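(* Let $a>b>0$ be arbitrary but fixed. Then a travelling wave solution of $$u_{tt}+u_{xxxx}+au^+-bu^-=1\ \ (x\in\mathbb{R},\,t>0),\qquad u(x,t)\to 1/a,\ u_x(x,t)\to 0\ \text{ for } |x|\to+\infty,$$ exists for any wave speed $c\in\mathbb{R}\setminus\{0\}$ satisfying $$\left(\frac{4a}{c^4},\frac{4b}{c^4}\right)\in\Omega^{-}.$$
   Context: Here $u^{\pm}=\max\{\pm u,0\}$, so $u=u^+-u^-$. A travelling wave solution with wave speed $c$ is a (classical) solution of the problem $$u_{tt}+u_{xxxx}+au^+-bu^-=1\ \ (x\in\mathbb{R},\,t>0),\qquad u(x,t)\to 1/a,\ u_x(x,t)\to 0\ \text{ for } |x|\to+\infty,$$ of the form $u(x,t)=y(x-ct)$ which is nontrivial, i.e. $y\not\equiv 1/a$; equivalently, $z=y-1/a$ is a nontrivial solution of $z^{(4)}+c^2z''+a(z+1/a)^+-b(z+1/a)^--1=0$ on $\mathbb{R}$ with $z,z'\to0$ as $|s|\to+\infty$. Let $\Omega:=(1,+\infty)\times(0,1)$, $H^2(\mathbb{R})=W^{2,2}(\mathbb{R})$, and for $(\alpha,\beta)\in\mathbb{R}^2$, $v\in H^2(\mathbb{R})$ put $$J(\alpha,\beta,v):=\int_{\mathbb{R}}\left((v'')^2-2(v')^2+\alpha(v^+)^2+\beta(v^-)^2\right)dx .$$ Define $\Omega^{-}:=\{(\alpha,\beta)\in\Omega:\ \exists v\in H^2(\mathbb{R}):\ J(\alpha,\beta,v)<0\}$. *)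

(* Defs.v *)
From HB Require Import structures.
From mathcomp Require Import all_boot all_order all_algebra.
From mathcomp Require Import all_classical all_reals all_analysis.

Set Implicit Arguments.
Unset Strict Implicit.
Unset Printing Implicit Defensive.

Import Order.TTheory GRing.Theory Num.Theory.
Import numFieldNormedType.Exports.

Local Open Scope classical_set_scope.
Local Open Scope ring_scope.

Section sobolev.
Context {R : realType}.
Implicit Types (v w phi : R -> R) (k : nat).

Local Notation mu := (@lebesgue_measure R).

Definition test_function phi : Prop :=
  (forall k x, derivable (phi^`(k)%classic) x 1) /\
  compact (closure [set x | phi x != 0]).

Definition weak_derivative k v w : Prop :=
  [/\ locally_integrable setT v, locally_integrable setT w &
      forall phi, test_function phi ->
        (\int[mu]_x (v x * phi^`(k)%classic x) = (-1) ^+ k * \int[mu]_x (w x * phi x))].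

Definition L2_weak_derivative k v : set (R -> R) :=
  [set w | w \in Lfun mu 2%:E /\ weak_derivative k v w].

(* Elements of H^2(R) are represented by functions, not by their classes
   modulo almost everywhere equality. *)
Definition H2 : set (R -> R) :=
  [set v | [/\ v \in Lfun mu 2%:E,
               L2_weak_derivative 1 v !=set0 &
               L2_weak_derivative 2 v !=set0]].

(* A representative of the weak derivative, which is unique up to almost
   everywhere equality; the default value is irrelevant on H2. *)
Definition wderiv k v : R -> R := xget (cst 0) (L2_weak_derivative k v).

(* The integrand is integrable when v belongs to H2, so that the real-valued
   integral is not a default value there. *)
Definition J (alpha beta : R) v : R :=
  \int[mu]_x ((wderiv 2 v x) ^+ 2 - 2 * (wderiv 1 v x) ^+ 2
              + alpha * (v^\+ x) ^+ 2 + beta * (v^\- x) ^+ 2).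

Definition Omega : set (R * R) := [set p | 1 < p.1 /\ 0 < p.2 < 1].

Definition Omega_minus : set (R * R) :=
  [set p | Omega p /\ exists2 v, H2 v & J p.1 p.2 v < 0].

End sobolev.

Section beam.
Context {R : realType}.
Implicit Types (a b c x t : R) (u : R -> R -> R) (k : nat).

Definition partial_x k u x t : R := (fun s => u s t)^`(k)%classic x.

Definition partial_t k u x t : R := (fun s => u x s)^`(k)%classic t.

(* derive1n is total, so the existence of the derivatives is required
   separately from their continuity. *)
Definition C4_in_x u : Prop := forall x t, 0 < t ->
  (forall k, (k < 4)%N -> derivable (fun s => partial_x k u s t) x 1) /\
  (forall k, (k <= 4)%N ->
     {for (x, t), continuous (fun p : R * R => partial_x k u p.1 p.2)}).

Definition C2_in_t u : Prop := forall x t, 0 < t ->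
  (forall k, (k < 2)%N -> derivable (fun s => partial_t k u x s) t 1) /\
  (forall k, (k <= 2)%N ->
     {for (x, t), continuous (fun p : R * R => partial_t k u p.1 p.2)}).

Definition classical_solution a b u : Prop :=
  [/\ C4_in_x u,
      C2_in_t u,
      forall x t, 0 < t ->
        partial_t 2 u x t + partial_x 4 u x t
        + a * Num.max (u x t) 0 - b * Num.max (- u x t) 0 = 1,
      forall t, 0 < t ->
        u x t @[x --> +oo] --> a^-1 /\ u x t @[x --> -oo] --> a^-1 &
      forall t, 0 < t ->
        partial_x 1 u x t @[x --> +oo] --> (0 : R) /\
        partial_x 1 u x t @[x --> -oo] --> (0 : R)].

Definition travelling_wave a b c u : Prop :=
  classical_solution a b u /\
  exists y : R -> R,
    (forall x t, 0 < t -> u x t = y (x - c * t)) /\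
    (exists s, y s != a^-1).

End beam.

(* Main.v *)
Require Import Defs.
From mathcomp Require Import all_boot all_order all_algebra.
From mathcomp Require Import all_classical all_reals all_analysis.
From mathcomp Require Import measurable_realfun ring lra.
Set Implicit Arguments.
Unset Strict Implicit.
Unset Printing Implicit Defensive.
Import Order.TTheory GRing.Theory Num.Theory.
Import numFieldNormedType.Exports.
Local Open Scope classical_set_scope.
Local Open Scope ring_scope.

(** A profile is obtained from the maximisation of a quadratic functional over
nonnegative densities.  No maximiser is needed: almost maximal densities almost
solve the profile equation, and almost solutions converge to an exact one.

Write [u(x,t) = y(x - c t)] and [y(s) = 1/a - K v(c s / sqrt 2)].  For
[K = 1/(a M)] the profile equation becomes [v'''' + 2 v'' + al v = ga (v - M)^+]
with [al = 4a/c^4 > 1] and [ga = 4(a - b)/c^4]; the threshold [M > 0] is free,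
because multiplying [v] by a positive constant only changes [M].  The symbol of
[L = D^4 + 2 D^2 + al] is at least [al - 1 > 0], and [L] is inverted by
convolution with an explicit, exponentially decaying kernel [k]
([resolvent_exists]).  In terms of [f = ga (v - M)^+] the equation reads
[f = ga (k * f - M)^+].  This is the Euler-Lagrange equation for maximising
[Q(f) = \int (k * f) f - ga^-1 \int f^2] over [f >= 0] with [\int f = 1]; since
[Q] is homogeneous of degree 2, the multiplier [M] is [sup Q] itself.  The
supremum is finite because [k] is bounded.

The supremum is positive because some [v] in [H^2] has negative energy.  Indeed,
let [w] be smooth with [J(al, be, w) < 0], where [be = al - ga = 4b/c^4], and
complete the square: for [f = ga w^-], the nonnegative energy [\int z (L z)] of
[z = w + k * f] equals [J(al, be, w) + Q(f)], so that [Q(f) > 0]; cutting [f]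
off far away changes little ([dual_form_gt0_smooth]).  If [v] is only in [H^2]
and [Q <= 0], then all mollifications [w] of [v] satisfy
[\int (2 (w')^2 + ga (w^-)^2) <= \int (w'')^2 + al \int w^2].  The right-hand
side is bounded by its value at [v] (Jensen and Tonelli), the integrand on the
left converges almost everywhere (Lebesgue points), and Fatou's lemma gives
[J(al, be, v) >= 0] ([dual_form_gt0]).

Let [f] be a density with [Q(f) >= M - t^2], and [h = ga (k * f - M)^+].
Comparing [f] with [f + t (h - f)] gives [\int (h - f)^2 = O(t)]
([near_maximizer_defect]), so [f] almost solves the equation.  Take such
densities [f_n] with [t = 1/(n+1)], translated so that [v_n = k * f_n] is at
least [M/2] at the origin.  The [v_n] are uniformly bounded and equi-Lipschitz,
hence converge locally uniformly along an ultrafilter to some [v] with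
[v(0) >= M/2].  Mass of [f_n] may escape to infinity, so the limit need not
correspond to a maximiser; but [k] decays, escaped mass is invisible at bounded
distance, and [v = k * (ga (v - M)^+)] holds exactly ([limit_fixed_point]).  As
[ga (v - M)^+] is integrable, [v] and its first three derivatives vanish at
infinity, and [y] is a nontrivial profile ([wave_exists]). *)

(** * Integration and calculus on the line *)

Section toolkit.
Context {R : realType}.
Implicit Types (f g h k u w : R -> R) (a b c e r x y A : R).
Local Notation mu := (@lebesgue_measure R).

Definition L1 f := mu.-integrable setT (EFin \o f).

Lemma cont_segment_integrable f a b :
  continuous f -> mu.-integrable `[a, b] (EFin \o f).
Proof.
move=> cf; apply: continuous_compact_integrable; first exact: segment_compact.
exact: continuous_subspaceT.
Qed.

Lemma is_derive_cont f x d : is_derive x 1 f d -> {for x, continuous f}.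
Proof. by move=> [df _]; apply/differentiable_continuous/derivable1_diffP. Qed.

Lemma ftc (F f : R -> R) a b : a <= b -> (forall x, is_derive x 1 F (f x)) ->
  continuous f -> \int[mu]_(x in `[a, b]) f x = F b - F a.
Proof.
move=> ab dF cf; move: ab; rewrite le_eqVlt => /predU1P[->|ab].
  by rewrite set_itv1 Rintegral_set1 subrr.
rewrite /Rintegral (@continuous_FTC2 _ f F a b)//.
- exact: continuous_subspaceT.
- split.
  + by move=> x _; case: (dF x).
  + by apply: cvg_at_right_filter; apply: is_derive_cont (dF a).
  + by apply: cvg_at_left_filter; apply: is_derive_cont (dF b).
- by move=> x _; rewrite derive1E; case: (dF x).
Qed.

Lemma L1S f (D : set R) : measurable D -> L1 f -> mu.-integrable D (EFin \o f).
Proof. by move=> mD; exact: integrableS. Qed.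

Lemma L1D f g : L1 f -> L1 g -> L1 (fun x => f x + g x).
Proof.
move=> lf lg; rewrite /L1.
have -> : EFin \o (fun x => f x + g x) = (EFin \o f) \+ (EFin \o g) by [].
exact: integrableD.
Qed.

Lemma L1Z c f : L1 f -> L1 (fun x => c * f x).
Proof.
move=> lf; rewrite /L1.
have -> : EFin \o (fun x => c * f x) = (fun x => c%:E * (EFin \o f) x)%E by [].
exact: integrableZl.
Qed.

Lemma L1B f g : L1 f -> L1 g -> L1 (fun x => f x - g x).
Proof.
move=> lf lg; have := L1D lf (L1Z (-1) lg).
by apply: eq_ind; congr L1; apply/funext => x; rewrite mulN1r.
Qed.

Lemma L1_measurable f : L1 f -> measurable_fun setT f.
Proof. by move/measurable_int/measurable_EFinP. Qed.

Lemma L1_le f g : measurable_fun setT f -> (forall x, `|f x| <= g x) ->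
  L1 g -> L1 f.
Proof.
move=> mf fg; apply: le_integrable => //; first exact/measurable_EFinP.
by move=> x _ /=; rewrite lee_fin (le_trans (fg x))// ler_norm.
Qed.

Lemma L1_abs f : L1 f -> L1 (fun x => `|f x|).
Proof. exact: integrable_norm. Qed.

Lemma L1_mul_bounded f g c : continuous g -> (forall x, `|g x| <= c) -> L1 f ->
  L1 (fun x => g x * f x).
Proof.
move=> cg gc lf; apply: (@L1_le _ (fun x => c * `|f x|)).
- by apply: measurable_funM; [exact: continuous_measurable_fun|exact: L1_measurable].
- by move=> x; rewrite normrM ler_wpM2r.
- exact/L1Z/L1_abs.
Qed.

Lemma Rint_le f g : L1 f -> L1 g -> (forall x, f x <= g x) ->
  \int[mu]_x f x <= \int[mu]_x g x.
Proof. by move=> lf lg fg; apply: le_Rintegral. Qed.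

Lemma RintD f g : L1 f -> L1 g ->
  \int[mu]_x (f x + g x) = \int[mu]_x f x + \int[mu]_x g x.
Proof. exact: RintegralD. Qed.

Lemma RintB f g : L1 f -> L1 g ->
  \int[mu]_x (f x - g x) = \int[mu]_x f x - \int[mu]_x g x.
Proof. exact: RintegralB. Qed.

Lemma RintZ c f : L1 f -> \int[mu]_x (c * f x) = c * \int[mu]_x f x.
Proof. exact: RintegralZl. Qed.

Lemma Rint_segments f : L1 f ->
  \int[mu]_(x in `[- n%:R, n%:R]) f x @[n --> \oo] --> \int[mu]_x f x.
Proof.
move=> lf.
pose f_ (n : nat) := (EFin \o f) \_ (`[- n%:R, n%:R] : set R).
have mE : measurable_fun setT (EFin \o f) by apply: measurable_int lf.
have mf_ n : measurable_fun setT (f_ n).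
  by apply/(measurable_restrictT _ (measurable_itv _)); exact: measurable_funTS.
have [||_ _ H] := @dominated_convergence _ _ R mu setT measurableT f_ (EFin \o f)
  (fun x => `|f x|%:E) mf_ mE _ (L1_abs lf).
- apply: aeW => x _ /=; apply: cvg_near_cst.
  near=> n; rewrite /f_ patchE mem_set//= in_itv/= -ler_norml.
  by near: n; exact: nbhs_infty_ger.
- apply: aeW => x n _; rewrite /f_ patchE; case: ifPn => _ //=.
  by rewrite normr0 lee_fin.
rewrite /Rintegral; apply: fine_cvg; rewrite fineK; last exact: integrable_fin_num.
by under eq_fun do rewrite integral_mkcond.
Unshelve. all: by end_near. Qed.

Lemma Rint_segment_supp f a b : (forall x, x \notin `[a, b] -> f x = 0) ->
  \int[mu]_x f x = \int[mu]_(x in `[a, b]) f x.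
Proof.
move=> fz; rewrite [RHS]Rintegral_mkcond; apply: eq_Rintegral => x _.
by rewrite patchE; case: ifPn => //; rewrite notin_setE /= => /negP/fz.
Qed.

Lemma shift_ge0 f (c : R) : continuous f -> (forall x, 0 <= f x) ->
  (\int[mu]_x (f x)%:E = \int[mu]_x (f (x + c))%:E)%E.
Proof.
move=> cf f0; have d x : is_derive x 1 (fun z : R => z + c) 1.
  by apply: is_derive_eq; rewrite addr0.
have dE : (fun z : R => z + c)^`()%classic = cst 1.
  by apply/funext => x; rewrite derive1E; case: (d x).
rewrite (@increasing_ge0_integration_by_substitutionT _ (fun z => z + c) f)//.
- by apply: eq_integral => x _ /=; rewrite dE /cst/= mulr1.
- by move=> x y; rewrite ltrD2r.
- by rewrite dE; exact: cst_continuous.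
- by rewrite dE; exact: is_cvg_cst.
- by rewrite dE; exact: is_cvg_cst.
- by apply/cvgrNyPle => A; near=> x; rewrite -lerBrDr; near: x; apply: nbhs_ninfty_le; exact: num_real.
- by apply/cvgryPge => A; near=> x; rewrite -lerBlDr; near: x; apply: nbhs_pinfty_ge; exact: num_real.
Unshelve. all: by end_near. Qed.

Lemma shift_L1 f (c : R) : continuous f -> L1 f -> L1 (fun x => f (x + c)).
Proof.
move=> cf /integrableP[mf fi]; have csh : continuous (fun x : R => x + c).
  by move=> x; apply: cvgD; [exact: cvg_id|exact: cvg_cst].
apply/integrableP; split.
  apply/measurable_EFinP; apply: continuous_measurable_fun => x.
  by apply: continuous_comp; [exact: csh|exact: cf].
have := @shift_ge0 (fun x => `|f x|) c _ _.
rewrite /= => <- //.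
by move=> x; apply: continuous_comp; [exact: cf|exact: norm_continuous].
Qed.

(** Substitution is available for nonnegative integrands; [f] is the difference
of the nonnegative functions [f + |f|] and [|f|]. *)
Lemma Rint_shift f (c : R) : continuous f -> L1 f ->
  \int[mu]_x f (x + c) = \int[mu]_x f x.
Proof.
move=> cf lf; have cn : continuous (fun x => `|f x|).
  by move=> x; apply: continuous_comp; [exact: cf|exact: norm_continuous].
have ln := L1_abs lf; have ls := shift_L1 c cf lf.
have cp : continuous (fun x => f x + `|f x|).
  by move=> x; apply: cvgD; [exact: cf|exact: cn].
have p0 x : 0 <= f x + `|f x| by rewrite -lerBlDl sub0r -normrN ler_norm.
have e1 : \int[mu]_x (f x + `|f x|) = \int[mu]_x (f (x + c) + `|f (x + c)|).
  by rewrite /Rintegral (shift_ge0 c cp).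
have e2 : \int[mu]_x `|f x| = \int[mu]_x `|f (x + c)|.
  by rewrite /Rintegral (shift_ge0 c cn).
move: e1; rewrite !RintD//; last exact: (shift_L1 c cn).
by rewrite e2 => /addIr.
Qed.

(** Monotone convergence along growing segments: for a continuous nonnegative
function, uniform bounds on segments are enough for integrability. *)
Lemma L1_segments f m : continuous f -> (forall x, 0 <= f x) ->
  (forall n : nat, \int[mu]_(x in `[- n%:R, n%:R]) f x <= m) -> L1 f.
Proof.
move=> cf f0 fm; have mf : measurable_fun setT (EFin \o f).
  by apply/measurable_EFinP; exact: continuous_measurable_fun.
apply/integrableP; split => //.
apply: (@le_lt_trans _ _ m%:E); last by rewrite ltry.
pose F (n : nat) := `[- n%:R : R, n%:R]%classic.
have bF : \bigcup_n F n = setT.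
  apply/seteqP; split => // x _.
  have [n _ xn] := nbhs_infty_ger `|x|.
  by exists n => //; rewrite /F /= in_itv /= -ler_norml; exact: (xn n (leqnn n)).
have H : (\int[mu]_(x in F i) `|f x|%:E @[i --> \oo] --> \int[mu]_x `|f x|%:E)%E.
  rewrite -bF; apply: ge0_nondecreasing_set_cvg_integral.
  - move=> i j ij; apply/subsetPset => x; rewrite /F/= !in_itv/= -!ler_norml.
    by move=> /le_trans; apply; rewrite ler_nat.
  - by move=> n; exact: measurable_itv.
  - move=> n; apply: measurable_funTS; apply/measurable_EFinP.
    by apply: measurableT_comp => //; exact/measurable_EFinP.
  - by move=> n x _; rewrite lee_fin.
move/cvg_lim : (H) => /= <- //; apply: lime_le; first by apply/cvg_ex; eexists; exact: H.
apply: nearW => n; rewrite -[leLHS]fineK.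
    rewrite lee_fin; apply: le_trans (fm n); rewrite /Rintegral.
    by rewrite le_eqVlt; apply/orP; left; apply/eqP; congr fine; apply: eq_integral => x _; rewrite ger0_norm.
  apply: integrable_fin_num; first exact: measurable_itv.
  by apply: integrable_norm; exact: cont_segment_integrable.
Qed.

Lemma L1_tail f (e : R) : L1 f -> 0 < e -> exists n : nat,
  \int[mu]_x `|f x| - \int[mu]_(x in `[- n%:R, n%:R]) `|f x| <= e.
Proof.
move=> lf e0; have /cvgrPdist_le /(_ _ e0)[n _ H] := Rint_segments (L1_abs lf).
exists n; apply: le_trans (ler_norm _) _; exact: H (leqnn n).
Qed.

Definition convolution k f x : R := \int[mu]_y (k (x - y) * f y).

Lemma segmentD f g a b : continuous f -> continuous g ->
  \int[mu]_(x in `[a, b]) (f x + g x) =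
  \int[mu]_(x in `[a, b]) f x + \int[mu]_(x in `[a, b]) g x.
Proof. by move=> cf cg; apply: RintegralD => //; exact: cont_segment_integrable. Qed.

Lemma segmentB f g a b : continuous f -> continuous g ->
  \int[mu]_(x in `[a, b]) (f x - g x) =
  \int[mu]_(x in `[a, b]) f x - \int[mu]_(x in `[a, b]) g x.
Proof. by move=> cf cg; apply: RintegralB => //; exact: cont_segment_integrable. Qed.

Lemma segmentZ f r a b : continuous f ->
  \int[mu]_(x in `[a, b]) (r * f x) = r * \int[mu]_(x in `[a, b]) f x.
Proof. by move=> cf; apply: RintegralZl => //; exact: cont_segment_integrable. Qed.

Lemma segment_le f g a b : continuous f -> continuous g ->
  (forall x, x \in `[a, b] -> f x <= g x) ->
  \int[mu]_(x in `[a, b]) f x <= \int[mu]_(x in `[a, b]) g x.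
Proof. by move=> cf cg fg; apply: le_Rintegral => //; exact: cont_segment_integrable. Qed.

Lemma segment_mono f a b : continuous f -> (forall x, 0 <= f x) -> a <= b ->
  \int[mu]_(x in `[- a, a]) f x <= \int[mu]_(x in `[- b, b]) f x.
Proof.
move=> cf f0 ab; have mf : measurable_fun setT (EFin \o f).
  by apply/measurable_EFinP; exact: continuous_measurable_fun.
rewrite /Rintegral fine_le//.
- by apply: integrable_fin_num => //; exact: cont_segment_integrable.
- by apply: integrable_fin_num => //; exact: cont_segment_integrable.
- apply: ge0_subset_integral => //.
  + exact: measurable_funTS.
  + by move=> x _; rewrite lee_fin.
  + by apply: subset_itv; rewrite bnd_simp// lerN2.
Qed.

Lemma segment_le_Rint f A : L1 f -> (forall x, 0 <= f x) ->
  \int[mu]_(x in `[- A, A]) f x <= \int[mu]_x f x.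
Proof.
move=> lf f0; rewrite Rintegral_mkcond; apply: Rint_le => //.
- rewrite /L1 -restrict_EFin; apply/integrable_restrict => //=; rewrite setTI.
  exact: (L1S (measurable_itv _) lf).
- by move=> y; rewrite patchE; case: ifPn.
Qed.

Lemma Rint_segment_near f e : continuous f -> L1 f -> 0 < e ->
  exists T : R, forall A, T <= A ->
    `|\int[mu]_x f x - \int[mu]_(x in `[- A, A]) f x| <= e.
Proof.
move=> cf lf e0.
have pos g d : continuous g -> L1 g -> (forall x, 0 <= g x) -> 0 < d ->
    exists T : R, forall A, T <= A ->
    0 <= \int[mu]_x g x - \int[mu]_(x in `[- A, A]) g x <= d.
  move=> cg lg g0 d0; have [n H] := L1_tail lg d0.
  exists n%:R => A nA; rewrite subr_ge0 segment_le_Rint//=.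
  have E D : \int[mu]_(x in D) `|g x| = \int[mu]_(x in D) g x.
    by apply: eq_Rintegral => x _; rewrite ger0_norm.
  by rewrite !E in H; rewrite (le_trans _ H)// lerB// segment_mono.
have ca : continuous (fun x => `|f x|).
  by move=> x; apply: continuous_comp; [exact: cf|exact: norm_continuous].
have cs : continuous (fun x => f x + `|f x|).
  by move=> x; apply: cvgD; [exact: cf|exact: ca].
have la := L1_abs lf; have ls := L1D lf la.
have s0 x : 0 <= f x + `|f x| by rewrite -lerBlDl sub0r -normrN ler_norm.
have [T1 H1] := pos _ e ca la (fun x => normr_ge0 _) e0.
have [T2 H2] := pos _ e cs ls s0 e0.
exists (Num.max T1 T2) => A; rewrite ge_max => /andP[/H1 + /H2].
rewrite RintD// segmentD// => /andP[? ?] /andP[? ?].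
by rewrite ler_norml; apply/andP; split; lra.
Qed.

Lemma contD f g : continuous f -> continuous g -> continuous (fun x => f x + g x).
Proof. by move=> cf cg x; apply: cvgD; [exact: cf|exact: cg]. Qed.

Lemma contB f g : continuous f -> continuous g -> continuous (fun x => f x - g x).
Proof. by move=> cf cg x; apply: cvgB; [exact: cf|exact: cg]. Qed.

Lemma contM f g : continuous f -> continuous g -> continuous (fun x => f x * g x).
Proof. by move=> cf cg x; apply: cvgM; [exact: cf|exact: cg]. Qed.

Lemma contZ f r : continuous f -> continuous (fun x => r * f x).
Proof. by move=> cf x; apply: cvgM; [exact: cvg_cst|exact: cf]. Qed.

Lemma contX f : continuous f -> continuous (fun x => f x ^+ 2).
Proof. by move=> cf x; apply: cvgM; exact: cf. Qed.

Lemma cont_abs f : continuous f -> continuous (fun x => `|f x|).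
Proof. by move=> cf x; apply: continuous_comp; [exact: cf|exact: norm_continuous]. Qed.

Lemma cont_max0 f : continuous f -> continuous (fun x => Num.max (f x) 0).
Proof. by move=> cf x; apply: continuous_max; [exact: cf|exact: cvg_cst]. Qed.

Lemma cont_shift f r : continuous f -> continuous (fun x => f (x + r)).
Proof.
move=> cf x; apply: continuous_comp; last exact: cf.
by apply: cvgD; [exact: cvg_id|exact: cvg_cst].
Qed.

Lemma is_derive_continuous f g : (forall x, is_derive x 1 f (g x)) -> continuous f.
Proof. by move=> df x; exact: is_derive_cont (df x). Qed.

Lemma continuous_subl x (g : R -> R) :
  continuous g -> continuous (fun y => g (x - y)).
Proof.
move=> cg y; apply: continuous_comp; last exact: cg.
by apply: cvgB; [exact: cvg_cst|exact: cvg_id].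
Qed.

Lemma is_derive_near f g x d : (\forall y \near x, f y = g y) ->
  is_derive x 1 f d -> is_derive x 1 g d.
Proof.
move=> fg [df fd].
have gd : h^-1 *: ((g \o shift x) (h *: 1) - g x) @[h --> 0^'] --> d.
  rewrite -fd; apply: cvg_trans df; apply: near_eq_cvg.
  have fgx : f x = g x by apply: nbhs_singleton fg.
  have c0 : (h *: 1 + x : R) @[h --> (0 : R)] --> x.
    rewrite -[in X in _ --> X](add0r x) -[in X in _ --> X](scale0r (1 : R)).
    by apply: cvgD; [apply: cvgZl; exact: cvg_id|exact: cvg_cst].
  have H : \forall h \near (0 : R)^', f (h *: 1 + x) = g (h *: 1 + x).
    by apply: cvg_within; exact: c0 fg.
  by rewrite -fgx; near=> h; rewrite /=; congr (_ *: (_ - _)); near: h.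
by apply: DeriveDef; [apply/cvg_ex; exists d|apply/cvg_lim].
Unshelve. all: by end_near. Qed.

Lemma derive_bound_lipschitz u u1 L : (forall x, is_derive x 1 u (u1 x)) ->
  (forall x, `|u1 x| <= L) -> forall x y, `|u x - u y| <= L * `|x - y|.
Proof.
move=> du u1L x y; wlog xy : x y / x <= y.
  move=> W; have [xy|/ltW yx] := leP x y; first exact: W.
  by rewrite distrC (distrC x); exact: W.
have [z _ E] := @MVT_segment R u u1 x y xy (fun x _ => du x)
   (continuous_subspaceT (is_derive_continuous du)).
by rewrite distrC E normrM (distrC x) ler_wpM2r.
Qed.

(** Iterated derivatives are identified by listing them: each function in the
list has the next one as derivative. *)
Lemma derive1n_chain (d : nat -> R -> R) N :
  (forall j, (j < N)%N -> forall x, is_derive x 1 (d j) (d j.+1 x)) ->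
  forall j, (j <= N)%N -> (d 0%N)^`(j)%classic = d j.
Proof.
move=> dd; elim=> [//|j IH] jN; rewrite derive1nS IH ?(ltnW jN)//.
by apply/funext => x; rewrite derive1E; case: (dd j jN x).
Qed.

Lemma is_derive_affine (d e : R -> R) (r s x : R) :
  (forall y, is_derive y 1 d (e y)) ->
  is_derive x 1 (fun x => d (r * x + s)) (r * e (r * x + s)).
Proof.
move=> de.
have h : is_derive x 1 (fun x : R => r * x + s) r.
  by apply: is_derive_eq; rewrite /GRing.scale/=; ring.
have H := @is_derive1_comp _ d (fun x : R => r * x + s) x _ _ (de (r * x + s)) h.
by apply: (is_derive_eq H); rewrite mulrC.
Qed.

Lemma mul_small x y e : 0 <= e <= 1 -> `|x| <= e -> `|y| <= e -> `|x * y| <= e.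
Proof.
move=> /andP[e0 e1] xe ye; rewrite normrM (le_trans (ler_pM _ _ xe ye))//.
by rewrite ler_piMr.
Qed.

Lemma norm_le_of_sqr x e : 0 <= e -> x ^+ 2 <= e ^+ 2 -> `|x| <= e.
Proof.
by move=> e0; rewrite -real_normK ?num_real// ler_pXn2r ?nnegrE.
Qed.

Lemma norm_lin_le (a b A B E : R) : `|A| <= E -> `|B| <= E ->
  `|a * A + b * B| <= (`|a| + `|b|) * E.
Proof.
move=> AE BE; rewrite (le_trans (ler_normD _ _))// !normrM mulrDl.
by rewrite lerD// ler_wpM2l.
Qed.

Lemma young_le (a b e : R) : 0 < e -> `|a * b| <= e * a ^+ 2 + e^-1 * b ^+ 2.
Proof.
move=> e0; have ei : 0 < e^-1 by rewrite invr_gt0.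
have h1 : 0 <= e^-1 * (e * a - b) ^+ 2 by rewrite mulr_ge0 ?sqr_ge0 ?ltW.
have h2 : 0 <= e^-1 * (e * a + b) ^+ 2 by rewrite mulr_ge0 ?sqr_ge0 ?ltW.
have h3 : 0 <= e * a ^+ 2 by rewrite mulr_ge0 ?sqr_ge0 ?ltW.
have h4 : 0 <= e^-1 * b ^+ 2 by rewrite mulr_ge0 ?sqr_ge0 ?ltW.
have e1 : e^-1 * (e * a - b) ^+ 2 = e * a ^+ 2 - 2 * (a * b) + e^-1 * b ^+ 2.
  by field; rewrite gt_eqF.
have e2 : e^-1 * (e * a + b) ^+ 2 = e * a ^+ 2 + 2 * (a * b) + e^-1 * b ^+ 2.
  by field; rewrite gt_eqF.
by rewrite ler_norml; apply/andP; split; lra.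
Qed.

End toolkit.

(** * Primitives on half-lines and exponential weights *)

Section halfline.
Context {R : realType}.
Implicit Types (f g : R -> R) (a b x y : R).
Local Notation mu := (@lebesgue_measure R).

Lemma is_derive_left_integral g x : continuous g ->
  (forall y, mu.-integrable `]-oo, y] (EFin \o g)) ->
  is_derive x 1 (fun x => \int[mu]_(t in `]-oo, x]) g t) (g x).
Proof.
move=> cg ig.
have x1 : x < x + 1 by rewrite ltrDl.
have [|dF FE] := @continuous_FTC1 _ g -oo%O x _ x1 (ig _) _ (cg x).
  by rewrite ltNyr.
by apply: DeriveDef; [exact: dF|rewrite -derive1E FE].
Qed.

Lemma is_derive_right_integral g x : continuous g ->
  (forall y, mu.-integrable `]y, +oo[ (EFin \o g)) ->
  is_derive x 1 (fun x => \int[mu]_(t in `]x, +oo[) g t) (- g x).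
Proof.
move=> cg ig; set a := x - 1.
have ax : a < x by rewrite /a ltrBlDr ltrDl.
have x1 : x < x + 1 by rewrite ltrDl.
have iga y : mu.-integrable `]a, y] (EFin \o g).
  by apply: integrableS (ig a) => //; apply: subset_itvl.
pose P y := \int[mu]_(t in `]a, y]) g t.
have [|dF FE] := @continuous_FTC1 _ g (BRight a) x _ x1 (iga _) _ (cg x).
  exact: ax.
have dP : is_derive x 1 P (g x).
  by apply: DeriveDef; [exact: dF|rewrite -derive1E FE].
(* near [x] the integral is a constant minus the primitive [P] starting at [a] *)
apply: (@is_derive_near _ (fun y => \int[mu]_(t in `]a, +oo[) g t - P y)).
  near=> y; rewrite /P (@Rintegral_itvB _ g (BRight a) +oo%O y)//.
  by rewrite /Order.le/=; near: y; exact: lt_le_nbhsr.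
by apply: is_derive_eq; rewrite add0r mul1r.
Unshelve. all: by end_near. Qed.

Lemma integrable_weighted f g c (D : set R) : measurable D -> continuous g ->
  L1 f -> (forall x, D x -> `|g x| <= c) ->
  mu.-integrable D (EFin \o (fun x => g x * f x)).
Proof.
move=> mD cg lf gc; have c0 x : D x -> 0 <= c by move/gc; apply: le_trans.
apply: (@le_integrable _ _ _ mu D mD _ (EFin \o (fun x => c * `|f x|))).
- apply/measurable_EFinP; apply: measurable_funTS; apply: measurable_funM.
    exact: continuous_measurable_fun.
  exact: L1_measurable.
- move=> x Dx /=; rewrite lee_fin !normrM normr_id (ger0_norm (c0 x Dx)) ler_wpM2r//.
  exact: gc.
- exact/L1S/L1Z/L1_abs.
Qed.

End halfline.

Section decay.
Context {R : realType}.
Implicit Types (f g : R -> R) (a b x y : R).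
Local Notation mu := (@lebesgue_measure R).
Variable p : R.
Hypothesis p0 : 0 < p.

(** The exponential weight that dominates the kernel of the resolvent. *)
Definition expw (x : R) : R := expR (- (p * `|x|)).

Lemma expw_gt0 x : 0 < expw x. Proof. exact: expR_gt0. Qed.

Lemma expw_le1 x : expw x <= 1.
Proof. by rewrite -expR0 ler_expR oppr_le0 mulr_ge0// ltW. Qed.

Lemma continuous_expw : continuous expw.
Proof.
move=> x; apply: continuous_comp; last exact: continuous_expR.
apply: cvgN; apply: cvgM; first exact: cvg_cst.
exact: norm_continuous.
Qed.

Definition expconv f : R -> R := convolution expw (fun y => `|f y|).

Lemma L1_expw f x : L1 f -> L1 (fun y => expw (x - y) * `|f y|).
Proof.
move=> lf; apply: (@L1_mul_bounded _ _ _ 1); last exact: L1_abs.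
  exact: continuous_subl continuous_expw.
by move=> y; rewrite ger0_norm ?expw_le1// ltW// expw_gt0.
Qed.

Lemma expconv_ge0 f x : 0 <= expconv f x.
Proof. by apply: Rintegral_ge0 => y _; rewrite mulr_ge0// ltW// expw_gt0. Qed.

Lemma expconv_le f x : L1 f -> expconv f x <= \int[mu]_y `|f y|.
Proof.
move=> lf; apply: Rint_le; [exact: L1_expw|exact: L1_abs|] => y.
by rewrite ler_piMl ?expw_le1.
Qed.

Lemma expw_small (e : R) : 0 < e -> exists T : R, forall x, T <= `|x| -> expw x <= e.
Proof.
move=> e0; exists (- ln e / p) => x; rewrite ler_pdivrMr// => H.
rewrite /expw -[leRHS](@lnK _ e)// ler_expR lerNl.
by rewrite mulrC.
Qed.

(** Split the integral at a segment that carries all of the mass of [f] but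
[e/2]: far from the segment the weight is small on it, and off the segment the
weight is at most 1. *)
Lemma expconv_small f (e : R) : L1 f -> 0 < e ->
  exists T : R, forall x, T <= `|x| -> expconv f x <= e.
Proof.
move=> lf e0; have lfa := L1_abs lf.
have e20 : 0 < e / 2 by rewrite divr_gt0.
have [n ntail] := L1_tail lf e20.
set I := \int[mu]_x `|f x| in ntail.
have I0 : 0 <= I by apply: Rintegral_ge0.
have e2I : 0 < e / 2 / (I + 1) by rewrite divr_gt0// ltr_wpDl.
have [T HT] := expw_small e2I.
exists (T + n%:R) => x Tx.
pose g y := `|f y| - ((fun y => `|f y|) \_ `[- n%:R, n%:R]) y.
have lr : L1 ((fun y => `|f y|) \_ `[- n%:R, n%:R]).
  rewrite /L1 -restrict_EFin.
  have H : mu.-integrable `[- n%:R, n%:R]%classic (EFin \o (fun y => `|f y|)).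
    exact: L1S (measurable_itv _) lfa.
  by apply/integrable_restrict => //=; rewrite setTI.
apply: (@le_trans _ _ (\int[mu]_y (e / 2 / (I + 1) * `|f y| + g y))).
  apply: Rint_le; first exact: L1_expw.
    by apply: L1D; [exact: L1Z|exact: L1B].
  move=> y; rewrite /g patchE; case: ifPn => [|_]; last first.
    rewrite subr0; apply: (@le_trans _ _ (1 * `|f y|)).
      by rewrite ler_wpM2r// expw_le1.
    by rewrite mul1r lerDr mulr_ge0// ltW.
  rewrite inE/= in_itv/= -ler_norml => yn; rewrite subrr addr0 ler_wpM2r//.
  apply: HT; rewrite (le_trans _ (lerB_dist _ _))// lerBrDr.
  by rewrite (le_trans _ Tx)// lerD2l.
rewrite RintD; [|exact: L1Z|exact: L1B].
rewrite RintZ// RintB// -Rintegral_mkcond -/I [leRHS](splitr e) lerD//.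
rewrite mulrAC ler_pdivrMr ?ltr_wpDl//; apply: ler_wpM2l; first exact: ltW.
by rewrite lerDl.
Qed.

End decay.

(** * Causal and anticausal convolution with damped oscillations *)

Section green.
Context {R : realType}.
Implicit Types (f g : R -> R) (a b x y : R).
Local Notation mu := (@lebesgue_measure R).

Lemma is_derive_mulD (u v A B : R -> R) x u' v' A' B' :
  is_derive x 1 u u' -> is_derive x 1 v v' ->
  is_derive x 1 A A' -> is_derive x 1 B B' ->
  is_derive x 1 (fun x => u x * A x + v x * B x)
    (u' * A x + u x * A' + (v' * B x + v x * B')).
Proof.
move=> du dv dA dB; apply: is_derive_eq.
by rewrite /GRing.scale/=; ring.
Qed.

Lemma is_derive_mulB (u v A B : R -> R) x u' v' A' B' :
  is_derive x 1 u u' -> is_derive x 1 v v' ->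
  is_derive x 1 A A' -> is_derive x 1 B B' ->
  is_derive x 1 (fun x => u x * A x - v x * B x)
    (u' * A x + u x * A' - (v' * B x + v x * B')).
Proof.
move=> du dv dA dB; apply: is_derive_eq.
by rewrite /GRing.scale/=; ring.
Qed.

Variables p q : R.
Hypothesis p0 : 0 < p.

Let ca x : R := expR (- (p * x)) * cos (q * x).
Let sa x : R := expR (- (p * x)) * sin (q * x).
Let cb x : R := expR (p * x) * cos (q * x).
Let sb x : R := expR (p * x) * sin (q * x).

Let dca x : is_derive x 1 ca (- p * ca x - q * sa x).
Proof. by apply: is_derive_eq; rewrite /ca /sa /GRing.scale/=; ring. Qed.
Let dsa x : is_derive x 1 sa (- p * sa x + q * ca x).
Proof. by apply: is_derive_eq; rewrite /ca /sa /GRing.scale/=; ring. Qed.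
Let dcb x : is_derive x 1 cb (p * cb x - q * sb x).
Proof. by apply: is_derive_eq; rewrite /cb /sb /GRing.scale/=; ring. Qed.
Let dsb x : is_derive x 1 sb (p * sb x + q * cb x).
Proof. by apply: is_derive_eq; rewrite /cb /sb /GRing.scale/=; ring. Qed.

Let cca : continuous ca. Proof. by move=> x; exact: is_derive_cont (dca x). Qed.
Let csa : continuous sa. Proof. by move=> x; exact: is_derive_cont (dsa x). Qed.
Let ccb : continuous cb. Proof. by move=> x; exact: is_derive_cont (dcb x). Qed.
Let csb : continuous sb. Proof. by move=> x; exact: is_derive_cont (dsb x). Qed.

Let norm_cos x : `|cos x| <= 1. Proof. by rewrite ler_norml cos_geN1 cos_le1. Qed.
Let norm_sin x : `|sin x| <= 1. Proof. by rewrite ler_norml sin_geN1 sin_le1. Qed.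

Let exp_mul_le x u : `|u| <= 1 -> `|expR x * u| <= expR x.
Proof. by move=> u1; rewrite normrM ger0_norm ?expR_ge0// ler_piMr// expR_ge0. Qed.

Let expB x y : expR (- (p * (x - y))) = expR (- (p * x)) * expR (p * y).
Proof. by rewrite -expRD; congr expR; ring. Qed.

Let caB x y : ca (x - y) = ca x * cb y + sa x * sb y.
Proof. by rewrite /ca /cb /sa /sb expB mulrBr cosB; ring. Qed.
Let saB x y : sa (x - y) = sa x * cb y - ca x * sb y.
Proof. by rewrite /ca /cb /sa /sb expB mulrBr sinB; ring. Qed.

Let cacb x : ca x * cb x + sa x * sb x = 1.
Proof. by rewrite -caB subrr /ca !mulr0 oppr0 expR0 cos0 mulr1. Qed.
Let sacb x : sa x * cb x - ca x * sb x = 0.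
Proof. by rewrite -saB subrr /sa !mulr0 sin0 mulr0. Qed.

Section fixed.
Variable f : R -> R.
Hypothesis (cf : continuous f) (lf : L1 f).

Let left_int (u : R -> R) x := \int[mu]_(t in `]-oo, x]) (u t * f t).
Let right_int (u : R -> R) x := \int[mu]_(t in `]x, +oo[) (u t * f t).

(** The integrals of [f] against damped oscillations, over the past
([left]) and the future ([right]) of [x]; see [left_cosE] to [right_sinE].  By
the addition formulas the kernels split into products of a function of [x] and a
function of [y], which leaves primitives of fixed functions and makes
differentiation elementary. *)
Definition left_cos x := ca x * left_int cb x + sa x * left_int sb x.
Definition left_sin x := sa x * left_int cb x - ca x * left_int sb x.
Definition right_cos x := cb x * right_int ca x + sb x * right_int sa x.
Definition right_sin x := cb x * right_int sa x - sb x * right_int ca x.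

Let il (u : R -> R) x :
  continuous (fun y => expR (p * y) * u y) -> (forall y, `|u y| <= 1) ->
  mu.-integrable `]-oo, x] (EFin \o (fun y => expR (p * y) * u y * f y)).
Proof.
move=> cu u1; apply: (@integrable_weighted _ f _ (expR (p * x))) => //.
move=> y /=; rewrite in_itv/= => yx; rewrite (le_trans (exp_mul_le _ (u1 y)))//.
by rewrite ler_expR ler_pM2l.
Qed.

Let ir (u : R -> R) x :
  continuous (fun y => expR (- (p * y)) * u y) -> (forall y, `|u y| <= 1) ->
  mu.-integrable `]x, +oo[ (EFin \o (fun y => expR (- (p * y)) * u y * f y)).
Proof.
move=> cu u1; apply: (@integrable_weighted _ f _ (expR (- (p * x)))) => //.
move=> y /=; rewrite in_itv/= andbT => /ltW yx; rewrite (le_trans (exp_mul_le _ (u1 y)))//.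
by rewrite ler_expR lerN2 ler_pM2l.
Qed.

Let icb x : mu.-integrable `]-oo, x] (EFin \o (fun y => cb y * f y)).
Proof. by apply: (@il (fun y => cos (q * y))). Qed.
Let isb x : mu.-integrable `]-oo, x] (EFin \o (fun y => sb y * f y)).
Proof. by apply: (@il (fun y => sin (q * y))). Qed.
Let ica x : mu.-integrable `]x, +oo[ (EFin \o (fun y => ca y * f y)).
Proof. by apply: (@ir (fun y => cos (q * y))). Qed.
Let isa x : mu.-integrable `]x, +oo[ (EFin \o (fun y => sa y * f y)).
Proof. by apply: (@ir (fun y => sin (q * y))). Qed.

Let cM g : continuous g -> continuous (fun y => g y * f y).
Proof. by move=> cg y; apply: cvgM; [exact: cg|exact: cf]. Qed.

Let dl_cb x : is_derive x 1 (left_int cb) (cb x * f x).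
Proof. by apply: (is_derive_left_integral _ (cM ccb)) icb. Qed.
Let dl_sb x : is_derive x 1 (left_int sb) (sb x * f x).
Proof. by apply: (is_derive_left_integral _ (cM csb)) isb. Qed.
Let dr_ca x : is_derive x 1 (right_int ca) (- (ca x * f x)).
Proof. by apply: (is_derive_right_integral _ (cM cca)) ica. Qed.
Let dr_sa x : is_derive x 1 (right_int sa) (- (sa x * f x)).
Proof. by apply: (is_derive_right_integral _ (cM csa)) isa. Qed.

Lemma is_derive_left_cos x : is_derive x 1 left_cos (- p * left_cos x - q * left_sin x + f x).
Proof.
apply: (is_derive_eq (is_derive_mulD (dca x) (dsa x) (dl_cb x) (dl_sb x))); rewrite /left_cos /left_sin /right_cos /right_sin.
have /= h := congr1 (fun z => z * f x) (cacb x); lra.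
Qed.

Lemma is_derive_left_sin x : is_derive x 1 left_sin (- p * left_sin x + q * left_cos x).
Proof.
apply: (is_derive_eq (is_derive_mulB (dsa x) (dca x) (dl_cb x) (dl_sb x))); rewrite /left_cos /left_sin /right_cos /right_sin.
have /= h := congr1 (fun z => z * f x) (sacb x); lra.
Qed.

Lemma is_derive_right_cos x : is_derive x 1 right_cos (p * right_cos x + q * right_sin x - f x).
Proof.
apply: (is_derive_eq (is_derive_mulD (dcb x) (dsb x) (dr_ca x) (dr_sa x))); rewrite /left_cos /left_sin /right_cos /right_sin.
have /= h := congr1 (fun z => z * f x) (cacb x); lra.
Qed.

Lemma is_derive_right_sin x : is_derive x 1 right_sin (p * right_sin x - q * right_cos x).
Proof.
apply: (is_derive_eq (is_derive_mulB (dcb x) (dsb x) (dr_sa x) (dr_ca x))); rewrite /left_cos /left_sin /right_cos /right_sin.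
have /= h := congr1 (fun z => z * f x) (sacb x); lra.
Qed.

Let iZ (D : set R) g a : measurable D -> mu.-integrable D (EFin \o g) ->
  mu.-integrable D (EFin \o (fun x => a * g x)).
Proof.
move=> mD ig.
have -> : EFin \o (fun x => a * g x) = (fun x => a%:E * (EFin \o g) x)%E by [].
exact: integrableZl.
Qed.

Let intD (D : set R) g1 g2 a b : measurable D ->
  mu.-integrable D (EFin \o (fun y => g1 y * f y)) ->
  mu.-integrable D (EFin \o (fun y => g2 y * f y)) ->
  \int[mu]_(y in D) ((a * g1 y + b * g2 y) * f y) =
  a * \int[mu]_(y in D) (g1 y * f y) + b * \int[mu]_(y in D) (g2 y * f y).
Proof.
move=> mD i1 i2; rewrite -!RintegralZl// -RintegralD//.
- by apply: eq_Rintegral => y _; ring.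
- exact: iZ.
- exact: iZ.
Qed.

Lemma left_cosE x : left_cos x = \int[mu]_(y in `]-oo, x]) (ca (x - y) * f y).
Proof.
rewrite /left_cos -intD//; apply: eq_Rintegral => y _; by rewrite caB.
Qed.

Lemma left_sinE x : left_sin x = \int[mu]_(y in `]-oo, x]) (sa (x - y) * f y).
Proof.
rewrite /left_sin -mulNr -intD//; apply: eq_Rintegral => y _; by rewrite saB mulNr.
Qed.

Lemma right_cosE x : right_cos x = \int[mu]_(y in `]x, +oo[) (ca (y - x) * f y).
Proof.
rewrite /right_cos -intD//; apply: eq_Rintegral => y _; rewrite caB; congr (_ * _); ring.
Qed.

Lemma right_sinE x : right_sin x = \int[mu]_(y in `]x, +oo[) (sa (y - x) * f y).
Proof.
rewrite /right_sin -mulNr -intD//; apply: eq_Rintegral => y _; rewrite saB; congr (_ * _); ring.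
Qed.

Let bound (D : set R) (u : R -> R) x : measurable D -> continuous u ->
  (forall y, D y -> `|u y| <= expw p (x - y)) ->
  mu.-integrable D (EFin \o (fun y => u y * f y)) /\
  `|\int[mu]_(y in D) (u y * f y)| <= expconv p f x.
Proof.
move=> mD cu uD.
have i1 : mu.-integrable D (EFin \o (fun y => u y * f y)).
  apply: (@integrable_weighted _ f u 1) => // y Dy.
  by rewrite (le_trans (uD _ Dy))// expw_le1.
split=> //.
have h := @le_normr_Rintegral _ _ R mu D (fun y => u y * f y) mD i1.
apply: (le_trans h) => {h}.
rewrite /expconv Rintegral_mkcond.
have i2 : L1 (fun y => expw p (x - y) * `|f y|) by exact: L1_expw.
apply: Rint_le => //.
  apply: (@L1_le _ _ (fun y => expw p (x - y) * `|f y|)) => //.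
    apply/(measurable_restrictT _ mD); apply: measurableT_comp => //.
    by apply/measurable_EFinP; apply: measurable_int i1.
  move=> y; rewrite patchE; case: ifPn => [|_].
    rewrite inE => Dy; rewrite normr_id normrM ler_wpM2r//; exact: uD.
  by rewrite normr0 mulr_ge0// ltW// expw_gt0.
move=> y; rewrite patchE; case: ifPn => [|_].
  by rewrite inE => Dy; rewrite normrM ler_wpM2r//; exact: uD.
by rewrite mulr_ge0// ltW// expw_gt0.
Qed.

Let ca_le y : 0 <= y -> `|ca y| <= expw p y.
Proof. by move=> y0; rewrite (le_trans (exp_mul_le _ _))// /expw ger0_norm. Qed.
Let sa_le y : 0 <= y -> `|sa y| <= expw p y.
Proof. by move=> y0; rewrite (le_trans (exp_mul_le _ _))// /expw ger0_norm. Qed.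

Let contl (u : R -> R) x : continuous u -> continuous (fun y => u (x - y)).
Proof. exact: continuous_subl. Qed.
Let contr (u : R -> R) x : continuous u -> continuous (fun y => u (y - x)).
Proof.
move=> cu y; apply: continuous_comp; last exact: cu.
by apply: cvgB; [exact: cvg_id|exact: cvg_cst].
Qed.

Let bl (u : R -> R) x : continuous u -> (forall y, 0 <= y -> `|u y| <= expw p y) ->
  mu.-integrable `]-oo, x] (EFin \o (fun y => u (x - y) * f y)) /\
  `|\int[mu]_(y in `]-oo, x]) (u (x - y) * f y)| <= expconv p f x.
Proof.
move=> cu ue; apply: bound => //; first exact: contl.
by move=> y /=; rewrite in_itv/= => yx; apply: ue; rewrite subr_ge0.
Qed.

Let br (u : R -> R) x : continuous u -> (forall y, 0 <= y -> `|u y| <= expw p y) ->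
  mu.-integrable `]x, +oo[ (EFin \o (fun y => u (y - x) * f y)) /\
  `|\int[mu]_(y in `]x, +oo[) (u (y - x) * f y)| <= expconv p f x.
Proof.
move=> cu ue; apply: bound => //; first exact: contr.
move=> y /=; rewrite in_itv/= andbT => /ltW yx.
have -> : expw p (x - y) = expw p (y - x) by rewrite /expw distrC.
by apply: ue; rewrite subr_ge0.
Qed.

Lemma left_cos_le x : `|left_cos x| <= expconv p f x.
Proof. by rewrite left_cosE; apply: (bl x cca ca_le).2. Qed.
Lemma left_sin_le x : `|left_sin x| <= expconv p f x.
Proof. by rewrite left_sinE; apply: (bl x csa sa_le).2. Qed.
Lemma right_cos_le x : `|right_cos x| <= expconv p f x.
Proof. by rewrite right_cosE; apply: (br x cca ca_le).2. Qed.
Lemma right_sin_le x : `|right_sin x| <= expconv p f x.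
Proof. by rewrite right_sinE; apply: (br x csa sa_le).2. Qed.

(** An even kernel that is a damped oscillation on each half-line: its
convolution is a sum of a causal and an anticausal part. *)
Lemma kernelE (k : R -> R) c a b x : continuous k ->
  (forall y, `|k y| <= c) ->
  (forall y, 0 <= y -> k y = a * ca y + b * sa y) ->
  (forall y, y <= 0 -> k y = a * ca (- y) + b * sa (- y)) ->
  \int[mu]_y (k (x - y) * f y) = a * (left_cos x + right_cos x) + b * (left_sin x + right_sin x).
Proof.
move=> ck k1 kp kn.
have -> : [set: R] = `]-oo, x]%classic `|` `]x, +oo[%classic.
  by apply/seteqP; split => // y _ /=; rewrite !in_itv/= andbT; case: (leP y x); [left|right].
rewrite Rintegral_setU//=; last 2 first.
- apply: L1S; first exact: measurableU.
  by apply: (@L1_mul_bounded _ _ _ c) => //; exact: contl.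
- apply/disj_setPS => y [/=]; rewrite !in_itv/= andbT => yx.
  by rewrite ltNge yx.
have -> : \int[mu]_(y in `]-oo, x]) (k (x - y) * f y) = a * left_cos x + b * left_sin x.
  rewrite left_cosE left_sinE -intD//; [|exact: (bl x cca ca_le).1|exact: (bl x csa sa_le).1].
  apply: eq_Rintegral => y; rewrite inE/= in_itv/= => yx.
  by rewrite kp// subr_ge0.
have -> : \int[mu]_(y in `]x, +oo[) (k (x - y) * f y) = a * right_cos x + b * right_sin x.
  rewrite right_cosE right_sinE -intD//; [|exact: (br x cca ca_le).1|exact: (br x csa sa_le).1].
  apply: eq_Rintegral => y; rewrite inE/= in_itv/= andbT => yx.
  by rewrite kn ?opprB// subr_le0 ltW.
ring.
Qed.

End fixed.
End green.

(** * The resolvent of the fourth-order operator *)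

Section resolvent.
Context {R : realType}.
Local Notation mu := (@lebesgue_measure R).

Implicit Types (x y : R) (f g k : R -> R).

(** All that is used of the inverse of [D^4 + 2 D^2 + al]: convolution with [k]
solves the equation classically, and the solution and its first three
derivatives inherit the decay rate [p] of the kernel, with one constant [c]. *)
Definition resolvent_kernel (al p c : R) (k : R -> R) : Prop :=
  [/\ 0 < p, continuous k, forall x : R, `|k x| <= c * expw p x &
  forall f : R -> R, continuous f -> L1 f -> exists u1 u2 u3 : R -> R,
  [/\ forall x : R, is_derive x 1 (convolution k f) (u1 x),
      forall x : R, is_derive x 1 u1 (u2 x),
      forall x : R, is_derive x 1 u2 (u3 x),
      forall x : R, is_derive x 1 u3 (f x - 2 * u2 x - al * convolution k f x) &
      forall x : R, [/\ `|convolution k f x| <= c * expconv p f x,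
        `|u1 x| <= c * expconv p f x, `|u2 x| <= c * expconv p f x
        & `|u3 x| <= c * expconv p f x]]].

(** The characteristic roots are [+-p +- i q] with [p^2 = (sqrt al - 1)/2] and
[q^2 = (sqrt al + 1)/2], and [al > 1] is what makes [p] positive.  The kernel is
[exp(-p|x|) (a cos(q|x|) + b sin(q|x|))], where [a] and [b] are chosen so that
it is twice continuously differentiable and its third derivative jumps by 1 at
the origin. *)
Lemma resolvent_exists (al : R) : 1 < al -> exists p c k, resolvent_kernel al p c k.
Proof.
move=> al1; set m : R := Num.sqrt al.
have al0 : 0 <= al by rewrite (le_trans _ (ltW al1)).
have m2 : m ^+ 2 = al by rewrite sqr_sqrtr.
have m1 : 1 < m by rewrite -(@ltr_pXn2r _ 2)// ?nnegrE ?sqrtr_ge0// m2 expr1n.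
have m0 : 0 < m by exact: lt_trans m1.
set p : R := Num.sqrt ((m - 1) / 2); set q : R := Num.sqrt ((m + 1) / 2).
have p2 : p ^+ 2 = (m - 1) / 2 by rewrite sqr_sqrtr// divr_ge0// subr_ge0 ltW.
have q2 : q ^+ 2 = (m + 1) / 2 by rewrite sqr_sqrtr// divr_ge0// addr_ge0// ltW.
have p0 : 0 < p by rewrite sqrtr_gt0 divr_gt0// subr_gt0.
have q0 : 0 < q by rewrite sqrtr_gt0 divr_gt0// addr_gt0.
(* [a p = b q] removes the jump of the first derivative, which then is
   [b1 exp(-p x) sin(q x)] for positive [x] *)
pose a : R := (4 * p * m)^-1; pose b : R := (4 * q * m)^-1; pose b1 : R := - (4 * p * q)^-1.
pose ca (x : R) := expR (- (p * x)) * cos (q * x).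
pose sa (x : R) := expR (- (p * x)) * sin (q * x).
pose k (x : R) : R := a * ca `|x| + b * sa `|x|.
have expw0 x : 0 <= expw p x by exact/ltW/expw_gt0.
have ca_le x : `|ca `|x| | <= expw p x.
  rewrite normrM ger0_norm ?expR_ge0// ler_piMr ?expR_ge0//.
  by rewrite ler_norml cos_geN1 cos_le1.
have sa_le x : `|sa `|x| | <= expw p x.
  rewrite normrM ger0_norm ?expR_ge0// ler_piMr ?expR_ge0//.
  by rewrite ler_norml sin_geN1 sin_le1.
have ck : continuous k.
  move=> x; have nx : {for x, continuous (fun x : R => `|x|)} by exact: norm_continuous.
  have cl (z c : R) : {for z, continuous (fun z : R => c * z)}.
    by apply: cvgM; [exact: cvg_cst|exact: cvg_id].
  have clN (z c : R) : {for z, continuous (fun z : R => - (c * z))} by apply: cvgN; exact: cl.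
  have cca z : {for z, continuous ca}.
    apply: cvgM; apply: continuous_comp.
    - exact: clN.
    - exact: continuous_expR.
    - exact: cl.
    - exact: continuous_cos.
  have csa z : {for z, continuous sa}.
    apply: cvgM; apply: continuous_comp.
    - exact: clN.
    - exact: continuous_expR.
    - exact: cl.
    - exact: continuous_sin.
  apply: cvgD; apply: cvgM; try exact: cvg_cst.
    by apply: continuous_comp; [exact: nx|exact: cca].
  by apply: continuous_comp; [exact: nx|exact: csa].
pose c0 : R := `|a| + `|b|.
have k_le x : `|k x| <= c0 * expw p x by apply: norm_lin_le.
have k_le1 x : `|k x| <= c0.
  by rewrite (le_trans (k_le x))// ler_piMr ?expw_le1// addr_ge0.
pose d2 : R := `|b1 * q| + `|- (b1 * p)|.
pose d3 : R := `|b1 * (- 2 * p * q)| + `|b1 * (p ^+ 2 - q ^+ 2)|.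
pose c : R := 2 * (c0 + `|b1| + d2 + d3).
have [n1 n2 n3 n4] : [/\ 0 <= c0, 0 <= `|b1|, 0 <= d2 & 0 <= d3].
  by split; rewrite ?addr_ge0.
have c0c : c0 <= c by rewrite /c; lra.
have c0c2 : 2 * c0 <= c by rewrite /c; lra.
have b1c : 2 * `|b1| <= c by rewrite /c; lra.
have d2c : 2 * d2 <= c by rewrite /c; lra.
have d3c : 2 * d3 <= c by rewrite /c; lra.
exists p, c, k; split => //.
  by move=> x; rewrite (le_trans (k_le x))// ler_wpM2r.
move=> f cf lf.
(* [P] and [Q] convolve [f] with even kernels, [M] and [N] with odd ones;
   differentiation exchanges the two pairs, and only the derivative of [M]
   produces [f], since only its kernel jumps at the origin *)
pose P x := left_cos p q f x + right_cos p q f x.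
pose M x := left_cos p q f x - right_cos p q f x.
pose Q x := left_sin p q f x + right_sin p q f x.
pose N x := left_sin p q f x - right_sin p q f x.
have dC x := is_derive_left_cos q p0 cf lf x.
have dS x := is_derive_left_sin q p0 cf lf x.
have dA x := is_derive_right_cos q p0 cf lf x.
have dT x := is_derive_right_sin q p0 cf lf x.
have dP x : is_derive x 1 P (- p * M x - q * N x).
  by apply: (is_derive_eq (is_deriveD (dC x) (dA x))); rewrite /M /N; ring.
have dM x : is_derive x 1 M (- p * P x - q * Q x + 2 * f x).
  by apply: (is_derive_eq (is_deriveB (dC x) (dA x))); rewrite /P /Q; ring.
have dQ x : is_derive x 1 Q (- p * N x + q * M x).
  by apply: (is_derive_eq (is_deriveD (dS x) (dT x))); rewrite /M /N; ring.
have dN x : is_derive x 1 N (- p * Q x + q * P x).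
  by apply: (is_derive_eq (is_deriveB (dS x) (dT x))); rewrite /P /Q; ring.
have convE : convolution k f = (fun x => a * P x + b * Q x).
  apply/funext => x; rewrite /convolution (@kernelE _ p q p0 f lf k c0 a b x)//.
  - by move=> y y0; rewrite /k ger0_norm.
  - by move=> y y0; rewrite /k ler0_norm.
exists (fun x => b1 * N x), (fun x => b1 * q * P x + - (b1 * p) * Q x),
  (fun x => b1 * (- 2 * p * q) * M x + b1 * (p ^+ 2 - q ^+ 2) * N x).
have pq : p ^+ 2 - q ^+ 2 = - 1 by rewrite p2 q2; lra.
have dlin (A B : R -> R) (r s x A' B' : R) : is_derive x 1 A A' -> is_derive x 1 B B' ->
    is_derive x 1 (fun x => r * A x + s * B x) (r * A' + s * B').
  by move=> hA hB; apply: is_derive_eq; rewrite /GRing.scale/=; ring.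
have mE : m = 1 + 2 * p ^+ 2 by rewrite p2; lra.
have qE : q ^+ 2 = 1 + p ^+ 2 by rewrite p2 q2; lra.
have pn0 : p != 0 by rewrite gt_eqF.
have qn0 : q != 0 by rewrite gt_eqF.
have mn0 : m != 0 by rewrite gt_eqF.
split.
- move=> x; rewrite convE; apply: (is_derive_eq (dlin _ _ _ _ _ _ _ (dP x) (dQ x))).
  rewrite /a /b /b1.
  have -> : (4 * p * m)^-1 * (- p * M x - q * N x) + (4 * q * m)^-1 * (- p * N x + q * M x)
     = - (p ^+ 2 + q ^+ 2) / (4 * p * q * m) * N x.
    by field; rewrite mn0 pn0 qn0.
  rewrite qE; have -> : p ^+ 2 + (1 + p ^+ 2) = m by rewrite mE; ring.
  by field; rewrite mn0 pn0 qn0.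
- move=> x; have := dlin _ _ b1 0 x _ _ (dN x) (dN x).
  rewrite (_ : (fun x => b1 * N x + 0 * N x) = (fun x => b1 * N x)).
    by move=> h; apply: (is_derive_eq h); ring.
  by apply/funext => y; rewrite mul0r addr0.
- move=> x; apply: (is_derive_eq (dlin _ _ _ _ _ _ _ (dP x) (dQ x))); ring.
- move=> x; apply: (is_derive_eq (dlin _ _ _ _ _ _ _ (dM x) (dN x))).
  have f1 : b1 * p * q * 4 = - 1 by rewrite /b1; field; rewrite pn0 qn0.
  have f2 : m ^+ 2 * a = - (b1 * q * m) by rewrite /b1 /a; field; rewrite mn0 pn0 qn0.
  have f3 : m ^+ 2 * b = - (b1 * p * m) by rewrite /b1 /b; field; rewrite mn0 pn0 qn0.
  rewrite convE /= pq -m2.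
  have -> : m ^+ 2 * (a * P x + b * Q x) = m ^+ 2 * a * P x + m ^+ 2 * b * Q x by ring.
  have -> : b1 * (- 2 * p * q) * (- p * P x - q * Q x + 2 * f x) =
    2 * b1 * p ^+ 2 * q * P x + 2 * b1 * p * q ^+ 2 * Q x - (b1 * p * q * 4) * f x by ring.
  by rewrite f1 f2 f3 qE mE; ring.
- move=> x; have E0 := expconv_ge0 p f x.
  have lC := left_cos_le q p0 lf x; have lA := right_cos_le q p0 lf x.
  have lS := left_sin_le q p0 lf x; have lT := right_sin_le q p0 lf x.
  have PE : `|P x| <= 2 * expconv p f x.
    by rewrite (le_trans (ler_normD _ _))// mulrDl mul1r lerD.
  have ME : `|M x| <= 2 * expconv p f x.
    by rewrite (le_trans (ler_normB _ _))// mulrDl mul1r lerD.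
  have QE : `|Q x| <= 2 * expconv p f x.
    by rewrite (le_trans (ler_normD _ _))// mulrDl mul1r lerD.
  have NE : `|N x| <= 2 * expconv p f x.
    by rewrite (le_trans (ler_normB _ _))// mulrDl mul1r lerD.
  have fin d : 2 * d <= c -> d * (2 * expconv p f x) <= c * expconv p f x.
    by move=> dc; rewrite mulrA (mulrC d) ler_wpM2r.
  split.
  + by rewrite convE (le_trans (norm_lin_le _ _ PE QE))// fin.
  + by rewrite normrM (le_trans _ (fin _ b1c))// ler_wpM2l.
  + by rewrite (le_trans (norm_lin_le _ _ PE QE))// fin.
  + by rewrite (le_trans (norm_lin_le _ _ ME NE))// fin.
Qed.
End resolvent.

(** * Energy identities *)

Section energy.
Context {R : realType}.
Local Notation mu := (@lebesgue_measure R).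
Implicit Types (x y a b A : R) (f g h k w u v : R -> R).

(** [D^4 u + 2 D^2 u + al u = f], with the derivatives of [u] given as functions. *)
Definition ode_chain al f u u1 u2 u3 :=
  [/\ forall x, is_derive x 1 u (u1 x), forall x, is_derive x 1 u1 (u2 x),
      forall x, is_derive x 1 u2 (u3 x) &
      forall x, is_derive x 1 u3 (f x - 2 * u2 x - al * u x)].

(** The boundary terms left by integrating the energy of [w + u] by parts. *)
Definition energy_bdry w w1 u u1 u2 u3 x : R :=
  2 * (w x * w1 x) + 2 * (w1 x * u2 x - w x * u3 x + w1 x * u x - w x * u1 x)
  + (u1 x * u2 x - u x * u3 x).

(** Since [D^4 + 2 D^2 + al = (D^2 + 1)^2 + (al - 1)], the energy of [w + u] is
a sum of squares; expanding it, the cross term and the square of [u] are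
simplified by the equation for [u].  By parts, all derivatives beyond the second
are put on [u], so [w] may be any function with two derivatives.  The difference
of the two integrands is the derivative of [energy_bdry]. *)
Lemma energy_identity al f u u1 u2 u3 w w1 w2 A : 0 <= A ->
  ode_chain al f u u1 u2 u3 -> continuous f ->
  (forall x, is_derive x 1 w (w1 x)) -> (forall x, is_derive x 1 w1 (w2 x)) ->
  continuous w2 ->
  \int[mu]_(x in `[- A, A])
     ((w2 x + w x + (u2 x + u x)) ^+ 2 + (al - 1) * (w x + u x) ^+ 2)
  = \int[mu]_(x in `[- A, A]) (w2 x ^+ 2 - 2 * w1 x ^+ 2 + al * w x ^+ 2)
    + 2 * \int[mu]_(x in `[- A, A]) (w x * f x)
    + \int[mu]_(x in `[- A, A]) (u x * f x)
    + (energy_bdry w w1 u u1 u2 u3 A - energy_bdry w w1 u u1 u2 u3 (- A)).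
Proof.
move=> A0 [du du1 du2 du3] cf dw dw1 cw2.
have cu := is_derive_continuous du; have cu1 := is_derive_continuous du1.
have cu2 := is_derive_continuous du2; have cu3 := is_derive_continuous du3.
have cw := is_derive_continuous dw; have cw1 := is_derive_continuous dw1.
pose I1 x := (w2 x + w x + (u2 x + u x)) ^+ 2 + (al - 1) * (w x + u x) ^+ 2.
pose I2 x := w2 x ^+ 2 - 2 * w1 x ^+ 2 + al * w x ^+ 2.
have cI1 : continuous I1.
  by apply: contD; [apply/contX/contD; apply: contD|apply/contZ/contX/contD].
have cI2 : continuous I2.
  by apply: contD; [apply: contB; [exact: contX|exact/contZ/contX]|exact/contZ/contX].
have cwf : continuous (fun x => w x * f x) by exact: contM.
have cuf : continuous (fun x => u x * f x) by exact: contM.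
have Aab : - A <= A by lra.
pose D x := I1 x - (I2 x + 2 * (w x * f x) + u x * f x).
have cD : continuous D.
  by apply: contB => //; apply: contD => //; apply: contD => //; exact: contZ.
have dB x : is_derive x 1 (energy_bdry w w1 u u1 u2 u3) (D x).
  by rewrite /energy_bdry; apply: is_derive_eq; rewrite /GRing.scale/= /D /I1 /I2; ring.
rewrite -(ftc Aab dB cD) -segmentZ// -segmentD//; last exact: contZ.
rewrite -segmentD//; last exact/contD/contZ.
rewrite -segmentD//; last exact/contD/cuf/contD/contZ.
by apply: eq_Rintegral => x _; rewrite /D /I1 /I2; ring.
Qed.

Definition symmetry_bdry u u1 u2 u3 v v1 v2 v3 x : R :=
  u x * v3 x - u1 x * v2 x + u2 x * v1 x - u3 x * v x + 2 * (u x * v1 x - u1 x * v x).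

(** Green's formula for the formally self-adjoint operator [D^4 + 2 D^2 + al]. *)
Lemma symmetry_identity al f u u1 u2 u3 g v v1 v2 v3 A : 0 <= A ->
  ode_chain al f u u1 u2 u3 -> continuous f -> ode_chain al g v v1 v2 v3 -> continuous g ->
  \int[mu]_(x in `[- A, A]) (u x * g x) - \int[mu]_(x in `[- A, A]) (v x * f x)
  = symmetry_bdry u u1 u2 u3 v v1 v2 v3 A - symmetry_bdry u u1 u2 u3 v v1 v2 v3 (- A).
Proof.
move=> A0 [du du1 du2 du3] cf [dv dv1 dv2 dv3] cg.
have cu := is_derive_continuous du; have cv := is_derive_continuous dv.
have Aab : - A <= A by lra.
rewrite -segmentB; [|exact: contM|exact: contM].
apply: ftc => //; last by apply: contB; exact: contM.
by move=> x; rewrite /symmetry_bdry; apply: is_derive_eq; rewrite /GRing.scale/=; ring.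
Qed.

Lemma energy_ge al f u u1 u2 u3 w w1 w2 A : 0 <= A ->
  ode_chain al f u u1 u2 u3 -> continuous f ->
  (forall x, is_derive x 1 w (w1 x)) -> (forall x, is_derive x 1 w1 (w2 x)) ->
  continuous w2 ->
  (al - 1) * \int[mu]_(x in `[- A, A]) ((w x + u x) ^+ 2)
  <= \int[mu]_(x in `[- A, A]) (w2 x ^+ 2 - 2 * w1 x ^+ 2 + al * w x ^+ 2)
    + 2 * \int[mu]_(x in `[- A, A]) (w x * f x)
    + \int[mu]_(x in `[- A, A]) (u x * f x)
    + (energy_bdry w w1 u u1 u2 u3 A - energy_bdry w w1 u u1 u2 u3 (- A)).
Proof.
move=> A0 du cf dw dw1 cw2; rewrite -(energy_identity A0 du cf dw dw1 cw2).
have [/is_derive_continuous cu _ /is_derive_continuous cu2 _] := du.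
have cw := is_derive_continuous dw.
rewrite -segmentZ; last exact/contX/contD.
apply: segment_le => [||x _].
- exact/contZ/contX/contD.
- by apply: contD; [apply/contX/contD; apply: contD|apply/contZ/contX/contD].
- by rewrite lerDr sqr_ge0.
Qed.

Lemma zero_energy_ge al f u u1 u2 u3 A : 0 <= A ->
  ode_chain al f u u1 u2 u3 -> continuous f ->
  (al - 1) * \int[mu]_(x in `[- A, A]) (u x ^+ 2)
  <= \int[mu]_(x in `[- A, A]) (u x * f x)
    + (u1 A * u2 A - u A * u3 A - (u1 (- A) * u2 (- A) - u (- A) * u3 (- A))).
Proof.
move=> A0 du cf.
have d00 x : is_derive x 1 (fun=> 0 : R) (0 : R) by exact: is_derive_cst.
have := energy_ge A0 du cf d00 d00 (@cst_continuous _ _ _).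
have bE x : energy_bdry (fun=> 0) (fun=> 0) u u1 u2 u3 x = u1 x * u2 x - u x * u3 x.
  by rewrite /energy_bdry; ring.
rewrite !bE.
have -> : \int[mu]_(x in `[- A, A]) ((0 : R) ^+ 2 - 2 * 0 ^+ 2 + al * 0 ^+ 2) = 0.
  rewrite (@eq_Rintegral _ _ _ _ _ (fun=> 0)) ?Rintegral_cst ?mul0r//.
  by move=> x _; rewrite expr0n/=; ring.
have -> : \int[mu]_(x in `[- A, A]) ((0 : R) * f x) = 0.
  rewrite (@eq_Rintegral _ _ _ _ _ (fun=> 0)) ?Rintegral_cst ?mul0r//.
  by move=> x _; rewrite mul0r.
rewrite mulr0 !add0r.
by under eq_Rintegral do rewrite add0r.
Qed.

End energy.

(** * The resolvent on compactly supported functions *)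

Section Cc.
Context {R : realType}.
Local Notation mu := (@lebesgue_measure R).
Implicit Types (x y a b A e : R) (f g h k w u v : R -> R).

Definition Cc f := continuous f /\ exists A, forall x, A <= `|x| -> f x = 0.

Lemma CcD f g : Cc f -> Cc g -> Cc (fun x => f x + g x).
Proof.
move=> [cf [A fA]] [cg [B gB]]; split; first exact: contD.
exists (Num.max A B) => x; rewrite ge_max => /andP[Ax Bx].
by rewrite fA// gB// addr0.
Qed.

Lemma CcM g f : continuous g -> Cc f -> Cc (fun x => g x * f x).
Proof.
move=> cg [cf [A fA]]; split; first exact: contM.
by exists A => x Ax; rewrite fA// mulr0.
Qed.

Lemma CcZ r f : Cc f -> Cc (fun x => r * f x).
Proof. by apply: CcM; exact: cst_continuous. Qed.

Lemma CcB f g : Cc f -> Cc g -> Cc (fun x => f x - g x).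
Proof.
move=> Cf Cg; have := CcD Cf (CcZ (-1) Cg).
by congr Cc; apply/funext => x; rewrite mulN1r.
Qed.

Lemma CcX f : Cc f -> Cc (fun x => f x ^+ 2).
Proof. by move=> Cf; apply: CcM => //; case: Cf. Qed.

Lemma Cc_shift f r : Cc f -> Cc (fun x => f (x + r)).
Proof.
move=> [cf [A fA]]; split; first exact: cont_shift.
exists (A + `|r|) => x Ax; apply: fA.
by rewrite -lerBrDr in Ax; rewrite (le_trans Ax)// -(normrN r) -{2}(opprK r) lerB_dist.
Qed.

Lemma Cc_segment f A : continuous f -> (forall x, A <= `|x| -> f x = 0) ->
  L1 f /\ \int[mu]_x f x = \int[mu]_(x in `[- A, A]) f x.
Proof.
move=> cf fA.
have fz x : x \notin `[- A, A] -> f x = 0.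
  by rewrite in_itv/= -ler_norml -ltNge => /ltW; exact: fA.
split; last exact: Rint_segment_supp.
have -> : f = f \_ `[- A, A].
  by apply/funext => x; rewrite patchE; case: ifPn => //; rewrite notin_setE => /negP/fz.
rewrite /L1 -restrict_EFin; apply/integrable_restrict => //=; rewrite setTI.
exact: cont_segment_integrable.
Qed.

Lemma Cc_L1 f : Cc f -> L1 f.
Proof. by move=> [cf [A fA]]; have [] := Cc_segment cf fA. Qed.

Lemma Cc_Rint f : Cc f -> exists A0, forall g A, continuous g -> A0 <= A ->
  \int[mu]_x (g x * f x) = \int[mu]_(x in `[- A, A]) (g x * f x).
Proof.
move=> [cf [A fA]]; exists A => g B cg AB.
have [] := @Cc_segment (fun x => g x * f x) B => //; first exact: contM.
by move=> x Bx; rewrite fA ?mulr0// (le_trans AB).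
Qed.

End Cc.

Section resolvent_theory.
Context {R : realType}.
Local Notation mu := (@lebesgue_measure R).
Implicit Types (x y a b A e : R) (f g h w u v : R -> R).
Variables (al p c : R) (k : R -> R).
Hypothesis (al1 : 1 < al) (Hk : resolvent_kernel al p c k).

Let p0 : 0 < p. Proof. by case: Hk. Qed.
Let ck : continuous k. Proof. by case: Hk. Qed.

Lemma kernel_c_ge0 : 0 <= c.
Proof.
have [_ _ /(_ 0) + _] := Hk; rewrite /expw normr0 mulr0 oppr0 expR0 mulr1.
exact: le_trans.
Qed.

Lemma kernel_le x : `|k x| <= c.
Proof.
have [_ _ /(_ x) + _] := Hk; move=> /le_trans; apply.
by rewrite ler_piMr ?kernel_c_ge0// expw_le1.
Qed.

Lemma L1_convolution f x : L1 f -> L1 (fun y => k (x - y) * f y).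
Proof.
apply: (@L1_mul_bounded _ _ _ c); first exact: continuous_subl.
by move=> y; exact: kernel_le.
Qed.

Lemma convolutionD f g x : L1 f -> L1 g ->
  convolution k (fun y => f y + g y) x = convolution k f x + convolution k g x.
Proof.
move=> lf lg; rewrite /convolution -RintD; [|exact: L1_convolution..].
by apply: eq_Rintegral => y _; rewrite mulrDr.
Qed.

Lemma convolutionZ f r x : L1 f -> convolution k (fun y => r * f y) x = r * convolution k f x.
Proof.
move=> lf; rewrite /convolution -RintZ; last exact: L1_convolution.
by apply: eq_Rintegral => y _; rewrite mulrCA.
Qed.

Lemma convolution_shift f r x : continuous f -> L1 f ->
  convolution k (fun y => f (y + r)) x = convolution k f (x + r).
Proof.
move=> cf lf; rewrite /convolution -(@Rint_shift _ (fun y => k (x + r - y) * f y) r).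
- by apply: eq_Rintegral => y _; congr (k _ * _); rewrite opprD addrA addrAC addrK.
- by apply: contM => //; exact: continuous_subl.
- exact: L1_convolution.
Qed.

Lemma resolvent_chain f : continuous f -> L1 f -> exists u1 u2 u3,
  ode_chain al f (convolution k f) u1 u2 u3 /\
  forall x, [/\ `|convolution k f x| <= c * expconv p f x,
        `|u1 x| <= c * expconv p f x, `|u2 x| <= c * expconv p f x
        & `|u3 x| <= c * expconv p f x].
Proof.
move=> cf lf; have [_ _ _ /(_ f cf lf)[u1 [u2 [u3 [d d1 d2 d3 b]]]]] := Hk.
by exists u1, u2, u3.
Qed.

(** Decay of the solution and its derivatives, in the form that makes the
boundary terms of the identities above vanish on large segments. *)
Lemma resolvent_chain_small f : continuous f -> L1 f -> exists u1 u2 u3,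
  ode_chain al f (convolution k f) u1 u2 u3 /\
  forall e, 0 < e -> exists T, forall x, T <= `|x| ->
   [/\ `|convolution k f x| <= e, `|u1 x| <= e, `|u2 x| <= e & `|u3 x| <= e].
Proof.
move=> cf lf; have [u1 [u2 [u3 [d b]]]] := resolvent_chain cf lf.
exists u1, u2, u3; split => // e e0.
have c1 : 0 < c + 1 by rewrite ltr_wpDl// kernel_c_ge0.
have [T HT] := expconv_small p0 lf (divr_gt0 e0 c1).
exists T => x /HT; rewrite ler_pdivlMr// => E.
have E' : c * expconv p f x <= e.
  by rewrite (le_trans _ E)// mulrC ler_wpM2l ?expconv_ge0// lerDl.
by have [b0 b1 b2 b3] := b x; split; rewrite (le_trans _ E').
Qed.

Lemma convolution_continuous f : continuous f -> L1 f -> continuous (convolution k f).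
Proof.
by move=> cf /(resolvent_chain cf)[u1 [u2 [u3 [[d _ _ _] _]]]]; exact: is_derive_continuous d.
Qed.

Lemma convolution_le f x : continuous f -> L1 f -> `|convolution k f x| <= c * \int[mu]_y `|f y|.
Proof.
move=> cf lf; have [u1 [u2 [u3 [_ /(_ x)[b _ _ _]]]]] := resolvent_chain cf lf.
by rewrite (le_trans b)// ler_wpM2l ?kernel_c_ge0// expconv_le.
Qed.

Lemma convolution_lipschitz f x y : continuous f -> L1 f ->
  `|convolution k f x - convolution k f y| <= c * \int[mu]_z `|f z| * `|x - y|.
Proof.
move=> cf lf; have [u1 [u2 [u3 [[d _ _ _] b]]]] := resolvent_chain cf lf.
apply: (derive_bound_lipschitz d) => z; have [_ b1 _ _] := b z.
by rewrite (le_trans b1)// ler_wpM2l ?kernel_c_ge0// expconv_le.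
Qed.

Lemma convolution_vanish f e : continuous f -> L1 f -> 0 < e ->
  exists T, forall x, T <= `|x| -> `|convolution k f x| <= e.
Proof.
move=> cf lf e0; have [u1 [u2 [u3 [_ /(_ e e0)[T HT]]]]] := resolvent_chain_small cf lf.
by exists T => x /HT[].
Qed.

(** [symmetry_identity] on a segment whose ends move to infinity. *)
Lemma convolution_sym f g : Cc f -> Cc g ->
  \int[mu]_x (convolution k f x * g x) = \int[mu]_x (convolution k g x * f x).
Proof.
move=> Cf Cg; have [cf _] := Cf; have [cg _] := Cg.
have lf := Cc_L1 Cf; have lg := Cc_L1 Cg.
have [u1 [u2 [u3 [du Hu]]]] := resolvent_chain_small cf lf.
have [v1 [v2 [v3 [dv Hv]]]] := resolvent_chain_small cg lg.
have [A HA] := Cc_Rint Cf; have [B HB] := Cc_Rint Cg.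
apply/eqP; rewrite -subr_eq0 -normr_eq0 eq_le normr_ge0 andbT.
apply/ler_addgt0Pr => e e0; rewrite add0r.
pose d := Num.min 1 (e / 16).
have d0 : 0 < d by rewrite lt_min ltr01 divr_gt0.
have d1 : 0 <= d <= 1 by rewrite ltW//= ge_min lexx.
have de : 16 * d <= e by rewrite mulrC -ler_pdivlMr// ge_min lexx orbT.
have [Tu HTu] := Hu _ d0; have [Tv HTv] := Hv _ d0.
pose M := Num.max (Num.max A B) (Num.max 0 (Num.max Tu Tv)).
have : M <= M by [].
rewrite {1}/M !ge_max => /andP[/andP[AM BM] /and3P[M0 uM vM]].
rewrite (HA _ M)//; last exact: convolution_continuous.
rewrite (HB _ M)//; last exact: convolution_continuous.
rewrite (symmetry_identity M0 du cf dv cg).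
have S x : `|x| = M -> `|symmetry_bdry (convolution k f) u1 u2 u3 (convolution k g) v1 v2 v3 x| <= 8 * d.
  move=> xM; have [a0 a1 a2 a3] : [/\ `|convolution k f x| <= d, `|u1 x| <= d, `|u2 x| <= d & `|u3 x| <= d].
    by apply: HTu; rewrite xM.
  have [b0 b1 b2 b3] : [/\ `|convolution k g x| <= d, `|v1 x| <= d, `|v2 x| <= d & `|v3 x| <= d].
    by apply: HTv; rewrite xM.
  have := mul_small d1 a0 b3; have := mul_small d1 a1 b2.
  have := mul_small d1 a2 b1; have := mul_small d1 a3 b0.
  have := mul_small d1 a0 b1; have := mul_small d1 a1 b0.
  rewrite /symmetry_bdry !ler_norml => /andP[? ?] /andP[? ?] /andP[? ?] /andP[? ?] /andP[? ?] /andP[? ?].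
  apply/andP; split; lra.
have := S M (ger0_norm M0); have := S (- M); rewrite normrN => /(_ (ger0_norm M0)).
rewrite !ler_norml => /andP[? ?] /andP[? ?]; apply/andP; split; lra.
Qed.

(** With [u = k * f], the right-hand side is [\int u (D^4 + 2 D^2 + al) u], at
least [(al - 1) \int u^2].  The statement is on segments, which spares proving
that [u^2] is integrable. *)
Lemma convolution_coercive f a : Cc f ->
  (al - 1) * \int[mu]_(x in `[- a, a]) (convolution k f x ^+ 2) <= \int[mu]_x (convolution k f x * f x).
Proof.
move=> Cf; have [cf _] := Cf; have lf := Cc_L1 Cf.
have [u1 [u2 [u3 [du Hu]]]] := resolvent_chain_small cf lf.
have [A HA] := Cc_Rint Cf.
apply/ler_addgt0Pr => e e0.
pose d := Num.min 1 (e / 4).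
have d0 : 0 < d by rewrite lt_min ltr01 divr_gt0.
have d1 : 0 <= d <= 1 by rewrite ltW//= ge_min lexx.
have de : 4 * d <= e by rewrite mulrC -ler_pdivlMr// ge_min lexx orbT.
have [Tu HTu] := Hu _ d0.
pose M := Num.max (Num.max A a) (Num.max 0 Tu).
have : M <= M by [].
rewrite {1}/M !ge_max => /andP[/andP[AM aM] /andP[M0 uM]].
have cu := convolution_continuous cf lf.
rewrite (HA _ M)//.
have mono : \int[mu]_(x in `[- a, a]) (convolution k f x ^+ 2) <=
    \int[mu]_(x in `[- M, M]) (convolution k f x ^+ 2).
  by apply: segment_mono => //; [exact: contX|move=> x; exact: sqr_ge0].
have E := zero_energy_ge M0 du cf.
apply: (@le_trans _ _ ((al - 1) * \int[mu]_(x in `[- M, M]) (convolution k f x ^+ 2))).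
  by rewrite ler_wpM2l// subr_ge0 ltW.
apply: (le_trans E); rewrite lerD2l.
have S x : `|x| = M -> `|u1 x * u2 x - convolution k f x * u3 x| <= 2 * d.
  move=> xM; have [a0 a1 a2 a3] : [/\ `|convolution k f x| <= d, `|u1 x| <= d, `|u2 x| <= d & `|u3 x| <= d].
    by apply: HTu; rewrite xM.
  have := mul_small d1 a1 a2; have := mul_small d1 a0 a3.
  rewrite !ler_norml => /andP[? ?] /andP[? ?]; apply/andP; split; lra.
have := S M (ger0_norm M0); have := S (- M); rewrite normrN => /(_ (ger0_norm M0)).
rewrite !ler_norml => /andP[? ?] /andP[? ?]; lra.
Qed.

End resolvent_theory.

(** * The dual variational problem *)

Section quotient.
Context {R : realType}.
Local Notation mu := (@lebesgue_measure R).
Implicit Types (x y a b A e t : R) (f g h w u v : R -> R).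
Variables (al p c : R) (k : R -> R) (ga : R).
Hypothesis (al1 : 1 < al) (Hk : resolvent_kernel al p c k) (ga0 : 0 < ga).

Let Kc f : Cc f -> continuous (convolution k f).
Proof. by move=> Cf; apply: (convolution_continuous Hk); [case: Cf|exact: Cc_L1]. Qed.

Let gi0 : 0 <= ga^-1. Proof. by rewrite invr_ge0 ltW. Qed.

Let sqr_int_ge0 f : 0 <= \int[mu]_x (f x ^+ 2).
Proof. by apply: Rintegral_ge0 => x _; exact: sqr_ge0. Qed.

Definition admissible f := Cc f /\ forall x, 0 <= f x.

(** The functional whose constrained maximisation is dual to the profile
equation: the gradient at [f] is [2 (k * f - ga^-1 f)]. *)
Definition dual_form f : R := \int[mu]_x (convolution k f x * f x) - ga^-1 * \int[mu]_x (f x ^+ 2).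

Let CcK f g : Cc f -> Cc g -> Cc (fun x => convolution k f x * g x).
Proof. by move=> /Kc cK; exact: CcM. Qed.

Lemma convolution_pair_le f : admissible f ->
  \int[mu]_x (convolution k f x * f x) <= c * (\int[mu]_x f x) ^+ 2.
Proof.
move=> [Cf f0]; have [cf _] := Cf; have lf := Cc_L1 Cf.
have If : \int[mu]_x `|f x| = \int[mu]_x f x.
  by apply: eq_Rintegral => x _; rewrite ger0_norm.
apply: (@le_trans _ _ (\int[mu]_x ((c * \int[mu]_x f x) * f x))).
  apply: Rint_le; [exact/Cc_L1/CcK|exact: L1Z|] => x.
  by rewrite ler_wpM2r// (le_trans (ler_norm _))// -If (convolution_le Hk).
by rewrite RintZ// expr2 mulrA.
Qed.

Lemma dual_form_le f : admissible f -> dual_form f <= c * (\int[mu]_x f x) ^+ 2.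
Proof.
move=> Af; rewrite (le_trans _ (convolution_pair_le Af))// /dual_form lerBlDr lerDl.
exact: mulr_ge0.
Qed.

Lemma dual_formZ f r : Cc f -> dual_form (fun x => r * f x) = r ^+ 2 * dual_form f.
Proof.
move=> Cf; have lf := Cc_L1 Cf; rewrite /dual_form mulrBr; congr (_ - _).
  rewrite -RintZ; last exact/Cc_L1/CcK.
  by apply: eq_Rintegral => x _; rewrite (convolutionZ Hk)//; ring.
rewrite mulrCA; congr (_ * _); rewrite -RintZ; last exact/Cc_L1/CcX.
by apply: eq_Rintegral => x _; ring.
Qed.

(** The mixed terms agree by the symmetry of the convolution. *)
Lemma dual_form_expand f d t : Cc f -> Cc d ->
  dual_form (fun x => f x + t * d x) = dual_form f
   + 2 * t * (\int[mu]_x (convolution k f x * d x) - ga^-1 * \int[mu]_x (f x * d x))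
   + t ^+ 2 * dual_form d.
Proof.
move=> Cf Cd; have lf := Cc_L1 Cf; have ld := Cc_L1 Cd.
have [cf _] := Cf.
have l1 := Cc_L1 (CcK Cf Cf); have l2 := Cc_L1 (CcK Cf Cd).
have l3 := Cc_L1 (CcK Cd Cf); have l4 := Cc_L1 (CcK Cd Cd).
have l5 := Cc_L1 (CcX Cf); have l6 := Cc_L1 (CcM cf Cd); have l7 := Cc_L1 (CcX Cd).
have -> : dual_form (fun x => f x + t * d x) =
  (\int[mu]_x (convolution k f x * f x) + t * \int[mu]_x (convolution k f x * d x)
   + t * \int[mu]_x (convolution k d x * f x) + t ^+ 2 * \int[mu]_x (convolution k d x * d x))
  - ga^-1 * (\int[mu]_x (f x ^+ 2) + 2 * t * \int[mu]_x (f x * d x) + t ^+ 2 * \int[mu]_x (d x ^+ 2)).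
  rewrite /dual_form; congr (_ - _ * _).
    rewrite -!RintZ// -!RintD//; try by (do ?apply: L1D => //; exact: L1Z).
    apply: eq_Rintegral => x _; rewrite (convolutionD Hk)//; last exact: L1Z.
    by rewrite (convolutionZ Hk)//; ring.
  rewrite -!RintZ// -!RintD//; try by (do ?apply: L1D => //; exact: L1Z).
  by apply: eq_Rintegral => x _; ring.
rewrite (convolution_sym Hk Cd Cf) /dual_form; ring.
Qed.

Hypothesis dual_pos : exists2 f, admissible f & 0 < dual_form f.

Let S := [set dual_form f | f in [set f | admissible f /\ \int[mu]_x f x = 1]].

(** The supremum of [dual_form] over densities of mass 1.  It is also the
Lagrange multiplier of the mass constraint, i.e. the threshold of the profile
equation. *)
Definition dual_sup : R := sup S.

Lemma admissibleZ f r : 0 <= r -> admissible f -> admissible (fun x => r * f x).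
Proof. by move=> r0 [Cf f0]; split; [exact: CcZ|move=> x; rewrite mulr_ge0]. Qed.

Let S_ub : has_ubound S.
Proof.
exists c => _ [f [Af f1] <-]; apply: (le_trans (dual_form_le Af)).
by rewrite f1 expr1n mulr1.
Qed.

Let adm_int_ge0 f : admissible f -> 0 <= \int[mu]_x f x.
Proof. by move=> [_ f0]; apply: Rintegral_ge0. Qed.

Let normalize f : admissible f -> \int[mu]_x f x != 0 ->
  S (dual_form f / (\int[mu]_x f x) ^+ 2).
Proof.
move=> Af I0; have [Cf f0] := Af; set I := \int[mu]_x f x in I0 *.
exists (fun x => I^-1 * f x); last by rewrite dual_formZ// mulrC exprVn.
split; first by apply: admissibleZ => //; rewrite invr_ge0; exact: adm_int_ge0.
by rewrite RintZ; [rewrite mulVf|exact: Cc_L1].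
Qed.

Lemma dual_sup_gt0 : 0 < dual_sup.
Proof.
have [f Af Qf] := dual_pos.
have I0 : \int[mu]_x f x != 0.
  apply/eqP => I0; have := dual_form_le Af; rewrite I0 expr0n/= mulr0 leNgt.
  by rewrite Qf.
have nS := normalize Af I0.
have hS : has_sup S by split => //; eexists; exact: nS.
apply: lt_le_trans (sup_upper_bound hS nS).
by rewrite divr_gt0// exprn_even_gt0.
Qed.

Let S_sup : has_sup S.
Proof.
split => //; apply: contrapT => /nonemptyPn S0.
by have := dual_sup_gt0; rewrite /dual_sup S0 sup0 ltxx.
Qed.

Lemma dual_form_le_sup f : admissible f -> dual_form f <= dual_sup * (\int[mu]_x f x) ^+ 2.
Proof.
move=> Af; have [I0|I0] := eqVneq (\int[mu]_x f x) 0.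
  by have := dual_form_le Af; rewrite I0 expr0n/= !mulr0.
have := sup_upper_bound S_sup (normalize Af I0).
by rewrite ler_pdivrMr// exprn_even_gt0.
Qed.

Lemma admissible_shift f r : admissible f -> admissible (fun x => f (x + r)).
Proof. by move=> [Cf f0]; split; [exact: Cc_shift|]. Qed.

Lemma dual_form_shift f r : Cc f -> dual_form (fun x => f (x + r)) = dual_form f.
Proof.
move=> Cf; have lf := Cc_L1 Cf; have [cf _] := Cf; rewrite /dual_form; congr (_ - _ * _).
  rewrite -(@Rint_shift _ (fun x => convolution k f x * f x) r).
  - by apply: eq_Rintegral => x _; rewrite (convolution_shift Hk).
  - by case: (CcK Cf Cf).
  - exact/Cc_L1/CcK.
by rewrite -(@Rint_shift _ (fun x => f x ^+ 2) r)//; [exact: contX|exact/Cc_L1/CcX].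
Qed.

Definition excess M v x : R := ga * Num.max (v x - M) 0.

Lemma excess_ge0 M v x : 0 <= excess M v x.
Proof. by rewrite /excess mulr_ge0 ?(ltW ga0)// le_max lexx orbT. Qed.

Lemma excess_continuous M v : continuous v -> continuous (excess M v).
Proof. by move=> cv; apply/contZ/cont_max0/contB => //; exact: cst_continuous. Qed.

Lemma excess_Cc M f : 0 < M -> Cc f -> Cc (excess M (convolution k f)).
Proof.
move=> M0 Cf; have [cf _] := Cf; split; first exact/excess_continuous/Kc.
have [T HT] := convolution_vanish Hk cf (Cc_L1 Cf) M0.
exists T => x /HT /(le_trans (ler_norm _)) KM.
by rewrite /excess max_r ?mulr0// subr_le0.
Qed.

(** The average of [k * f] with weight [f] is at least [dual_form f], so [k * f]
is almost [dual_sup] or more somewhere; translation brings that point to the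
origin. *)
Lemma near_maximizer e : 0 < e -> exists f,
  [/\ admissible f, \int[mu]_x f x = 1, dual_sup - e < dual_form f & dual_sup - e <= convolution k f 0].
Proof.
move=> e0; have [_ [f [Af f1] <-] Qf] := sup_adherent e0 S_sup.
have [Cf f0] := Af; have lf := Cc_L1 Cf.
have [x0 Hx0] : exists x, dual_sup - e <= convolution k f x.
  apply: contrapT => /forallNP Hx.
  have : \int[mu]_x (convolution k f x * f x) <= dual_sup - e.
    rewrite -[leRHS]mulr1 -f1 -RintZ//; apply: Rint_le.
    - exact/Cc_L1/CcK.
    - exact: L1Z.
    - by move=> x; rewrite ler_wpM2r// ltW// ltNge; apply/negP/Hx.
  apply/negP; rewrite -ltNge; apply: (lt_le_trans Qf).
  by rewrite /dual_form lerBlDr lerDl; exact: mulr_ge0.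
exists (fun x => f (x + x0)); split.
- exact: admissible_shift.
- by rewrite Rint_shift//; case: Cf.
- by rewrite dual_form_shift.
- by rewrite (convolution_shift Hk) ?add0r//; case: Cf.
Qed.

(** [(v - M)^+ <= v^2 / M], and [v = k * f] has a square integral controlled by
coercivity.  The bound does not depend on [f]. *)
Lemma excess_mass f : admissible f -> \int[mu]_x f x = 1 ->
  \int[mu]_x excess dual_sup (convolution k f) x <= ga / dual_sup * (c / (al - 1)).
Proof.
move=> Af f1; have [Cf f0] := Af; have M0 := dual_sup_gt0.
have Ch := excess_Cc M0 Cf; have [ch _] := Ch.
have [A HA] := Cc_Rint Ch.
have cK := Kc Cf.
have := HA (fun=> 1) A (@cst_continuous _ _ _) (lexx _).
under eq_Rintegral do rewrite mul1r.
under [X in _ = X -> _]eq_Rintegral do rewrite mul1r.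
move=> ->.
have al10 : 0 < al - 1 by rewrite subr_gt0.
apply: (@le_trans _ _ (\int[mu]_(x in `[- A, A]) (ga / dual_sup * convolution k f x ^+ 2))).
  apply: segment_le => //; first exact/contZ/contX.
  move=> x _; rewrite /excess -mulrA (ler_wpM2l (ltW ga0))// ge_max.
  rewrite mulr_ge0 ?sqr_ge0 ?invr_ge0 ?(ltW M0)// andbT.
  rewrite mulrC ler_pdivlMr//.
  have := sqr_ge0 (convolution k f x - dual_sup / 2).
  have := sqr_ge0 dual_sup. nra.
rewrite segmentZ; last exact: contX.
rewrite ler_wpM2l ?divr_ge0 ?(ltW ga0) ?(ltW M0)// ler_pdivlMr// mulrC.
rewrite (le_trans (convolution_coercive al1 Hk A Cf))// (le_trans (convolution_pair_le Af))//.
by rewrite f1 expr1n mulr1.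
Qed.

(** The difference of the two sides is [(v - M - h/ga) (h - y)], where the first
factor is nonpositive, and zero where [h > 0]: the optimality conditions for
the constraint [y >= 0]. *)
Lemma excess_pointwise (M v y : R) : 0 <= y ->
  let h := ga * Num.max (v - M) 0 in
  ga^-1 * (h - y) ^+ 2 + M * (h - y) <= v * (h - y) - ga^-1 * (y * (h - y)).
Proof.
move=> y0 /=; have g0 : ga != 0 by rewrite gt_eqF.
case: (leP (v - M) 0) => v0.
  rewrite mulr0 sub0r -subr_ge0.
  have -> : v * - y - ga^-1 * (y * - y) - (ga^-1 * (- y) ^+ 2 + M * - y) =
    y * (M - v) by ring.
  by rewrite mulr_ge0// subr_ge0 -subr_le0.
by rewrite le_eqVlt; apply/orP; left; apply/eqP; field.
Qed.

(** Let [h = ga (k * f - M)^+] and [d = h - f].  By homogeneity the competitor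
[f + t d], of mass [1 + t \int d], has [dual_form] at most
[M (1 + t \int d)^2].  The first-order gain beyond [2 t M \int d] is at least
[2 t ga^-1 \int d^2], by [excess_pointwise]; all else is of order [t^2],
or absorbed by half of this gain. *)
Lemma near_maximizer_defect f t : admissible f -> \int[mu]_x f x = 1 -> 0 < t <= 1 ->
  dual_sup - t ^+ 2 <= dual_form f ->
  \int[mu]_x ((excess dual_sup (convolution k f) x - f x) ^+ 2)
  <= ga * (1 + dual_sup * (ga / dual_sup * (c / (al - 1)) + 1) ^+ 2) * t.
Proof.
move=> Af f1 /andP[t0 t1] Qf; have [Cf f0] := Af; have M0 := dual_sup_gt0.
have lf := Cc_L1 Cf.
set h := excess dual_sup (convolution k f); set m := ga / dual_sup * (c / (al - 1)).
have Ch : Cc h by exact: excess_Cc.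
have h0 x : 0 <= h x by exact: excess_ge0.
pose d x := h x - f x.
have Cd : Cc d by exact: CcB.
have [cf _] := Cf.
have mh := excess_mass Af f1; rewrite -/h -/m in mh.
have dE : \int[mu]_x d x = \int[mu]_x h x - 1 by rewrite RintB ?f1//; exact: Cc_L1.
have h0I : 0 <= \int[mu]_x h x by apply: Rintegral_ge0.
have ld := Cc_L1 Cd.
set D := \int[mu]_x (d x ^+ 2).
have D0 : 0 <= D by apply: Rintegral_ge0 => x _; exact: sqr_ge0.
(* a convex combination of [f] and [h] *)
have Ag : admissible (fun x => f x + t * d x).
  split; first by apply: CcD => //; exact: CcZ.
  move=> x; have -> : f x + t * d x = (1 - t) * f x + t * h x by rewrite /d; ring.
  by rewrite addr_ge0// mulr_ge0// ?subr_ge0// ltW.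
have := dual_form_le_sup Ag; rewrite dual_form_expand//.
rewrite RintD//; last exact: L1Z.
rewrite RintZ// f1 => ineq.
have Kdd : 0 <= \int[mu]_x (convolution k d x * d x).
  have := convolution_coercive al1 Hk 0 Cd; apply: le_trans.
  apply: mulr_ge0; first by rewrite subr_ge0 ltW.
  by apply: Rintegral_ge0 => x _; exact: sqr_ge0.
have Qd : - (ga^-1 * D) <= dual_form d by rewrite /dual_form -/D lerDr.
(* the first variation of the form in the direction [d] *)
have grad : ga^-1 * D + dual_sup * \int[mu]_x d x <=
    \int[mu]_x (convolution k f x * d x) - ga^-1 * \int[mu]_x (f x * d x).
  have l1 := Cc_L1 (CcK Cf Cd); have l2 := Cc_L1 (CcM cf Cd); have l3 := Cc_L1 (CcX Cd).
  rewrite -!RintZ// -RintB//; last exact: L1Z.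
  rewrite -RintD//; [|exact: L1Z|exact: L1Z].
  apply: Rint_le => //; [by apply: L1D; exact: L1Z|by apply: L1B => //; exact: L1Z|].
  by move=> x; exact: excess_pointwise.
set I := \int[mu]_x d x in ineq grad dE.
set G := _ - _ in grad ineq.
have I2 : I ^+ 2 <= (m + 1) ^+ 2.
  have m0 : 0 <= m by exact: le_trans mh.
  by rewrite -subr_ge0 subr_sqr dE mulr_ge0//; lra.
have gD : t * (ga^-1 * D) <= t ^+ 2 * (1 + dual_sup * (m + 1) ^+ 2).
  have gD0 : 0 <= ga^-1 * D by rewrite mulr_ge0// invr_ge0 ltW.
  have lI : dual_sup * I ^+ 2 <= dual_sup * (m + 1) ^+ 2 by rewrite ler_wpM2l// ltW.
  have tG : 2 * t * (ga^-1 * D + dual_sup * I) <= 2 * t * G by rewrite ler_wpM2l// mulr_ge0// ltW.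
  have tQ : t ^+ 2 * (- (ga^-1 * D)) <= t ^+ 2 * dual_form d by rewrite ler_wpM2l// sqr_ge0.
  have tI : t ^+ 2 * (dual_sup * I ^+ 2) <= t ^+ 2 * (dual_sup * (m + 1) ^+ 2) by rewrite ler_wpM2l// sqr_ge0.
  have tt : t ^+ 2 * (ga^-1 * D) <= t * (ga^-1 * D).
    by rewrite ler_wpM2r// expr2 ler_piMl// ltW.
  have e1 : dual_sup * (1 + t * I) ^+ 2 = dual_sup + 2 * t * (dual_sup * I) + t ^+ 2 * (dual_sup * I ^+ 2) by ring.
  rewrite e1 in ineq; lra.
rewrite -(ler_pM2l t0) -(ler_pM2l (_ : 0 < ga^-1)) ?invr_gt0//.
have -> : ga^-1 * (t * (ga * (1 + dual_sup * (m + 1) ^+ 2) * t)) =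
   t ^+ 2 * (1 + dual_sup * (m + 1) ^+ 2) by field; rewrite gt_eqF.
by rewrite mulrCA.
Qed.

End quotient.

(** * The limit of near-maximisers *)

Section expw_integrable.
Context {R : realType}.
Local Notation mu := (@lebesgue_measure R).
Variable p : R.
Hypothesis p0 : 0 < p.

(** Up to the factor 2, the weight is dominated by the reciprocal of
[exp(p x) + exp(-p x)], which has the bounded primitive [atan (exp(p x)) / p]. *)
Lemma expw_L1 : L1 (expw p).
Proof.
pose s (x : R) := (expR (p * x) + expR (- (p * x)))^-1.
have e0 (x : R) : 0 < expR (p * x) + expR (- (p * x)) by rewrite addr_gt0// expR_gt0.
have ds (x : R) : is_derive x 1 (fun x => 2 / p * atan (expR (p * x))) (2 * s x).
  apply: is_derive_eq; rewrite /GRing.scale/= /s.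
  have ex := expRxMexpNx_1 (p * x); have p1 := expR_gt0 (p * x).
  have -> : expR (- (p * x)) = (expR (p * x))^-1 by rewrite expRN.
  field; rewrite gt_eqF//= gt_eqF//=.
  by rewrite gt_eqF// addr_gt0// exprn_gt0.
have cs : continuous (fun x => 2 * s x).
  move=> x; apply: cvgM; first exact: cvg_cst.
  apply: cvgV; first by rewrite gt_eqF.
  have cl (z q : R) : {for z, continuous (fun z : R => expR (q * z))}.
    apply: continuous_comp; last exact: continuous_expR.
    by apply: cvgM; [exact: cvg_cst|exact: cvg_id].
  apply: cvgD; first exact: cl.
  apply: continuous_comp; last exact: continuous_expR.
  by apply: cvgN; apply: cvgM; [exact: cvg_cst|exact: cvg_id].
have le (x : R) : expw p x <= 2 * s x.
  rewrite /expw expRN /s ler_pdivlMr// mulrC ler_pdivrMr ?expR_gt0//.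
  rewrite mulr_natl mulr2n lerD// ler_expR -?mulrN ler_pM2l// ?ler_norm//.
  by rewrite -normrN ler_norm.
apply: (@L1_le _ _ (fun x => 2 * s x)).
- by apply: continuous_measurable_fun; exact: continuous_expw.
- by move=> x; rewrite ger0_norm// ltW// expw_gt0.
apply: (@L1_segments _ _ (2 / p * (pi / 2) + 2 / p * (pi / 2))) => //.
  by move=> x; rewrite mulr_ge0// invr_ge0 ltW.
move=> n; have nn : - n%:R <= n%:R :> R by rewrite (@le_trans _ _ 0)// oppr_le0.
have c0 : 0 <= 2 / p by rewrite divr_ge0// ltW.
rewrite (ftc nn ds cs) lerD//.
  by rewrite ler_wpM2l// ltW// atan_ltpi2.
by rewrite -mulrN ler_wpM2l// lerNl ltW// atan_gtNpi2.
Qed.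

End expw_integrable.

(** Images of ultrafilters turn compactness of segments into the existence of
pointwise limits, with no extraction of subsequences. *)
Lemma ultra_fmap (T S : Type) (f : T -> S) (U : set_system T) :
  UltraFilter U -> UltraFilter (f @ U).
Proof.
move=> UU; have PU := @ultra_proper _ _ UU.
split; first exact: fmap_proper_filter.
move=> G PG fG; apply/seteqP; split => [A GA|A /fG//].
have [//|nA] := in_ultra_setVsetC (f @^-1` A) UU.
have GnA : G (~` A) by apply: fG.
by have := @filterI _ G _ _ _ GA GnA; rewrite setICr => G0; case: (@filter_not_empty _ G PG); apply: G0.
Qed.

Section limit.
Context {R : realType}.
Local Notation mu := (@lebesgue_measure R).
Implicit Types (x y a b A e t D : R) (f g h w u v : R -> R).
Variables (al p c : R) (k : R -> R) (ga : R).
Hypothesis (al1 : 1 < al) (Hk : resolvent_kernel al p c k) (ga0 : 0 < ga).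

Let p0 : 0 < p. Proof. by case: Hk. Qed.
Let c0 : 0 <= c := kernel_c_ge0 Hk.

Lemma excess_lipschitz M u v x : `|excess ga M u x - excess ga M v x| <= ga * `|u x - v x|.
Proof.
rewrite /excess -mulrBr normrM (ger0_norm (ltW ga0)) ler_wpM2l ?(ltW ga0)//.
rewrite ler_norml; have := ler_norm (u x - v x); have := ler_norm (- (u x - v x)).
rewrite normrN => h1 h2.
by case: (leP (u x - M) 0) => h3; case: (leP (v x - M) 0) => h4;
  apply/andP; split; lra.
Qed.

Variables (f_ : nat -> R -> R) (M m C : R).
Hypothesis (M0 : 0 < M) (m0 : 0 <= m).
Hypothesis f_adm : forall n, admissible (f_ n).
Hypothesis f_mass : forall n, \int[mu]_x f_ n x = 1.
Let v_ n := convolution k (f_ n).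
Let h_ n := excess ga M (v_ n).
Hypothesis h_mass : forall n, \int[mu]_x h_ n x <= m.
Hypothesis defect : forall n, \int[mu]_x ((h_ n x - f_ n x) ^+ 2) <= C / n.+1%:R.

Let lf n : L1 (f_ n). Proof. by case: (f_adm n) => /Cc_L1. Qed.
Let cf n : continuous (f_ n). Proof. by case: (f_adm n) => -[]. Qed.
Let fabs n : \int[mu]_x `|f_ n x| = 1.
Proof.
rewrite -(f_mass n); apply: eq_Rintegral => x _; rewrite ger0_norm//.
by case: (f_adm n).
Qed.
Let Ch n : Cc (h_ n). Proof. by apply: (excess_Cc ga Hk) => //; case: (f_adm n). Qed.
Let v_le n x : `|v_ n x| <= c.
Proof. by rewrite (le_trans (convolution_le Hk x (@cf n) (lf n)))// fabs mulr1. Qed.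
Let v_lip n x y : `|v_ n x - v_ n y| <= c * `|x - y|.
Proof. by rewrite (le_trans (convolution_lipschitz Hk x y (@cf n) (lf n)))// fabs mulr1. Qed.

Let cv n : continuous (v_ n).
Proof. exact: (convolution_continuous Hk (@cf n) (lf n)). Qed.

Let exU : exists U : set_system nat, UltraFilter U /\ \oo `<=` U.
Proof. exact: ultraFilterLemma. Qed.
Let U := sval (cid exU).
Let UU : UltraFilter U. Proof. by rewrite /U; case: cid => ? []. Qed.
Let ooU : \oo `<=` U. Proof. by rewrite /U; case: cid => ? []. Qed.
#[local] Existing Instance UU.
Let PU : ProperFilter U := @ultra_proper _ _ UU.
#[local] Existing Instance PU.

Let v_cvg x : exists l : R, v_ n x @[n --> U] --> l.
Proof.
have cpt : compact (`[- c, c]%classic : set R) by exact: segment_compact.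
move: cpt; rewrite compact_ultra => /(_ ((fun n => v_ n x) @ U)).
move=> /(_ (ultra_fmap _ UU)) [].
  by apply: (@filterE nat U) => n; rewrite /= in_itv/= -ler_norml; exact: v_le.
by move=> l [_ lU]; exists l.
Qed.

Let V x : R := sval (cid (v_cvg x)).
Let VE x : v_ n x @[n --> U] --> V x. Proof. by rewrite /V; case: cid. Qed.

Let V_near x e : 0 < e -> \forall n \near U, `|V x - v_ n x| <= e.
Proof. by move=> e0; move/cvgrPdist_le : (@VE x) => /(_ e e0). Qed.

Let V_lip x y : `|V x - V y| <= c * `|x - y|.
Proof.
apply/ler_addgt0Pr => e e0; have e2 : 0 < e / 2 by rewrite divr_gt0.
have [n [h1 h2]] : exists n, `|V x - v_ n x| <= e / 2 /\ `|V y - v_ n y| <= e / 2.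
  by apply: (@filter_ex _ U PU); apply: filterI; exact: V_near.
have := v_lip n x y; rewrite (_ : V x - V y = (V x - v_ n x) + (v_ n x - v_ n y) - (V y - v_ n y)); last ring.
move=> h3.
have n1 := ler_normB (V x - v_ n x + (v_ n x - v_ n y)) (V y - v_ n y).
have n2 := ler_normD (V x - v_ n x) (v_ n x - v_ n y).
lra.
Qed.

Let V_cont : continuous V.
Proof.
move=> x; apply/cvgrPdist_le => e e0.
have c1 : 0 < c + 1 by rewrite ltr_wpDl.
near=> y; rewrite (le_trans (V_lip x y))//.
have : `|x - y| <= e / (c + 1).
  near: y; apply: cvgr_dist_le; [exact: cvg_id|exact: divr_gt0].
rewrite ler_pdivlMr// => h; rewrite (le_trans _ h)// mulrC ler_wpM2l// lerDl//.
Unshelve. all: by end_near. Qed.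

(** A finite grid of mesh [d] suffices, as all the functions share a Lipschitz
constant. *)
Let V_unif D e : 0 < e -> \forall n \near U, forall x, `|x| <= D -> `|V x - v_ n x| <= e.
Proof.
move=> e0; have e3 : 0 < e / 3 by rewrite divr_gt0.
have c1 : 0 < c + 1 by rewrite ltr_wpDl.
pose d := e / 3 / (c + 1); have d0 : 0 < d by rewrite divr_gt0.
pose N := (Num.truncn (2 * D / d)).+1.
pose g (i : nat) : R := - D + i%:R * d.
have H : \forall n \near U, forall i : 'I_N, `|V (g i) - v_ n (g i)| <= e / 3.
  by apply: filter_forall => i; exact: V_near.
apply: filterS H => n H x xD.
have xD' : 0 <= (x + D) / d.
  by apply: divr_ge0; [move: xD; rewrite ler_norml => /andP[? _]; lra|exact: ltW].
pose i := Num.truncn ((x + D) / d).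
have /andP[i1 i2] := truncn_itv xD'.
have iN : (i < N)%N.
  rewrite ltnS; apply: le_truncn; rewrite ler_pM2r ?invr_gt0//.
  by move: xD; rewrite ler_norml => /andP[_ ?]; lra.
have xg : `|x - g i| <= d.
  rewrite ler_pdivlMr// in i1; rewrite ltr_pdivrMr// -natr1 in i2.
  by rewrite /g ler_norml; apply/andP; split; rewrite /i; lra.
have cxg : c * `|x - g i| <= e / 3.
  apply: (@le_trans _ _ ((c + 1) * d)); last by rewrite /d mulrC divfK// gt_eqF.
  by apply: ler_pM => //; rewrite lerDl.
have := H (Ordinal iN) => /= h1.
rewrite (_ : V x - v_ n x = (V x - V (g i)) + (V (g i) - v_ n (g i)) - (v_ n x - v_ n (g i))); last ring.
rewrite (le_trans (ler_normB _ _))//.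
have h2 := le_trans (v_lip n x (g i)) cxg; have h3 := le_trans (V_lip x (g i)) cxg.
have := ler_normD (V x - V (g i)) (V (g i) - v_ n (g i)).
lra.
Qed.

Let F := excess ga M V.
Let cF : continuous F. Proof. exact: excess_continuous. Qed.
Let F0 x : 0 <= F x. Proof. exact: excess_ge0. Qed.
Let h0 n x : 0 <= h_ n x. Proof. exact: excess_ge0. Qed.

Let segment_h n (N : nat) : \int[mu]_(x in `[- N%:R, N%:R]) h_ n x <= m.
Proof.
have [ch [A hA]] := Ch n.
have := @Cc_segment _ (h_ n) (Num.max A N%:R) ch.
move=> [x|_ E]; first by rewrite ge_max => /andP[+ _]; exact: hA.
rewrite (le_trans _ (h_mass n))// E; apply: segment_mono => //.
by rewrite le_max lexx orbT.
Qed.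

(** Local uniform convergence carries the mass bound of the [h_ n] over to the
limit, on each segment. *)
Let segment_F (N : nat) : \int[mu]_(x in `[- N%:R, N%:R]) F x <= m.
Proof.
apply/ler_addgt0Pr => e e0.
have d0 : 0 < e / (ga * (2 * N%:R + 1)).
  by rewrite divr_gt0// mulr_gt0// ltr_wpDl// mulr_ge0.
have [n Hn] := filter_ex (V_unif N%:R d0).
rewrite -lerBlDr; apply: le_trans (segment_h n N); rewrite lerBlDr.
have [ch _] := Ch n.
have NN : - N%:R <= N%:R :> R by rewrite (@le_trans _ _ 0)// oppr_le0.
apply: (@le_trans _ _ (\int[mu]_(x in `[- N%:R, N%:R]) (h_ n x + e / (2 * N%:R + 1)))).
  apply: segment_le => //; first by apply: contD => //; exact: cst_continuous.
  move=> x; rewrite in_itv/= -ler_norml => xN.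
  have := excess_lipschitz M V (v_ n) x; rewrite -/(h_ n) -/F => lip.
  have := Hn x xN => h1.
  rewrite -lerBlDl (le_trans (ler_norm _))// (le_trans lip)//.
  have -> : e / (2 * N%:R + 1) = ga * (e / (ga * (2 * N%:R + 1))).
    by field; rewrite !gt_eqF// ltr_wpDl// mulr_ge0.
  by rewrite ler_wpM2l// ltW.
rewrite segmentD//; last exact: cst_continuous.
rewrite lerD2l Rintegral_cst//= lebesgue_measure_itv/= lte_fin.
case: ifPn => // _; last by rewrite mulr0 ltW.
rewrite mulrAC ler_pdivrMr ?ltr_wpDl// ?mulr_ge0// ler_wpM2l ?ltW//.
by rewrite /= opprK; lra.
Qed.

Let lF : L1 F. Proof. exact: L1_segments segment_F. Qed.

Let F_mass : \int[mu]_x F x <= m.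
Proof.
have := Rint_segments lF => cv1.
rewrite -(cvg_lim _ cv1)//; apply: limr_le; first by apply/cvg_ex; eexists; exact: cv1.
by apply: nearW => N; exact: segment_F.
Qed.

Let kern2 x : L1 (fun y => expw p (x - y)).
Proof.
have := shift_L1 (- x) (continuous_expw (p := p)) (expw_L1 p0).
by congr L1; apply/funext => y; rewrite /expw distrC.
Qed.

Let kern_sqr x : L1 (fun y => k (x - y) ^+ 2).
Proof.
apply: (@L1_le _ _ (fun y => c * (c * expw p (x - y)))).
- by apply: continuous_measurable_fun; apply/contX/continuous_subl; case: Hk.
- move=> y; have [_ _ /(_ (x - y)) kle _] := Hk.
  by rewrite normrX expr2 ler_pM// (kernel_le Hk).
- exact/L1Z/L1Z.
Qed.

(** Young's inequality inside the integral, so that only the square integral of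
the defect is needed. *)
Let error_bound x n e : 0 < e ->
  `|\int[mu]_y (k (x - y) * (h_ n y - f_ n y))| <=
   e * \int[mu]_y (k (x - y) ^+ 2) + e^-1 * (C / n.+1%:R).
Proof.
move=> e0; have [Cf _] := f_adm n.
have Cd : Cc (fun y => h_ n y - f_ n y) by exact: CcB.
have ld := Cc_L1 Cd; have ld2 := Cc_L1 (CcX Cd).
rewrite (le_trans (le_normr_Rintegral measurableT (L1_convolution Hk x ld)))//.
apply: (@le_trans _ _ (\int[mu]_y (e * k (x - y) ^+ 2 + e^-1 * (h_ n y - f_ n y) ^+ 2))).
  apply: Rint_le.
  - exact/L1_abs/(L1_convolution Hk).
  - by apply: L1D; exact: L1Z.
  - move=> y; exact: young_le.
rewrite RintD; [|exact: L1Z|exact: L1Z].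
rewrite !RintZ// lerD2l ler_wpM2l ?invr_ge0 ?(ltW e0)//.
Qed.

(** Near the origin the two excesses are close by uniform convergence; the
factor [expR (p * D) * expw p y], at least 1 there, stands for the indicator of
the segment.  Far away the kernel is small, whatever the two masses do. *)
Let limit_bound x n D e : 0 <= D -> 0 < e ->
  (forall y, `|y| <= D -> `|V y - v_ n y| <= e) ->
  `|\int[mu]_y (k (x - y) * (h_ n y - F y))| <=
   c * ga * e * expR (p * D) * \int[mu]_y expw p y
   + c * expR (- (p * (D - `|x|))) * (m + m).
Proof.
move=> D0 e0 H; have [ch _] := Ch n; have lh := Cc_L1 (Ch n).
have ld : L1 (fun y => h_ n y - F y) by exact: L1B.
rewrite (le_trans (le_normr_Rintegral measurableT (L1_convolution Hk x ld)))//.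
set a := c * ga * e * _; set b := c * expR _.
have a0 : 0 <= a by rewrite !mulr_ge0 ?expR_ge0 ?(ltW ga0) ?(ltW e0).
have b0 : 0 <= b by rewrite mulr_ge0 ?expR_ge0.
apply: (@le_trans _ _ (\int[mu]_y (a * expw p y + b * (h_ n y + F y)))).
  apply: Rint_le.
  - exact/L1_abs/(L1_convolution Hk).
  - by apply: L1D; apply: L1Z; [exact: expw_L1|exact: L1D].
  - move=> y; rewrite normrM; have [yD|Dy] := leP `|y| D.
      rewrite -[leLHS]addr0 lerD//; last by rewrite mulr_ge0// addr_ge0.
      apply: (@le_trans _ _ (c * (ga * e))).
        apply: ler_pM => //; first exact: (kernel_le Hk).
        rewrite distrC; apply: (le_trans (excess_lipschitz M V (v_ n) y)).
        by rewrite ler_wpM2l ?(ltW ga0)//; exact: H.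
      rewrite /a -!mulrA ler_wpM2l// ler_wpM2l ?(ltW ga0)//.
      rewrite -[leLHS]mulr1 ler_wpM2l ?(ltW e0)// -expRD -expR0 ler_expR.
      by rewrite -mulrN -mulrDr mulr_ge0 ?(ltW p0)// subr_ge0.
    rewrite -[leLHS]add0r lerD//; first by rewrite mulr_ge0// ltW// expw_gt0.
    apply: ler_pM => //.
      have [_ _ /(_ (x - y)) kle _] := Hk; rewrite (le_trans kle)// ler_wpM2l//.
      rewrite /expw ler_expR lerN2 ler_wpM2l ?(ltW p0)//.
      rewrite distrC (le_trans _ (lerB_dist _ _))// lerB// ltW//.
    by rewrite (le_trans (ler_normB _ _))// !ger0_norm.
rewrite RintD; [|exact/L1Z/expw_L1|exact/L1Z/L1D].
rewrite !RintZ; [|exact: L1D|exact: expw_L1].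
by rewrite RintD// lerD2l ler_wpM2l// lerD.
Qed.

(** [v_ n = k * f_ n] differs from [k * F] by [k * (h_ n - F)] and
[k * (f_ n - h_ n)]; the former is small by [limit_bound], the latter by
[error_bound]. *)
Let F_conv x : convolution k F x = V x.
Proof.
set K2 := \int[mu]_y (k (x - y) ^+ 2); set E := \int[mu]_y expw p y.
have K20 : 0 <= K2 by apply: Rintegral_ge0 => y _; exact: sqr_ge0.
have E0 : 0 <= E by apply: Rintegral_ge0 => y _; exact/ltW/expw_gt0.
have key e : 0 < e -> `|V x - convolution k F x| <= e * (1 + K2 + 1 + c * ga * E + c * (m + m)).
  move=> e0.
  have [T HT] := expw_small p0 e0.
  pose D := Num.max 0 T + `|x|.
  have T0 : 0 <= Num.max 0 T by rewrite le_max lexx.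
  have D0 : 0 <= D by rewrite addr_ge0.
  have eD : expR (- (p * (D - `|x|))) <= e.
    rewrite /D addrK; have := HT (Num.max 0 T); rewrite /expw (ger0_norm T0).
    by apply; rewrite le_max lexx orbT.
  pose e1 := e / expR (p * D).
  have e10 : 0 < e1 by rewrite divr_gt0 ?expR_gt0.
  have [n [[h1 h2] h3]] : exists n, (`|V x - v_ n x| <= e /\
      (forall y, `|y| <= D -> `|V y - v_ n y| <= e1)) /\ C / n.+1%:R <= e * e.
    apply: (@filter_ex _ U PU); apply: filterI.
      by apply: filterI; [exact: V_near|exact: V_unif].
    apply: ooU; have ee : 0 < e * e by exact: mulr_gt0.
    exists (Num.truncn (C / (e * e))) => // n /= nn.
    rewrite ler_pdivrMr// -ler_pdivrMl// mulrC.
    rewrite (le_trans (ltW (truncnS_gt _)))// ler_nat.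
    exact: nn.
  have [Cf _] := f_adm n.
  have Cd : Cc (fun y => h_ n y - f_ n y) by exact: CcB.
  have ld := Cc_L1 Cd; have lh := Cc_L1 (Ch n).
  have ld2 : L1 (fun y => h_ n y - F y) by exact: L1B.
  have e1n : v_ n x - convolution k F x =
     \int[mu]_y (k (x - y) * (h_ n y - F y)) - \int[mu]_y (k (x - y) * (h_ n y - f_ n y)).
    rewrite /v_ /convolution -!RintB; try exact: (L1_convolution Hk).
    by apply: eq_Rintegral => y _; ring.
  have b1 := error_bound x n e0.
  have b2 := limit_bound x D0 e10 h2.
  have b3 : e^-1 * (C / n.+1%:R) <= e.
    by rewrite ler_pdivrMl.
  have b4 : c * ga * e1 * expR (p * D) * E = e * (c * ga * E).
    by rewrite /e1; field; rewrite gt_eqF ?expR_gt0.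
  have b5 : c * expR (- (p * (D - `|x|))) * (m + m) <= e * (c * (m + m)).
    by rewrite mulrAC mulrC ler_wpM2r// mulr_ge0// addr_ge0.
  rewrite -/K2 in b1; rewrite -/E b4 in b2.
  have -> : V x - convolution k F x = (V x - v_ n x) + (v_ n x - convolution k F x) by ring.
  have n1 := ler_normD (V x - v_ n x) (v_ n x - convolution k F x).
  have n2 := ler_normB (\int[mu]_y (k (x - y) * (h_ n y - F y))) (\int[mu]_y (k (x - y) * (h_ n y - f_ n y))).
  rewrite -e1n in n2.
  apply: (le_trans n1); apply: (le_trans (lerD h1 (le_trans n2 (lerD b2 b1)))).
  have -> : e * (1 + K2 + 1 + c * ga * E + c * (m + m)) =
    e + (e * (c * ga * E) + e * (c * (m + m)) + (e * K2 + e)) by ring.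
  by rewrite lerD2l lerD// ?lerD2l.
apply/eqP; rewrite eq_sym -subr_eq0 -normr_eq0 eq_le normr_ge0 andbT.
apply/ler_addgt0Pr => e e0; rewrite add0r.
set B := 1 + K2 + 1 + c * ga * E + c * (m + m) in key.
have B0 : 0 < B.
  by rewrite /B -!addrA ltr_pwDl// !addr_ge0// !mulr_ge0// ?(ltW ga0)// addr_ge0.
by have := key _ (divr_gt0 e0 B0); rewrite divfK// gt_eqF.
Qed.

(** Almost solutions with bounded excess mass have an exact solution as locally
uniform limit.  Part of the mass of the densities [f_ n] may escape to infinity, so
that the excess of the limit may have smaller mass; the decaying kernel does not
see the escaped part. *)
Lemma limit_fixed_point : (forall n, M / 2 <= v_ n 0) ->
  exists v, [/\ M / 2 <= v 0, continuous (excess ga M v), L1 (excess ga M v) &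
    forall x, v x = convolution k (excess ga M v) x].
Proof.
move=> v0; exists V; split => //.
- have cv0 := @VE 0; rewrite -(cvg_lim _ cv0)//.
  by apply: limr_ge; [apply/cvg_ex; eexists; exact: cv0|exact: nearW].
Qed.

End limit.

(** * From the fixed point to the travelling wave *)

Section existence.
Context {R : realType}.
Local Notation mu := (@lebesgue_measure R).
Implicit Types (x y : R) (f g u v : R -> R).
Variables (al p c : R) (k : R -> R) (ga : R).
Hypothesis (al1 : 1 < al) (Hk : resolvent_kernel al p c k) (ga0 : 0 < ga).
Hypothesis dual_pos : exists2 f, admissible f & 0 < dual_form k ga f.

(** Near-maximisers of defect at most [(n+1)^-2] violate the equation by
[O(1/(n+1))] in square mean, and are at least [M/2] at the origin. *)
Lemma fixed_point : exists M v, [/\ 0 < M, M / 2 <= v 0, continuous (excess ga M v),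
  L1 (excess ga M v) & forall x, v x = convolution k (excess ga M v) x].
Proof.
set M := dual_sup k ga; have M0 : 0 < M := dual_sup_gt0 Hk ga0 dual_pos.
have ex (n : nat) : exists f, [/\ admissible f, \int[mu]_x f x = 1,
    M - n.+1%:R^-1 ^+ 2 <= dual_form k ga f & M / 2 <= convolution k f 0].
  have e0 : 0 < Num.min (n.+1%:R^-1 ^+ 2) (M / 2) by rewrite lt_min exprn_gt0//= divr_gt0.
  have [f [Af f1 Qf vf]] := near_maximizer Hk ga0 dual_pos e0.
  exists f; split=> //.
    by rewrite (le_trans _ (ltW Qf))// lerB// ge_min lexx.
  rewrite (le_trans _ vf)// -/M lerBrDr -lerBrDl.
  by rewrite ge_min; apply/orP; right; lra.
pose f n := sval (cid (ex n)).
have fP n := svalP (cid (ex n)); rewrite -/(f _) in fP.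
have m0 : 0 <= ga / M * (c / (al - 1)).
  apply: mulr_ge0; apply: divr_ge0; rewrite ?(ltW ga0) ?(ltW M0) ?(kernel_c_ge0 Hk)//.
  by rewrite subr_ge0 ltW.
have mass n : \int[mu]_x excess ga M (convolution k (f n)) x <= ga / M * (c / (al - 1)).
  by have [Af f1 _ _] := fP n; exact: (excess_mass al1 Hk ga0 dual_pos Af f1).
have defect n : \int[mu]_x ((excess ga M (convolution k (f n)) x - f n x) ^+ 2)
    <= ga * (1 + M * (ga / M * (c / (al - 1)) + 1) ^+ 2) / n.+1%:R.
  have [Af f1 Qf _] := fP n.
  apply: (near_maximizer_defect al1 Hk ga0 dual_pos Af f1) => //.
  by rewrite invr_gt0 ltr0n/= invf_le1// ler1n.
have [v [v0 cF lF vE]] := limit_fixed_point Hk ga0 M0 m0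
   (fun n => let: And4 Af _ _ _ := fP n in Af) (fun n => let: And4 _ f1 _ _ := fP n in f1)
   mass defect (fun n => let: And4 _ _ _ vf := fP n in vf).
by exists M, v.
Qed.

End existence.

Section wave.
Context {R : realType}.
Local Notation mu := (@lebesgue_measure R).
Implicit Types (x y s t : R) (f g u v : R -> R).

Lemma travelling_wave_of_profile (a b c : R) (d : nat -> R -> R) :
  (forall j, (j < 4)%N -> forall x, is_derive x 1 (d j) (d j.+1 x)) ->
  continuous (d 4%N) ->
  (forall x, c ^+ 2 * d 2%N x + d 4%N x + a * Num.max (d 0%N x) 0
      - b * Num.max (- d 0%N x) 0 = 1) ->
  d 0%N x @[x --> +oo] --> a^-1 -> d 0%N x @[x --> -oo] --> a^-1 ->
  d 1%N x @[x --> +oo] --> (0 : R) -> d 1%N x @[x --> -oo] --> (0 : R) ->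
  (exists s, d 0%N s != a^-1) ->
  travelling_wave a b c (fun x t => d 0%N (x - c * t)).
Proof.
move=> dd c4 ode dy dNy d1y d1Ny nontriv.
have dc j : (j <= 4)%N -> continuous (d j).
  rewrite leq_eqVlt => /predU1P[->//|j4].
  exact: is_derive_continuous (dd j j4).
set u := fun x t => d 0%N (x - c * t).
have px j x t : (j <= 4)%N -> partial_x j u x t = d j (x - c * t).
  move=> j4; rewrite /partial_x /u.
  have dch i : (i < 4)%N -> forall s, is_derive s 1 (fun s => d i (s - c * t)) (d i.+1 (s - c * t)).
    move=> i4 s; have := @is_derive_affine _ (d i) (d i.+1) 1 (- (c * t)) s (dd i i4).
    rewrite !mul1r (_ : (fun x => d i (1 * x - c * t)) = (fun x => d i (x - c * t)))//.
    by apply/funext => y; rewrite mul1r.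
  by rewrite (@derive1n_chain _ (fun j s => d j (s - c * t)) 4 dch j j4).
have pt j x t : (j <= 4)%N -> partial_t j u x t = (- c) ^+ j * d j (x - c * t).
  move=> j4; rewrite /partial_t /u.
  have -> : (fun s => d 0%N (x - c * s)) = (fun s => (- c) ^+ 0 * d 0%N (- c * s + x)).
    by apply/funext => s; rewrite expr0 mul1r mulNr addrC.
  have dch i : (i < 4)%N -> forall s, is_derive s 1 (fun s => (- c) ^+ i * d i (- c * s + x))
      ((- c) ^+ i.+1 * d i.+1 (- c * s + x)).
    move=> i4 s; have h := @is_derive_affine _ (d i) (d i.+1) (- c) x s (dd i i4).
    by apply: is_derive_eq; rewrite /GRing.scale/= exprS; ring.
  rewrite (@derive1n_chain _ (fun j s => (- c) ^+ j * d j (- c * s + x)) 4 dch j j4).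
  by rewrite mulNr addrC.
have cu j : (j <= 4)%N -> forall z : R * R,
    {for z, continuous (fun p : R * R => d j (p.1 - c * p.2))}.
  move=> j4 z; apply: (@continuous_comp _ _ _ (fun p : R * R => p.1 - c * p.2)); last exact: dc.
  apply: cvgB; first exact: cvg_fst.
  by apply: cvgM; [exact: cvg_cst|exact: cvg_snd].
split; last by exists (d 0%N); split.
split.
- move=> x t t0; split => j j4.
    have -> : (fun s => partial_x j u s t) = (fun s => d j (s - c * t)).
      by apply/funext => s; rewrite px// ltnW.
    have := @is_derive_affine _ (d j) (d j.+1) 1 (- (c * t)) x (dd j j4).
    rewrite (_ : (fun x => d j (1 * x - c * t)) = (fun x => d j (x - c * t))); first by case.
    by apply/funext => y; rewrite mul1r.
  have -> : (fun p : R * R => partial_x j u p.1 p.2) = (fun p => d j (p.1 - c * p.2)).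
    by apply/funext => p; rewrite px.
  exact: cu.
- move=> x t t0; split => j j4.
    have j44 : (j < 4)%N by exact: ltn_trans j4 _.
    have -> : (fun s => partial_t j u x s) = (fun s => (- c) ^+ j * d j (- c * s + x)).
      by apply/funext => s; rewrite (pt _ _ _ (ltnW j44)) mulNr (addrC x).
    have h := @is_derive_affine _ (d j) (d j.+1) (- c) x t (dd j j44).
    by apply: derivableM; [exact: derivable_cst|case: h].
  have j44 : (j <= 4)%N by exact: leq_trans j4 _.
  have -> : (fun p : R * R => partial_t j u p.1 p.2) = (fun p => (- c) ^+ j * d j (p.1 - c * p.2)).
    by apply/funext => p; rewrite pt.
  by apply: cvgM; [exact: cvg_cst|exact: cu].
- move=> x t t0; rewrite pt// px// /u -[RHS](ode (x - c * t)); ring.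
- move=> t t0; split.
    by apply: cvg_comp dy; apply/cvgryPge => A; near=> x; rewrite lerBrDr; near: x;
       apply: nbhs_pinfty_ge; exact: num_real.
  by apply: cvg_comp dNy; apply/cvgrNyPle => A; near=> x; rewrite lerBlDr; near: x;
       apply: nbhs_ninfty_le; exact: num_real.
- move=> t t0.
  have -> : (fun x => partial_x 1 u x t) = (fun x => d 1%N (x - c * t)).
    by apply/funext => x; rewrite px.
  split.
    by apply: cvg_comp d1y; apply/cvgryPge => A; near=> x; rewrite lerBrDr; near: x;
       apply: nbhs_pinfty_ge; exact: num_real.
  by apply: cvg_comp d1Ny; apply/cvgrNyPle => A; near=> x; rewrite lerBlDr; near: x;
       apply: nbhs_ninfty_le; exact: num_real.
Unshelve. all: by end_near. Qed.

Lemma cvg_at_infinities f : (forall e, 0 < e -> exists T, forall x, T <= `|x| -> `|f x| <= e) ->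
  f x @[x --> +oo] --> (0 : R) /\ f x @[x --> -oo] --> (0 : R).
Proof.
move=> H; split; apply/cvgrPdist_le => e /H[T HT]; near=> x; rewrite sub0r normrN;
  apply: HT; rewrite ler_normr.
- by apply/orP; left; near: x; apply: nbhs_pinfty_ge; exact: num_real.
- by apply/orP; right; rewrite lerNr; near: x; apply: nbhs_ninfty_le; exact: num_real.
Unshelve. all: by end_near. Qed.

(** The fixed point [v] solves [v'''' + 2 v'' + al v = ga (v - M)^+].  With
[s = c / sqrt 2] one has [s^4 al = a] and [s^2 = c^2 / 2], so that scaling by [s]
produces the coefficients of the profile equation; the factor [- (a M)^-1] maps
the threshold [M] to the value [-1/a], at which [y = 1/a - v / (a M)] changes
sign. *)
Lemma wave_exists (a b c : R) : 0 < b -> b < a -> c != 0 ->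
  forall p cc k, 1 < 4 * a / c ^+ 4 -> resolvent_kernel (4 * a / c ^+ 4) p cc k ->
  (exists2 f, admissible f & 0 < dual_form k (4 * a / c ^+ 4 - 4 * b / c ^+ 4) f) ->
  exists u : R -> R -> R, travelling_wave a b c u.
Proof.
move=> b0 ab c0 p cc k al1 Hk dpos.
set al := 4 * a / c ^+ 4 in al1 Hk dpos *.
set ga := al - _ in dpos.
have a0 : 0 < a by exact: lt_trans ab.
have c4 : 0 < c ^+ 4 by rewrite exprn_even_gt0.
have ga0 : 0 < ga by rewrite /ga /al subr_gt0 ltr_pM2r ?invr_gt0// ltr_pM2l.
have [M [v [M0 v0 cF lF vE]]] := fixed_point al1 Hk ga0 dpos.
set F := excess ga M v in cF lF vE.
have [u1 [u2 [u3 [[d0 d1 d2 d3] small]]]] := resolvent_chain_small Hk cF lF.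
have vE' : convolution k F = v by apply/funext => x; rewrite -vE.
rewrite vE' in d0 d3 small.
pose u4 x := F x - 2 * u2 x - al * v x.
pose s : R := c / Num.sqrt 2.
have s2 : s ^+ 2 = c ^+ 2 / 2 by rewrite /s expr_div_n sqr_sqrtr.
have s0 : s != 0 by rewrite /s mulf_neq0// invr_neq0// gt_eqF// sqrtr_gt0.
pose w (j : nat) := nth u4 [:: v; u1; u2; u3] j.
pose K := (a * M)^-1.
pose d (j : nat) (x : R) := (if j == 0%N then a^-1 else 0) - K * s ^+ j * w j (s * x).
have dw j : (j < 4)%N -> forall x, is_derive x 1 (w j) (w j.+1 x).
  by case: j => [|[|[|[|j]]]].
have decay j : (j < 2)%N -> forall e, 0 < e -> exists T, forall x, T <= `|x| ->
    `|K * s ^+ j * w j (s * x)| <= e.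
  move=> j2 e e0; pose r := `|K * s ^+ j| + 1.
  have r0 : 0 < r by rewrite /r ltr_wpDl.
  have [T HT] := small _ (divr_gt0 e0 r0).
  exists (T / `|s|) => x Tx.
  have Tsx : T <= `|s * x| by rewrite normrM mulrC -ler_pdivrMr// normr_gt0.
  have [h0 h1 _ _] := HT _ Tsx.
  have wj : `|w j (s * x)| <= e / r by case: j j2 @r r0 HT h0 h1 => [|[|]].
  rewrite normrM (le_trans (ler_wpM2l _ wj))// mulrA ler_pdivrMr// mulrC ler_wpM2l ?(ltW e0)//.
  by rewrite /r lerDl.
have d0cvg := cvg_at_infinities (decay 0%N isT).
have d1cvg := cvg_at_infinities (decay 1%N isT).
exists (fun x t => d 0%N (x - c * t)); apply: travelling_wave_of_profile.
- move=> j j4 x; have h := @is_derive_affine _ (w j) (w j.+1) s 0 x (dw j j4).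
  have -> : d j = (fun x => (if j == 0%N then a^-1 else 0) - K * s ^+ j * w j (s * x + 0)).
    by apply/funext => z; rewrite addr0.
  by apply: is_derive_eq; rewrite /GRing.scale/= /d/= addr0 exprS; ring.
- have cu2 := is_derive_continuous d2; have cv := is_derive_continuous d0.
  have cu4 : continuous u4.
    by apply: contB; [apply: contB => //; exact: contZ|exact: contZ].
  move=> x; apply: cvgB; first exact: cvg_cst.
  apply: cvgM; first exact: cvg_cst.
  apply: (@continuous_comp _ _ _ (fun x => s * x)); last exact: cu4.
  by apply: cvgM; [exact: cvg_cst|exact: cvg_id].
- move=> x; rewrite /d /w/=; set z := s * x.
  rewrite /u4 /F /excess.
  have s4 : s ^+ 4 = c ^+ 4 / 4 by rewrite (exprM s 2 2) s2; field.
  have e1 : c ^+ 2 * (0 - K * s ^+ 2 * u2 z) = - (K * (c ^+ 4 / 2) * u2 z) by rewrite s2; ring.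
  rewrite e1 s4 /ga /al expr0 mulr1.
  have cn : c != 0 by [].
  have an : a != 0 by rewrite gt_eqF.
  have Mn : M != 0 by rewrite gt_eqF.
  have aK : a^-1 = K * M by rewrite /K; field; rewrite an Mn.
  have K0 : 0 < K by rewrite invr_gt0 mulr_gt0.
  have KaM : K * a * M = 1 by rewrite /K; field; rewrite an Mn.
  rewrite aK -mulrBr; case: (leP (v z - M) 0) => h.
    rewrite max_l; last by rewrite mulr_ge0 ?(ltW K0)// subr_ge0 -subr_le0.
    rewrite max_r; last by rewrite oppr_le0 mulr_ge0 ?(ltW K0)// subr_ge0 -subr_le0.
    by rewrite -[RHS]KaM; field.
  rewrite max_r; last by rewrite mulr_ge0_le0 ?(ltW K0)// subr_le0 ltW// -subr_gt0.
  rewrite max_l; last by rewrite oppr_ge0 mulr_ge0_le0 ?(ltW K0)// subr_le0 ltW// -subr_gt0.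
  by rewrite -[RHS]KaM; field.
- rewrite -[X in _ --> X]subr0; apply: cvgB; [exact: cvg_cst|exact: d0cvg.1].
- rewrite -[X in _ --> X]subr0; apply: cvgB; [exact: cvg_cst|exact: d0cvg.2].
- rewrite -[X in _ --> X]subr0; apply: cvgB; [exact: cvg_cst|exact: d1cvg.1].
- rewrite -[X in _ --> X]subr0; apply: cvgB; [exact: cvg_cst|exact: d1cvg.2].
- exists 0; rewrite /d/= mulr0 expr0 mulr1 -subr_eq0 addrAC subrr sub0r oppr_eq0.
  rewrite mulf_neq0//; first by rewrite invr_neq0// mulf_neq0// gt_eqF.
  by rewrite gt_eqF// (lt_le_trans _ v0)// divr_gt0.
Qed.
End wave.

(** * A smooth function of negative energy makes the dual form positive *)

Section smooth_to_dual.
Context {R : realType}.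
Local Notation mu := (@lebesgue_measure R).
Implicit Types (x y A e : R) (f g u v w : R -> R).

(** The closing estimate of [dual_form_gt0_smooth].  [d] is the gap in the
hypothesis, [e] the size of the boundary values; [GA], [IG] are the energy of
[w] on a segment and on the line, [NB], [IN] the integrals of [ga (w^-)^2];
[WF], [UF], [F2] stand for [\int w f], [\int (k * f) f] and [ga^-1 \int f^2]. *)
Lemma dual_arith (d e GA WF UF F2 IX NB IN IG b1 b2 : R) : 0 < d -> 64 * e <= d ->
  0 <= GA + 2 * WF + UF + (b1 - b2) -> - (2 * WF) - F2 = IX -> NB <= IX ->
  `|IN - NB| <= d / 8 -> `|IG - GA| <= d / 8 -> `|b1| <= 12 * e -> `|b2| <= 12 * e ->
  d = IN - IG -> 0 < UF - F2.
Proof.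
move=> ? ? ? ? ?; rewrite !ler_norml => /andP[? ?] /andP[? ?] /andP[? ?] /andP[? ?] ?.
lra.
Qed.

(** [P(x) - P(-x)], for a primitive [P], is bounded and has derivative
[g(x) + g(-x)]; on a long interval its mean slope is small, and the mean value
theorem provides a point.  Boundary terms in [w] and its derivative are thus
small at both ends of suitable segments, and no pointwise decay is required. *)
Lemma L1_small_pairs g e T : continuous g -> L1 g -> 0 < e ->
  exists2 A, T <= A & g A + g (- A) <= e.
Proof.
move=> cg lg e0.
pose P x := \int[mu]_(t in `]-oo, x]) g t.
have dP x : is_derive x 1 P (g x).
  by apply: is_derive_left_integral => // y; exact: L1S.
pose I := \int[mu]_x `|g x|.
have PI x : `|P x| <= I.
  have h := @le_normr_Rintegral _ _ R mu `]-oo, x]%classic g (measurable_itv _) (L1S (measurable_itv _) lg).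
  rewrite (le_trans h)// /I Rintegral_mkcond; apply: Rint_le.
  - rewrite /L1 -restrict_EFin; apply/integrable_restrict => //=; rewrite setTI.
    by apply: L1S => //; exact: L1_abs.
  - exact: L1_abs.
  - by move=> y; rewrite patchE; case: ifPn => _; [exact: lexx|exact: normr_ge0].
have I0 : 0 <= I by apply: Rintegral_ge0.
pose h x := P x - P (- x).
have dh x : is_derive x 1 h (g x + g (- x)).
  have dN : is_derive x 1 (fun x => P (- x)) (- g (- x)).
    have H := @is_derive1_comp _ P -%R x _ _ (dP (- x)) _.
    by apply: (is_derive_eq (H _ _)); rewrite mulrN1.
  by apply: (is_derive_eq (is_deriveB (dP x) dN)); rewrite opprK.
pose L := 4 * I / e + 1.
have L0 : 0 < L by rewrite /L ltr_wpDl//; apply: divr_ge0; [exact: mulr_ge0|exact: ltW].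
have TL : T <= T + L by rewrite lerDl ltW.
have [z zTL E] := @MVT_segment R h (fun x => g x + g (- x)) T (T + L) TL
   (fun x _ => dh x) (continuous_subspaceT (is_derive_continuous dh)).
exists z; first by move: zTL; rewrite in_itv/= => /andP[].
have E4 : (g z + g (- z)) * L <= 4 * I.
  rewrite (_ : L = T + L - T); last by ring.
  rewrite -E /h.
  have := PI (T + L); have := PI (- (T + L)); have := PI T; have := PI (- T).
  rewrite !ler_norml => /andP[? ?] /andP[? ?] /andP[? ?] /andP[? ?]; lra.
rewrite -(ler_pM2r L0) (le_trans E4)// /L mulrDr mulrCA mulfV ?gt_eqF// !mulr1.
by rewrite lerDl ltW.
Qed.

Definition cutoff (B : R) x : R := Num.max (Num.min 1 (B + 1 - `|x|)) 0.

Lemma cutoff01 B x : 0 <= cutoff B x <= 1.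
Proof. by rewrite /cutoff le_max lexx orbT/= ge_max ge_min lexx/= ler01. Qed.

Lemma cutoff1 B x : `|x| <= B -> cutoff B x = 1.
Proof. by move=> xB; rewrite /cutoff min_l ?max_l//; lra. Qed.

Lemma cutoff_continuous B : continuous (cutoff B).
Proof.
apply: cont_max0 => x.
apply: (@continuous_min _ _ (fun=> 1) (fun x => B + 1 - `|x|)); first exact: cvg_cst.
by apply: cvgB; [exact: cvg_cst|exact: norm_continuous].
Qed.

Lemma cutoff_supp B x : B + 1 <= `|x| -> cutoff B x = 0.
Proof. by move=> Bx; rewrite /cutoff max_r// ge_min; apply/orP; right; lra. Qed.

Variables (al p c : R) (k : R -> R) (ga : R).
Hypothesis (al1 : 1 < al) (Hk : resolvent_kernel al p c k) (ga0 : 0 < ga).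

(** With [f = ga w^-], the energy of [w + k * f] is nonnegative, and expands to
[E(w) + 2 \int w f + \int (k * f) f], where [E] is the quadratic form on the left
of the hypothesis.  As [\int w f = - ga^-1 \int f^2], this says that
[dual_form f >= ga \int (w^-)^2 - E(w) > 0].  The density must have compact
support, so [w^-] is multiplied by a cutoff that is 1 where most of [(w^-)^2]
lives. *)
Lemma dual_form_gt0_smooth w w1 w2 :
  (forall x, is_derive x 1 w (w1 x)) -> (forall x, is_derive x 1 w1 (w2 x)) ->
  continuous w2 ->
  L1 (fun x => w x ^+ 2) -> L1 (fun x => w1 x ^+ 2) -> L1 (fun x => w2 x ^+ 2) ->
  \int[mu]_x (w2 x ^+ 2 - 2 * w1 x ^+ 2 + al * w x ^+ 2) < \int[mu]_x (ga * w^\- x ^+ 2) ->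
  exists2 f, admissible f & 0 < dual_form k ga f.
Proof.
move=> dw dw1 cw2 lw lw1 lw2 Jneg.
have cw := is_derive_continuous dw; have cw1 := is_derive_continuous dw1.
have cn : continuous (w^\-) by apply: cont_max0 => x; apply: cvgN; exact: cw.
have n0 x : 0 <= w^\- x by rewrite /funrneg le_max lexx orbT.
pose G x := w2 x ^+ 2 - 2 * w1 x ^+ 2 + al * w x ^+ 2.
pose N x := ga * w^\- x ^+ 2.
have cN : continuous N by exact/contZ/contX.
have cG : continuous G.
  by apply: contD; [apply: contB; [exact: contX|exact/contZ/contX]|exact/contZ/contX].
have lG : L1 G by apply: L1D; [apply: L1B => //; exact: L1Z|exact: L1Z].
have lN : L1 N.
  apply: L1Z; apply: (@L1_le _ _ (fun x => w x ^+ 2)) => //.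
    by apply: continuous_measurable_fun; exact: contX.
  move=> x; rewrite ger0_norm ?sqr_ge0// /funrneg; case: (leP (- w x) 0) => h.
    by rewrite expr0n/= sqr_ge0.
  by rewrite sqrrN.
have gan0 : ga != 0 by rewrite gt_eqF.
set IG := \int[mu]_x G x in Jneg. set IN := \int[mu]_x N x in Jneg.
pose d := IN - IG; have d0 : 0 < d by rewrite subr_gt0.
have d8 : 0 < d / 8 by rewrite divr_gt0.
have /cvgrPdist_le /(_ _ d8) [B _ HB] := Rint_segments lN.
have {}HB := HB B (leqnn B); rewrite -/IN in HB.
pose th := cutoff B%:R.
pose f x := ga * (w^\- x * th x).
have cth : continuous th by exact: cutoff_continuous.
have th01 x : 0 <= th x <= 1 by exact: cutoff01.
have Cth : Cc th by split => //; exists (B%:R + 1) => x; exact: cutoff_supp.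
have Cf : Cc f by apply: CcZ; exact: CcM.
have Af : admissible f.
  split => // x; rewrite mulr_ge0 ?(ltW ga0)// mulr_ge0//.
  by have /andP[] := th01 x.
exists f => //.
have [cf _] := Cf; have lf := Cc_L1 Cf.
have [u1 [u2 [u3 [du Hu]]]] := resolvent_chain_small Hk cf lf.
have cu := convolution_continuous Hk cf lf.
pose e := Num.min 1 (d / 64).
have e0 : 0 < e by rewrite lt_min ltr01 divr_gt0.
have e1 : 0 <= e <= 1 by rewrite ltW//= ge_min lexx.
have ed : 64 * e <= d by rewrite mulrC -ler_pdivlMr// ge_min lexx orbT.
have ee0 : 0 < e ^+ 2 by rewrite exprn_gt0.
have [Tu HTu] := Hu _ e0.
have [Tf HTf] := Cc_Rint Cf.
have [Tn HTn] := Cc_Rint Cth.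
have [TG HTG] := Rint_segment_near cG lG d8.
pose g x := w x ^+ 2 + w1 x ^+ 2.
have cg : continuous g by apply: contD; exact: contX.
have lg : L1 g by exact: L1D.
pose T := Num.max (Num.max Tu Tf) (Num.max (Num.max Tn TG) B%:R).
have [A TA gA] := L1_small_pairs T cg lg ee0.
move: TA; rewrite !ge_max => /andP[/andP[uA fA] /andP[/andP[nA GA] BA]].
have A0 : 0 <= A by rewrite (le_trans _ BA).
have small x : `|x| = A -> g x <= e ^+ 2 ->
    `|energy_bdry w w1 (convolution k f) u1 u2 u3 x| <= 12 * e.
  move=> xA gx.
  have [a0 a1 a2 a3] : [/\ `|convolution k f x| <= e, `|u1 x| <= e, `|u2 x| <= e & `|u3 x| <= e].
    by apply: HTu; rewrite xA.
  have we : `|w x| <= e.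
    by apply: (norm_le_of_sqr (ltW e0)); rewrite (le_trans _ gx)// /g lerDl sqr_ge0.
  have w1e : `|w1 x| <= e.
    by apply: (norm_le_of_sqr (ltW e0)); rewrite (le_trans _ gx)// /g lerDr sqr_ge0.
  have := mul_small e1 we w1e; have := mul_small e1 w1e a2; have := mul_small e1 we a3.
  have := mul_small e1 w1e a0; have := mul_small e1 we a1.
  have := mul_small e1 a1 a2; have := mul_small e1 a0 a3.
  rewrite /energy_bdry !ler_norml => /andP[? ?] /andP[? ?] /andP[? ?] /andP[? ?] /andP[? ?] /andP[? ?] /andP[? ?].
  by apply/andP; split; lra.
have gx0 x : 0 <= g x by rewrite addr_ge0 ?sqr_ge0.
have bA := small A (ger0_norm A0) (le_trans (_ : g A <= g A + g (- A)) gA).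
have bNA := small (- A) _ (le_trans (_ : g (- A) <= g A + g (- A)) gA).
rewrite lerDl in bA; rewrite lerDr normrN in bNA.
have {}bA := bA (gx0 _); have {}bNA := bNA (ger0_norm A0) (gx0 _).
have E := energy_ge A0 du cf dw dw1 cw2.
have pos : 0 <= (al - 1) * \int[mu]_(x in `[- A, A]) ((w x + convolution k f x) ^+ 2).
  apply: mulr_ge0; first by rewrite subr_ge0 ltW.
  by apply: Rintegral_ge0 => x _; exact: sqr_ge0.
have {}E := le_trans pos E.
rewrite -(HTf w A cw fA) -(HTf (convolution k f) A cu fA) in E.
have {}HTG := HTG A GA.
(* what the cutoff leaves of [ga (w^-)^2]; it is all of it where [th = 1] *)
pose X x := N x * (2 * th x - th x ^+ 2).
have XE : - (2 * \int[mu]_x (w x * f x)) - ga^-1 * \int[mu]_x (f x ^+ 2) = \int[mu]_x X x.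
  have l1 := Cc_L1 (CcM cw Cf); have l2 := Cc_L1 (CcX Cf).
  rewrite -mulNr -!RintZ// -RintB//; [|exact: L1Z|exact: L1Z].
  apply: eq_Rintegral => x _; rewrite /X /N /f /funrneg.
  by case: (leP (- w x) 0) => h; field.
have X0 x : 0 <= X x.
  have /andP[t0 t1] := th01 x.
  by rewrite /X mulr_ge0//; [rewrite /N mulr_ge0 ?sqr_ge0 ?(ltW ga0)|nra].
have CX : Cc X.
  have -> : X = (fun x => (N x * (2 - th x)) * th x) by apply/funext => x; rewrite /X; ring.
  by apply: CcM => //; apply: contM => //; apply: contB => //; exact: cst_continuous.
have IX : \int[mu]_(x in `[- B%:R, B%:R]) N x <= \int[mu]_x X x.
  apply: le_trans (segment_le_Rint B%:R (Cc_L1 CX) X0).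
  apply: segment_le => //; first by case: CX.
  move=> x; rewrite in_itv/= -ler_norml => xB.
  by rewrite /X /th cutoff1// expr1n mulr1 (_ : 2 - 1 = 1 :> R) ?mulr1//; ring.
rewrite /dual_form.
exact: (dual_arith d0 ed E XE IX HB HTG bA bNA erefl).
Qed.

End smooth_to_dual.

(** * A bump function *)

Section bump.
Context {R : realType}.
Implicit Types (x y : R) (n m : nat).

(** A family containing [exp(-1/x)] and closed, up to linear combinations, under
differentiation. *)
Definition flat_exp n x : R := if 0 < x then x ^- n * expR (- x^-1) else 0.

Lemma flat_exp_ge0 n x : 0 <= flat_exp n x.
Proof.
by rewrite /flat_exp; case: ifPn => // x0; rewrite mulr_ge0 ?expR_ge0// invr_ge0 exprn_ge0// ltW.
Qed.

(** One term of the exponential series bounds [exp(1/x)] from below.  The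
quadratic bound is what makes the function differentiable at the origin. *)
Lemma flat_exp_le n x : flat_exp n x <= n.+2`!%:R * x ^+ 2.
Proof.
rewrite /flat_exp; case: ifPn => x0; last by rewrite mulr_ge0 ?sqr_ge0.
have f0 : 0 < n.+2`!%:R :> R by rewrite ltr0n fact_gt0.
have y0 : 0 <= x^-1 by rewrite invr_ge0 ltW.
have := expR_ge1Dxn n.+1 y0 => h.
have h1 : x ^- n.+2 / n.+2`!%:R <= expR x^-1.
  by rewrite -exprVn (le_trans _ h)// lerDr.
rewrite expRN ler_pdivrMr ?expR_gt0//.
rewrite ler_pdivrMr// in h1.
have xn : x ^- n = x ^- n.+2 * x ^+ 2.
  by rewrite !exprS; field; rewrite !gt_eqF// exprn_gt0.
rewrite xn (_ : n.+2`!%:R * x ^+ 2 * expR x^-1 = expR x^-1 * n.+2`!%:R * x ^+ 2); last by ring.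
by rewrite ler_wpM2r ?sqr_ge0.
Qed.

Lemma is_derive_pow n x : is_derive x 1 (fun y : R => y ^+ n) (n%:R * x ^+ n.-1).
Proof.
have h := is_deriveX n (is_derive_id x 1).
have -> : (fun y : R => y ^+ n) = (@id R) ^+ n by apply/funext => y; rewrite exprfctE.
by apply: (is_derive_eq h); rewrite /GRing.scale/= mulr1.
Qed.

Lemma is_derive_flat_exp n x : is_derive x 1 (flat_exp n) (- n%:R * flat_exp n.+1 x + flat_exp n.+2 x).
Proof.
have [x0|x0|<-] := ltgtP 0 x.
- apply: (@is_derive_near _ (fun y => y ^- n * expR (- y^-1))).
    near=> y; rewrite /flat_exp ifT//; near: y; exact: lt_nbhsr.
  have xn0 : x != 0 by rewrite gt_eqF.
  have xnn : x ^+ n != 0 by rewrite expf_neq0.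
  have dX : is_derive x 1 (fun y : R => y ^+ n) (n%:R * x ^+ n.-1).
    exact: is_derive_pow.
  have dI : is_derive x 1 (fun y : R => y ^- n) (- (x ^+ n) ^- 2 * (n%:R * x ^+ n.-1)).
    apply: (is_derive_eq (@is_deriveV _ (fun y : R => y ^+ n) x _ _ xnn dX)).
    by rewrite /GRing.scale/=.
  have dV : is_derive x 1 (fun y : R => y^-1) (- x ^- 2 * 1).
    apply: (is_derive_eq (@is_deriveV _ id x _ _ xn0 (is_derive_id x 1))).
    by rewrite /GRing.scale/=.
  have dE : is_derive x 1 (fun y : R => expR (- y^-1)) (expR (- x^-1) * (x ^- 2)).
    by apply: is_derive_eq; rewrite mulr1 opprK.
  apply: (is_derive_eq (is_deriveM dI dE)); rewrite /GRing.scale/= /flat_exp x0.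
  case: n xnn {dX dI} => [|n] xnn /=.
    by field.
  rewrite !exprS; field.
  by rewrite xn0/= expf_neq0.
- apply: (@is_derive_near _ (fun=> 0)).
    near=> y; rewrite /flat_exp ifF//; apply/negbTE; rewrite -leNgt; near: y; exact: lt_le_nbhsl.
  have z j : flat_exp j x = 0 by rewrite /flat_exp ifF//; apply/negbTE; rewrite -leNgt ltW.
  by rewrite !z mulr0 addr0; exact: is_derive_cst.
- have z j : flat_exp j 0 = 0 by rewrite /flat_exp ltxx.
  rewrite !z mulr0 addr0.
  have dcv : h^-1 *: ((flat_exp n \o shift 0) (h *: 1) - flat_exp n 0) @[h --> 0^'] --> (0 : R).
    apply/cvgrPdist_le => e e0; pose C : R := n.+2`!%:R.
    have C0 : 0 < C by rewrite ltr0n fact_gt0.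
    near=> h; rewrite sub0r normrN z subr0 /= addr0 /GRing.scale/= mulr1 normrM.
    have h0 : h != 0 by near: h; exact: nbhs_dnbhs_neq.
    rewrite (ger0_norm (flat_exp_ge0 _ _)) normfV mulrC ler_pdivrMr ?normr_gt0//.
    rewrite (le_trans (flat_exp_le n h))// -(@real_normK _ h) ?num_real// expr2 mulrA ler_wpM2r//.
    have : `|h| <= e / C by near: h; apply: dnbhs0_le; exact: divr_gt0.
    by rewrite ler_pdivlMr// mulrC.
  by apply: DeriveDef; [apply/cvg_ex; exists 0|apply/cvg_lim].
Unshelve. all: by end_near. Qed.

Lemma flat_exp0 n x : x <= 0 -> flat_exp n x = 0.
Proof. by move=> x0; rewrite /flat_exp ifF//; apply/negbTE; rewrite -leNgt. Qed.

(** The derivatives of [exp(-1/(1+x)) exp(-1/(1-x))] are sums of such terms, and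
are encoded as lists of triples on which differentiation acts formally
([bump_step]). *)
Definition bump_term (q : R * nat * nat) x : R :=
  q.1.1 * (flat_exp q.1.2 (1 + x) * flat_exp q.2 (1 - x)).

Definition bump_sum (l : seq (R * nat * nat)) x : R := \sum_(q <- l) bump_term q x.

Definition bump_step (q : R * nat * nat) : seq (R * nat * nat) :=
  let: (r, n, m) := q in
  [:: (- (r * n%:R), n.+1, m); (r, n.+2, m); (r * m%:R, n, m.+1); (- r, n, m.+2)].

Lemma is_derive_bump_term q x : is_derive x 1 (bump_term q) (bump_sum (bump_step q) x).
Proof.
case: q => [[r n] m].
have dp : is_derive x 1 (fun x : R => 1 + x) 1.
  by apply: (is_derive_eq (is_deriveD (is_derive_cst (1 : R) x 1) (is_derive_id x 1))); rewrite add0r.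
have dm : is_derive x 1 (fun x : R => 1 - x) (- 1).
  by apply: (is_derive_eq (is_deriveB (is_derive_cst (1 : R) x 1) (is_derive_id x 1))); rewrite add0r.
have d1 := @is_derive1_comp _ (flat_exp n) (fun x : R => 1 + x) x _ _ (is_derive_flat_exp n (1 + x)) dp.
have d2 := @is_derive1_comp _ (flat_exp m) (fun x : R => 1 - x) x _ _ (is_derive_flat_exp m (1 - x)) dm.
have d3 := is_deriveM d1 d2.
have d4 := is_deriveZ r d3.
apply: (is_derive_eq d4).
rewrite /bump_sum /bump_step !big_cons big_nil /bump_term /GRing.scale/=; ring.
Qed.

Lemma is_derive_bump_sum l x :
  is_derive x 1 (bump_sum l) (bump_sum (flatten (map bump_step l)) x).
Proof.
elim: l => [|q l IH].
  rewrite /bump_sum/= big_nil (_ : (fun x => _) = (fun=> 0)); last first.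
    by apply/funext => y; rewrite big_nil.
  exact: is_derive_cst.
have -> : bump_sum (q :: l) = (fun x => bump_term q x + bump_sum l x).
  by apply/funext => y; rewrite /bump_sum big_cons.
rewrite /= {2}/bump_sum big_cat/=.
exact: (is_deriveD (is_derive_bump_term q x) IH).
Qed.

Lemma bump_exists : exists d : nat -> R -> R,
  [/\ forall j x, is_derive x 1 (d j) (d j.+1 x),
      forall j x, 1 <= `|x| -> d j x = 0,
      forall x, 0 <= d 0%N x, forall x, d 0%N (- x) = d 0%N x & 0 < d 0%N 0].
Proof.
pose l j := iter j (fun l => flatten (map bump_step l)) [:: (1 : R, 0%N, 0%N)].
exists (fun j => bump_sum (l j)); split.
- by move=> j x; exact: is_derive_bump_sum.
- move=> j x x1; rewrite /bump_sum big1// => q _; rewrite /bump_term.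
  move: x1; rewrite ler_normr => /orP[x1|x1].
    by rewrite (@flat_exp0 _ (1 - x)) ?mulr0//; lra.
  by rewrite (@flat_exp0 _ (1 + x)) ?mul0r ?mulr0//; lra.
- move=> x; rewrite /bump_sum big_seq1 /bump_term/= mul1r.
  by rewrite mulr_ge0// flat_exp_ge0.
- by move=> x; rewrite /bump_sum !big_seq1 /bump_term/= opprK [flat_exp _ (1 - x) * _]mulrC.
- rewrite /bump_sum big_seq1 /bump_term/= mul1r addr0 subr0 /flat_exp ltr01.
  by rewrite mulr_gt0// mulr_gt0 ?expR_gt0// invr_gt0 exprn_gt0.
Qed.

End bump.

(** * Mollification *)

Section mollify.
Context {R : realType}.
Local Notation mu := (@lebesgue_measure R).
Implicit Types (a b x y A e r M : R) (f g u v w th : R -> R).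

Lemma Cc_bounded th : Cc th -> exists2 M, 0 <= M & forall x, `|th x| <= M.
Proof.
move=> [cth [A thA]].
have AA : - `|A| <= `|A| by rewrite (@le_trans _ _ 0)// oppr_le0.
have cn : {within `[- `|A|, `|A|], continuous (fun x => `|th x|)}.
  exact/continuous_subspaceT/cont_abs.
have [z _ Hz] := EVT_max AA cn.
exists `|th z| => // x; have [xA|Ax] := leP `|x| `|A|.
  by apply: Hz; rewrite in_itv/= -ler_norml.
by rewrite thA ?normr0// (le_trans (ler_norm A))// ltW.
Qed.

Lemma locally_integrable_segment g a b : locally_integrable setT g ->
  mu.-integrable `[a, b] (EFin \o g).
Proof.
move=> [mg _ ig]; apply/integrableP; split.
  by apply/measurable_EFinP; exact: measurable_funTS.
by apply: ig => //; exact: segment_compact.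
Qed.

Lemma L1_restrict_segment g a b : locally_integrable setT g ->
  L1 (g \_ `[a, b]).
Proof.
move=> lg; rewrite /L1 -restrict_EFin; apply/integrable_restrict => //=; rewrite setTI.
exact: locally_integrable_segment.
Qed.

Definition vanishes_beyond th r := forall x, r <= `|x| -> th x = 0.

Lemma convolution_localE th r g x y : vanishes_beyond th r ->
  th (x - y) * g y = th (x - y) * (g \_ `[x - r, x + r]) y.
Proof.
move=> v; rewrite patchE; case: ifPn => //; rewrite notin_setE/= in_itv/= => yI.
suff -> : th (x - y) = 0 by rewrite !mul0r.
apply: v; rewrite leNgt; apply/negP; rewrite ltr_norml => /andP[? ?].
by apply: yI; apply/andP; split; lra.
Qed.

Lemma L1_convolution_local th r g x : continuous th -> vanishes_beyond th r -> locally_integrable setT g ->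
  L1 (fun y => th (x - y) * g y).
Proof.
move=> cth vth lg; rewrite (_ : (fun y => _) = (fun y => th (x - y) * (g \_ `[x - r, x + r]) y)).
  have [M M0 HM] : exists2 M, 0 <= M & forall x, `|th x| <= M.
    by apply: Cc_bounded; split => //; exists r.
  apply: (@L1_mul_bounded _ _ _ M) => //; first exact: continuous_subl.
  exact: L1_restrict_segment.
by apply/funext => y; exact: convolution_localE.
Qed.

Lemma is_derive_convolution th (th' : R -> R) r g (a : R) : (forall x, is_derive x 1 th (th' x)) ->
  continuous th' -> vanishes_beyond th r -> vanishes_beyond th' r -> locally_integrable setT g ->
  is_derive a 1 (convolution th g) (convolution th' g a).
Proof.
move=> dth cth' vth vth' lg.
have cth := is_derive_continuous dth.
have [M M0 HM] : exists2 M, 0 <= M & forall x, `|th' x| <= M.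
  by apply: Cc_bounded; split => //; exists r.
pose f x y := th (x - y) * g y.
pose G y := M * `|(g \_ `[a - 1 - r, a + 1 + r]) y|.
have Ia : `](a - 1), (a + 1)[%classic a by rewrite /= in_itv/=; apply/andP; split; lra.
have df x y : is_derive x 1 (f ^~ y) (th' (x - y) * g y).
  have ds : is_derive x 1 (fun x : R => x - y) 1.
    by apply: (is_derive_eq (is_deriveB (is_derive_id x 1) (is_derive_cst y x 1))); rewrite subr0.
  have h := @is_derive1_comp _ th (fun x : R => x - y) x _ _ (dth (x - y)) ds.
  apply: (is_derive_eq (is_deriveM h (is_derive_cst (g y) x 1))).
  by rewrite /GRing.scale/= mulr0 add0r mulr1 mulrC.
have d1E x y : partial1of2 f x y = th' (x - y) * g y.
  by rewrite partial1of2E; case: (df x y).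
have G0 y : 0 <= G y by rewrite mulr_ge0.
have lG : L1 G by apply: L1Z; exact/L1_abs/L1_restrict_segment.
have intf x : `](a - 1), (a + 1)[%classic x -> mu.-integrable setT (EFin \o f x).
  by move=> _; exact: (L1_convolution_local x cth vth lg).
have der x y : `](a - 1), (a + 1)[%classic x -> [set: R] y -> derivable (f ^~ y) x 1.
  by move=> _ _; case: (df x y).
have Gub x y : `](a - 1), (a + 1)[%classic x -> [set: R] y -> `|partial1of2 f x y| <= G y.
  rewrite /= in_itv/= => /andP[x1 x2] _; rewrite d1E (convolution_localE _ _ _ vth') normrM.
  apply: ler_pM => //; rewrite !patchE; case: ifPn; case: ifPn => //.
    rewrite notin_setE => h1; rewrite inE => h2; exfalso; apply: h1; move: h2.
    by rewrite /= !in_itv/= => /andP[? ?]; apply/andP; split; lra.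
  by move=> _ _; rewrite normr0.
apply: DeriveDef.
  exact: (derivable_under_integral measurableT Ia intf der G0 lG Gub).
rewrite -derive1E (differentiation_under_integral measurableT Ia intf der G0 lG Gub).
by apply: eq_Rintegral => y _; rewrite d1E.
Qed.

Section jensen.
Variables (th : R -> R) (r : R).
Hypothesis (cth : continuous th) (th0 : forall x, 0 <= th x) (vth : vanishes_beyond th r).
Hypothesis (even : forall x, th (- x) = th x) (mass : \int[mu]_x th x = 1).

Let Cth : Cc th. Proof. by split => //; exists r. Qed.

Let shiftE x : (fun y => th (x - y)) = (fun y => th (y + - x)).
Proof. by apply/funext => y; rewrite -even opprB. Qed.

Lemma mass_reflected_kernel x : \int[mu]_y th (x - y) = 1.
Proof. by rewrite shiftE Rint_shift//; exact: Cc_L1. Qed.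

Lemma L1_reflected_kernel x : L1 (fun y => th (x - y)).
Proof. by rewrite shiftE; apply: shift_L1 => //; exact: Cc_L1. Qed.

(** Jensen: the variance of [g] under the density [th (x - y)] is nonnegative. *)
Lemma convolution_sqr_le g x : locally_integrable setT g -> L1 (fun y => g y ^+ 2) ->
  convolution th g x ^+ 2 <= \int[mu]_y (th (x - y) * g y ^+ 2).
Proof.
move=> lg lg2; set m := convolution th g x; have lk := L1_reflected_kernel x.
have l1 := L1_convolution_local x cth vth lg.
have [M M0 HM] := Cc_bounded Cth.
have l2 : L1 (fun y => th (x - y) * g y ^+ 2).
  by apply: (@L1_mul_bounded _ _ _ M) => //; exact: continuous_subl.
have h : 0 <= \int[mu]_y (th (x - y) * (g y - m) ^+ 2).
  by apply: Rintegral_ge0 => y _; rewrite mulr_ge0 ?sqr_ge0.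
have E t : \int[mu]_y (th (x - y) * (g y - t) ^+ 2) =
   \int[mu]_y (th (x - y) * g y ^+ 2) + (- 2 * t) * \int[mu]_y (th (x - y) * g y)
   + t ^+ 2 * \int[mu]_y th (x - y).
  rewrite -!RintZ// -!RintD//; try by (do ?apply: L1D => //; exact: L1Z).
  by apply: eq_Rintegral => y _; ring.
rewrite (E m) mass_reflected_kernel -/(convolution th g x) -/m in h.
lra.
Qed.

(** Integrate [convolution_sqr_le] in [x] and exchange the integrals. *)
Lemma convolution_L2 g : locally_integrable setT g -> L1 (fun y => g y ^+ 2) ->
  continuous (convolution th g) ->
  L1 (fun x => convolution th g x ^+ 2) /\
  \int[mu]_x (convolution th g x ^+ 2) <= \int[mu]_x (g x ^+ 2).
Proof.
move=> lg lg2 cm; have [mg _ _] := lg.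
have [M M0 HM] := Cc_bounded Cth.
have l2 x : L1 (fun y => th (x - y) * g y ^+ 2).
  by apply: (@L1_mul_bounded _ _ _ M) => //; exact: continuous_subl.
pose F (z : measurableTypeR R * measurableTypeR R) := (th (z.1 - z.2) * g z.2 ^+ 2)%:E.
have mF : measurable_fun setT F.
  apply/measurable_EFinP; apply: measurable_funM.
    apply: measurableT_comp; first exact: continuous_measurable_fun.
    by apply: measurable_funB; [exact: measurable_fst|exact: measurable_snd].
  apply: (measurableT_comp (measurable_funX _ mg)); exact: measurable_snd.
have F0 z : (0 <= F z)%E by rewrite lee_fin mulr_ge0 ?sqr_ge0.
have tonelli : (\int[mu]_x \int[mu]_y F (x, y) = \int[mu]_y \int[mu]_x F (x, y))%E.
  by have h := @fubini_tonelli _ _ _ _ R mu mu F mF F0; exact: h.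
have mm : measurable_fun setT (fun x => (convolution th g x ^+ 2)%:E).
  by apply/measurable_EFinP; apply: continuous_measurable_fun; exact: contX.
have key : (\int[mu]_x (convolution th g x ^+ 2)%:E <= \int[mu]_x (g x ^+ 2)%:E)%E.
  apply: (@le_trans _ _ (\int[mu]_x \int[mu]_y F (x, y))%E).
    apply: ge0_le_integral => //.
    - by move=> x _; rewrite lee_fin sqr_ge0.
    - exact: (measurable_fun_fubini_tonelli_F F mF F0).
    - move=> x _; rewrite /F/= -[leRHS]fineK.
        by rewrite lee_fin; exact: convolution_sqr_le.
      by apply: integrable_fin_num => //; exact: l2.
  rewrite tonelli; apply: ge0_le_integral => //.
  - by move=> x _; apply: integral_ge0.
  - exact: (measurable_fun_fubini_tonelli_G F mF F0).
  - by apply: measurable_int; exact: lg2.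
  - move=> y _; rewrite /F/=.
    have ly : L1 (fun x => g y ^+ 2 * th (x - y)).
      by apply: L1Z; apply: shift_L1 => //; exact: Cc_L1.
    under eq_integral do rewrite mulrC.
    rewrite -[leLHS]fineK; last by apply: integrable_fin_num => //; exact: ly.
    rewrite lee_fin -/(Rintegral mu setT (fun x => g y ^+ 2 * th (x - y))).
    rewrite RintZ; last by apply: shift_L1 => //; exact: Cc_L1.
    by rewrite Rint_shift ?mass ?mulr1//; exact: Cc_L1.
have g2fin : (\int[mu]_x (g x ^+ 2)%:E \is a fin_num)%E.
  by apply: integrable_fin_num => //; exact: lg2.
have lm : L1 (fun x => convolution th g x ^+ 2).
  apply/integrableP; split => //.
  under eq_integral do rewrite gee0_abs ?lee_fin ?sqr_ge0//.
  by rewrite (le_lt_trans key)// ltey_eq g2fin.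
split => //; rewrite /Rintegral fine_le//.
by apply: integrable_fin_num => //; exact: lm.
Qed.

End jensen.

End mollify.

(** * An approximate identity of test functions *)

Section approximate_identity.
Context {R : realType}.
Local Notation mu := (@lebesgue_measure R).
Implicit Types (a b x y A e r M : R) (f g u v w : R -> R) (n j k : nat).

(** [th n j] is the rescaled [j]-th derivative of one bump, not the [j]-th
derivative of the rescaled bump; hence the factor [n.+1] in the first clause.
The pointwise bound with the right scaling is what convergence at Lebesgue
points needs. *)
Definition approx_id (th : nat -> nat -> R -> R) (M : R) : Prop :=
  [/\ forall n j x, is_derive x 1 (th n j) (n.+1%:R * th n j.+1 x),
      forall n j, vanishes_beyond (th n j) n.+1%:R^-1,
      forall n x, 0 <= th n 0%N x <= M * n.+1%:R,
      forall n x, th n 0%N (- x) = th n 0%N x &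
      forall n, \int[mu]_x th n 0%N x = 1].

Lemma approx_id_exists : exists th M, approx_id th M.
Proof.
have [d [dd dv d0 de d00]] := @bump_exists R.
have cd j : continuous (d j) by exact: is_derive_continuous (dd j).
have Cd : Cc (d 0%N) by split => //; exists 1 => x; exact: dv.
have ld := Cc_L1 Cd.
set I := \int[mu]_x d 0%N x.
have I0 : 0 < I.
  pose e := d 0%N 0 / 2; have e0 : 0 < e by rewrite divr_gt0.
  have /cvgrPdist_le /(_ _ e0) := cd 0%N 0.
  move=> /nbhs_ballP[r /= r0 Hr].
  pose q := r / 2; have q0 : 0 < q by rewrite divr_gt0.
  apply: lt_le_trans (segment_le_Rint q ld d0).
  have qq : - q <= q by lra.
  apply: (@lt_le_trans _ _ (\int[mu]_(x in `[- q, q]) e)).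
    rewrite Rintegral_cst//= lebesgue_measure_itv/= lte_fin ifT; last by lra.
    by rewrite mulr_gt0//=; lra.
  apply: segment_le => //; first exact: cst_continuous.
  move=> x; rewrite in_itv/= -ler_norml => xq.
  have /Hr : ball (0 : R) r x.
    by rewrite /ball/= sub0r normrN (le_lt_trans xq)// /q; lra.
  have eE : d 0%N 0 = 2 * e by rewrite /e; field.
  by rewrite eE ler_norml => /andP[_ ?]; lra.
have [M M0 HM] := Cc_bounded Cd.
have In0 : I != 0 by rewrite gt_eqF.
exists (fun n j x => n.+1%:R * (I^-1 * d j (n.+1%:R * x))), (M / I).
have dsc n j x : is_derive x 1 (fun x => d j (n.+1%:R * x)) (n.+1%:R * d j.+1 (n.+1%:R * x)).
  have := @is_derive_affine _ (d j) (d j.+1) n.+1%:R 0 x (dd j).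
  rewrite (_ : (fun x0 => d j (n.+1%:R * x0 + 0)) = (fun x0 => d j (n.+1%:R * x0))).
    by rewrite addr0.
  by apply/funext => y; rewrite addr0.
split.
- by move=> n j x; have h := dsc n j x; apply: is_derive_eq; rewrite /GRing.scale/=; ring.
- move=> n j x nx; rewrite dv ?mulr0// normrM ger0_norm//.
  by rewrite -ler_pdivrMl ?ltr0n// mulr1.
- move=> n x; apply/andP; split.
    by rewrite mulr_ge0// mulr_ge0// invr_ge0 ltW.
  rewrite mulrC ler_pM2r ?ltr0n// mulrC ler_pM2r ?invr_gt0//.
  by rewrite (le_trans (ler_norm _)).
- by move=> n x; rewrite mulrN de.
- move=> n; have nn : n.+1%:R != 0 :> R by rewrite pnatr_eq0.
  set s : R := n.+1%:R; have s0 : 0 < s by rewrite ltr0n.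
  pose D x := \int[mu]_(t in `]-oo, x]) d 0%N t.
  have dD x : is_derive x 1 D (d 0%N x).
    by apply: is_derive_left_integral => // y; exact: L1S.
  have E1 : I = D 1 - D (- 1).
    have l1 : - 1 <= 1 :> R by lra.
    rewrite -(ftc l1 dD (@cd 0%N)) /I.
    by have [_ ->] := Cc_segment (@cd 0%N) (dv 0%N).
  have v1 x : s^-1 <= `|x| -> s * (I^-1 * d 0%N (s * x)) = 0.
    move=> sx; rewrite dv ?mulr0// normrM (ger0_norm (ltW s0)).
    by rewrite -ler_pdivrMl// mulr1.
  have ct : continuous (fun x => s * (I^-1 * d 0%N (s * x))).
    by apply/contZ/contZ; exact: is_derive_continuous (dsc n 0%N).
  have [_ ->] := Cc_segment ct v1.
  have si : - s^-1 <= s^-1 by rewrite (@le_trans _ _ 0)// ?oppr_le0 invr_ge0 ltW.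
  have dDs x : is_derive x 1 (fun x => I^-1 * D (s * x)) (s * (I^-1 * d 0%N (s * x))).
    have := @is_derive_affine _ D (d 0%N) s 0 x dD.
    rewrite (_ : (fun x0 => D (s * x0 + 0)) = (fun x0 => D (s * x0))).
      by rewrite addr0 => h; apply: is_derive_eq; rewrite /GRing.scale/=; ring.
    by apply/funext => y; rewrite addr0.
  by rewrite (ftc si dDs ct) mulrN mulfV// -mulrBr -E1 mulVf.
Qed.

Variables (th : nat -> nat -> R -> R) (M : R).
Hypothesis (Hth : approx_id th M).

Let dth n j x : is_derive x 1 (th n j) (n.+1%:R * th n j.+1 x).
Proof. by case: Hth. Qed.
Let cth n j : continuous (th n j).
Proof. by exact: is_derive_continuous (dth n j). Qed.
Let vth n j : vanishes_beyond (th n j) n.+1%:R^-1.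
Proof. by case: Hth. Qed.
Let th0 n x : 0 <= th n 0%N x.
Proof. by case: Hth => _ _ /(_ n x)/andP[]. Qed.

Lemma is_derive_approx n j g x : locally_integrable setT g ->
  is_derive x 1 (convolution (th n j) g) (n.+1%:R * convolution (th n j.+1) g x).
Proof.
move=> lg.
have v' : vanishes_beyond (fun x => n.+1%:R * th n j.+1 x) n.+1%:R^-1.
  by move=> y /vth ->; rewrite mulr0.
have := @is_derive_convolution _ (th n j) (fun x => n.+1%:R * th n j.+1 x) _ g x (dth n j)
  (contZ (@cth n j.+1)) (@vth n j) v' lg.
move=> h; apply: (is_derive_eq h); rewrite /convolution -RintZ.
  by apply: eq_Rintegral => y _; rewrite mulrA.
exact: (L1_convolution_local x (@cth n j.+1) (@vth n j.+1) lg).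
Qed.

Lemma test_function_approx n x : test_function (fun y => th n 0%N (x - y)) /\
  forall k, (fun y => th n 0%N (x - y))^`(k)%classic = (fun y => (- n.+1%:R) ^+ k * th n k (x - y)).
Proof.
set s : R := n.+1%:R; have s0 : 0 < s by rewrite ltr0n.
pose e k y := (- s) ^+ k * th n k (x - y).
have de k y : is_derive y 1 (e k) (e k.+1 y).
  have ds : is_derive y 1 (fun y : R => x - y) (- 1).
    by apply: (is_derive_eq (is_deriveB (is_derive_cst x y 1) (is_derive_id y 1))); rewrite sub0r.
  have h := @is_derive1_comp _ (th n k) (fun y : R => x - y) y _ _ (dth n k (x - y)) ds.
  have h2 := is_deriveZ ((- s) ^+ k) h.
  by apply: (is_derive_eq h2); rewrite /GRing.scale/= /e exprS -/s; ring.
have chain k : (fun y => th n 0%N (x - y))^`(k)%classic = e k.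
  rewrite -(@derive1n_chain _ e k (fun j _ => de j) k (leqnn k)); congr (_^`(_)%classic).
  by apply/funext => y; rewrite /e expr0 mul1r.
split => //; split.
  by move=> k y; rewrite chain; case: (de k y).
have [q vq] : exists q : R, vanishes_beyond (th n 0%N) q by exists s^-1; exact: vth.
have out (y : R) : ~~ (x - q <= y <= x + q) -> th n 0%N (x - y) = 0.
  move=> /negP h; apply: vq; rewrite leNgt; apply/negP.
  rewrite ltr_norml => /andP[? ?]; apply: h; apply/andP; split; lra.
apply: (@subclosed_compact _ _ `[x - q, x + q]%classic).
- exact: closed_closure.
- exact: segment_compact.
- have -> : `[x - q, x + q]%classic = closure `[x - q, x + q]%classic :> set R.
    by rewrite -(closure_id _).1//; exact: itv_closed.
  apply: closureS => y /= /eqP ny; rewrite in_itv/=.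
  by apply/negPn/negP => h; apply: ny; exact: out.
Qed.

(** [y |-> th n 0 (x - y)] is a test function; the signs from the reflection and
from the integration by parts cancel. *)
Lemma weak_derivative_convolution n k g w x : weak_derivative k g w ->
  n.+1%:R ^+ k * convolution (th n k) g x = convolution (th n 0%N) w x.
Proof.
move=> [lg lw /(_ _ (test_function_approx n x).1)].
set s : R := n.+1%:R; have s0 : 0 < s by rewrite ltr0n.
rewrite (test_function_approx n x).2 => E.
have lk := L1_convolution_local x (@cth n k) (@vth n k) lg.
have E1 : \int[mu]_y (g y * ((- s) ^+ k * th n k (x - y))) = (- s) ^+ k * convolution (th n k) g x.
  by rewrite /convolution -RintZ//; apply: eq_Rintegral => y _; ring.
have E2 : \int[mu]_y (w y * th n 0%N (x - y)) = convolution (th n 0%N) w x.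
  by apply: eq_Rintegral => y _; rewrite mulrC.
move: E; rewrite E1 E2 (exprNn s k) -mulrA => /(congr1 (fun z => (- 1) ^+ k * z)).
by rewrite !mulrA -!exprMn mulrNN mulr1 expr1n !mul1r.
Qed.

(** The error is at most [2 M] times the average of [|g - g(x)|] over the ball of
radius [1/(n+1)]. *)
Lemma approx_lebesgue_pt g x : locally_integrable setT g -> lebesgue_pt g x ->
  convolution (th n 0%N) g x @[n --> \oo] --> g x.
Proof.
move=> lg ptx; have [_ _ bnd even mass] := Hth.
have M0 : 0 <= M by have /andP[h1 h2] := bnd 0%N 0; rewrite mulr1 in h2; exact: le_trans h2.
have [mg _ _] := lg.
have key n : (`|convolution (th n 0%N) g x - g x|%:E <= (2 * M)%:E * davg g x n.+1%:R^-1)%E.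
  set s : R := n.+1%:R; have s0 : 0 < s by rewrite ltr0n.
  have si0 : 0 < s^-1 by rewrite invr_gt0.
  have l1 := L1_convolution_local x (@cth n 0%N) (@vth n 0%N) lg.
  have mm := mass_reflected_kernel (@cth n 0%N) (@vth n 0%N) (even n) (mass n) x.
  have l2 := L1_reflected_kernel (@cth n 0%N) (@vth n 0%N) (even n) x.
  pose D y := th n 0%N (x - y) * (g y - g x).
  have DE : D = (fun y => th n 0%N (x - y) * g y - g x * th n 0%N (x - y)).
    by apply/funext => y; rewrite /D; ring.
  have lD : L1 D by rewrite DE; apply: L1B => //; exact: L1Z.
  have -> : convolution (th n 0%N) g x - g x = \int[mu]_y D y.
    by rewrite DE RintB//; [rewrite RintZ// mm mulr1|exact: L1Z].
  rewrite (EFin_normr_Rintegral measurableT lD).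
  have mD := measurable_int mu lD.
  apply: (le_trans (le_abse_integral mu measurableT mD)).
  have mc : measurable_fun (ball x s^-1) (fun y => (`|g y - g x|)%:E).
    apply: measurable_funTS; apply/measurable_EFinP.
    apply: measurableT_comp; first exact: normr_measurable.
    by apply: measurable_funB; [exact: mg|exact: measurable_cst].
  have -> : ((2 * M)%:E * davg g x s^-1 =
      \int[mu]_(y in ball x s^-1) ((M * s) * `|g y - g x|)%:E)%E.
    under eq_integral do rewrite EFinM.
    rewrite ge0_integralZl//; last 2 first.
      exact: measurable_ball.
      by rewrite lee_fin mulr_ge0// ltW.
    rewrite /davg /iavg (lebesgue_measure_ball x (ltW si0)).
    have s20 : 0 < s^-1 *+ 2 by rewrite pmulrn_lgt0.
    rewrite inver gt_eqF//.
    rewrite muleA -EFinM; congr (_%:E * _)%E.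
    by rewrite -mulr_natl; field; rewrite gt_eqF.
  rewrite [leRHS]integral_mkcond; apply: ge0_le_integral => //.
  - by apply: measurableT_comp => //.
  - apply/(measurable_restrictT _ (measurable_ball x s^-1)).
    by under eq_fun do rewrite EFinM; exact: measurable_funeM.
  move=> y _; rewrite patchE; case: ifPn => [_|].
    rewrite /= lee_fin normrM ler_wpM2r//.
    by have /andP[h1 h2] := bnd n (x - y); rewrite ger0_norm.
  rewrite notin_setE/= => yb; rewrite /D (vth _); first by rewrite mul0r normr0.
  by rewrite leNgt; apply/negP => h; apply: yb.
have cvr : davg g x n.+1%:R^-1 @[n --> \oo] --> 0%E.
  have sc : n.+1%:R^-1 @[n --> \oo] --> (0 : R)^'+.
    move=> P [e /= e0 HP]; have [N _ HN] := near_infty_natSinv_lt (PosNum e0).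
    exists N => // m /= Nm; apply: HP => //=.
    by rewrite sub0r normrN ger0_norm ?invr_ge0//; exact: HN.
  exact: cvg_comp sc ptx.
have c0 : ((2 * M)%:E * davg g x n.+1%:R^-1 @[n --> \oo] --> 0)%E.
  by rewrite -(mule0 (2 * M)%:E); apply: cvgeZl.
have sq : (`|convolution (th n 0%N) g x - g x|%:E @[n --> \oo] --> 0%:E)%E.
  apply: (@squeeze_cvge _ _ _ _ (fun=> 0%E) _ (fun n => (2 * M)%:E * davg g x n.+1%:R^-1)%E) => //.
  - by apply: nearW => n; rewrite lee_fin normr_ge0 key.
  - exact: cvg_cst.
apply/subr_cvg0; apply: norm_cvg0.
exact: (fine_cvg sq).
Qed.

End approximate_identity.

(** * From the Sobolev class to smooth functions *)

Section omega_minus.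
Context {R : realType}.
Local Notation mu := (@lebesgue_measure R).
Implicit Types (a b x y A e r M : R) (f g u v w : R -> R) (n j : nat).

Lemma wderivP k v : L2_weak_derivative k v !=set0 -> L2_weak_derivative k v (wderiv k v).
Proof. by move=> [w Hw]; exact: (xgetPex (cst 0) (ex_intro _ w Hw)). Qed.

Lemma L2_sqr v : v \in Lfun mu 2%:E -> L1 (fun x => v x ^+ 2).
Proof. exact: Lfun2_integrable_sqr. Qed.

(** Mollify.  If [dual_form] is never positive, [dual_form_gt0_smooth] bounds
[\int (2 W'^2 + ga (W^-)^2)] from above by [\int W''^2 + al \int W^2] for each
mollification [W], hence by the same expression for [v].  Fatou's lemma keeps
only the terms to be bounded from below on the left, so almost everywhere
convergence of [W] and [W'] is enough and strong convergence in [H^2] is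
avoided. *)
Lemma dual_form_gt0 (al be p c : R) (k : R -> R) v :
  1 < al -> be < al -> resolvent_kernel al p c k -> H2 v -> J al be v < 0 ->
  exists2 f, admissible f & 0 < dual_form k (al - be) f.
Proof.
move=> al1 beal Hk [v2L ex1 ex2] Jneg.
set ga := al - be; have ga0 : 0 < ga by rewrite subr_gt0.
have [v1L W1] := wderivP ex1; have [w2L W2] := wderivP ex2.
rewrite /J in Jneg; set v1 := wderiv 1 v in v1L W1 Jneg; set v2 := wderiv 2 v in w2L W2 Jneg.
have [lv lv1 _] := W1; have [_ lv2 _] := W2.
have sv := L2_sqr v2L; have sv1 := L2_sqr v1L; have sv2 := L2_sqr w2L.
have [mv _ _] := lv; have [mv1 _ _] := lv1; have [mv2 _ _] := lv2.
have neg_le u x : u^\- x ^+ 2 <= u x ^+ 2.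
  by rewrite /funrneg; case: (leP (- u x) 0) => h; rewrite ?expr0n ?sqr_ge0//= sqrrN.
have mneg u : measurable_fun setT u -> measurable_fun setT (u^\-).
  move=> mu'; apply: measurable_maxr; last exact: measurable_cst.
  exact: measurableT_comp.
have sn : L1 (fun x => v^\- x ^+ 2).
  apply: (@L1_le _ _ (fun x => v x ^+ 2)) => //; first by apply: measurable_funX; exact: mneg.
  by move=> x; rewrite ger0_norm ?sqr_ge0.
pose B := \int[mu]_x (v2 x ^+ 2) + al * \int[mu]_x (v x ^+ 2).
have JE : \int[mu]_x (v2 x ^+ 2 - 2 * v1 x ^+ 2 + al * (v^\+ x) ^+ 2 + be * (v^\- x) ^+ 2) =
    B - \int[mu]_x (2 * v1 x ^+ 2 + ga * v^\- x ^+ 2).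
  rewrite /B -RintZ// -RintD//; last exact: L1Z.
  rewrite -RintB//; [|by apply: L1D => //; exact: L1Z|by apply: L1D; exact: L1Z].
  apply: eq_Rintegral => x _; rewrite /funrpos /funrneg /ga.
  case: (leP (- v x) 0) => h.
    by rewrite max_l ?expr0n/=; [ring|lra].
  by rewrite max_r; [ring|lra].
rewrite JE in Jneg.
apply: contrapT => nope.
have [th [M Hth]] := @approx_id_exists R.
have [dth vth bnd even mass] := Hth.
have cth n j : continuous (th n j) by exact: is_derive_continuous (dth n j).
have th0 n x : 0 <= th n 0%N x by have /andP[] := bnd n x.
pose W n := convolution (th n 0%N) v.
pose W' n := convolution (th n 0%N) v1.
pose W'' n := convolution (th n 0%N) v2.
have dW n x : is_derive x 1 (W n) (W' n x).
  have h := is_derive_approx Hth n 0 x lv.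
  by apply: (is_derive_eq h); rewrite /W' -(weak_derivative_convolution Hth n x W1) expr1.
have dW' n x : is_derive x 1 (W' n) (W'' n x).
  have -> : W' n = (fun x => n.+1%:R * convolution (th n 1%N) v x).
    by apply/funext => y; rewrite /W' -(weak_derivative_convolution Hth n y W1) expr1.
  have h := is_deriveZ n.+1%:R (is_derive_approx Hth n 1 x lv).
  apply: (is_derive_eq h); rewrite /W'' -(weak_derivative_convolution Hth n x W2) /GRing.scale/=.
  by rewrite expr2 mulrA.
have cW'' n : continuous (W'' n).
  have -> : W'' n = (fun x => n.+1%:R ^+ 2 * convolution (th n 2%N) v x).
    by apply/funext => y; rewrite /W'' -(weak_derivative_convolution Hth n y W2).
  by apply: contZ; exact: is_derive_continuous (fun x => is_derive_approx Hth n 2 x lv).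
have cW n := is_derive_continuous (dW n); have cW' n := is_derive_continuous (dW' n).
have [l0 b0] : (forall n, L1 (fun x => W n x ^+ 2)) /\
   forall n, \int[mu]_x (W n x ^+ 2) <= \int[mu]_x (v x ^+ 2).
  by split=> n; have [] := convolution_L2 (@cth n 0%N) (@th0 n) (@vth n 0%N) (even n) (mass n) lv sv (@cW n).
have l1 n : L1 (fun x => W' n x ^+ 2).
  by have [] := convolution_L2 (@cth n 0%N) (@th0 n) (@vth n 0%N) (even n) (mass n) lv1 sv1 (@cW' n).
have [l2 b2] : (forall n, L1 (fun x => W'' n x ^+ 2)) /\
   forall n, \int[mu]_x (W'' n x ^+ 2) <= \int[mu]_x (v2 x ^+ 2).
  by split=> n; have [] := convolution_L2 (@cth n 0%N) (@th0 n) (@vth n 0%N) (even n) (mass n) lv2 sv2 (@cW'' n).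
have cneg n : continuous ((W n)^\-) by apply: cont_max0 => x; apply: cvgN; exact: cW.
have ln n : L1 (fun x => (W n)^\- x ^+ 2).
  apply: (@L1_le _ _ (fun x => W n x ^+ 2)) => //.
    by apply: continuous_measurable_fun; exact: contX.
  by move=> x; rewrite ger0_norm ?sqr_ge0.
pose F n x := 2 * W' n x ^+ 2 + ga * (W n)^\- x ^+ 2.
have lF n : L1 (F n) by apply: L1D; exact: L1Z.
have FB n : \int[mu]_x F n x <= B.
  have h : \int[mu]_x (ga * (W n)^\- x ^+ 2) <=
      \int[mu]_x (W'' n x ^+ 2 - 2 * W' n x ^+ 2 + al * W n x ^+ 2).
    rewrite leNgt; apply/negP => h; apply: nope.
    exact: (dual_form_gt0_smooth al1 Hk ga0 (dW n) (dW' n) (@cW'' n) (l0 n) (l1 n) (l2 n) h).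
  move: h; rewrite RintD; [|by apply: L1B => //; exact: L1Z|exact: L1Z].
  rewrite RintB//; last exact: L1Z.
  rewrite (RintZ al)// /F RintD; [|exact: L1Z|exact: L1Z].
  have := b2 n; have : al * \int[mu]_x (W n x ^+ 2) <= al * \int[mu]_x (v x ^+ 2).
    by rewrite ler_wpM2l// ltW// (lt_trans _ al1).
  rewrite /B; lra.
pose G x := 2 * v1 x ^+ 2 + ga * v^\- x ^+ 2.
have lG : L1 G by apply: L1D; exact: L1Z.
have F0 n x : 0 <= F n x by rewrite addr_ge0// mulr_ge0 ?sqr_ge0// ltW.
have G0 x : 0 <= G x by rewrite addr_ge0// mulr_ge0 ?sqr_ge0// ltW.
have mF n : measurable_fun setT (EFin \o F n) by apply/measurable_EFinP; exact: L1_measurable (lF n).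
have fat : (\int[mu]_x limn_einf (fun n => (F n x)%:E) <= limn_einf (fun n => \int[mu]_x (F n x)%:E))%E.
  by apply: fatou => // n x _; rewrite lee_fin.
have infB : (limn_einf (fun n => \int[mu]_x (F n x)%:E) <= B%:E)%E.
  rewrite limn_einf_lim; apply: lime_le; first exact: is_cvg_einfs.
  apply: nearW => n; apply: (@le_trans _ _ (\int[mu]_x (F n x)%:E)%E).
    by apply: ereal_inf_lbound; exists n => /=.
  rewrite -[leLHS]fineK; first by rewrite lee_fin; exact: FB.
  by apply: (@integrable_fin_num _ _ _ mu _ measurableT (EFin \o F n)); exact: (lF n).
have aeG : {ae mu, forall x, limn_einf (fun n => (F n x)%:E) = (G x)%:E}.
  have := lebesgue_differentiation lv; have := lebesgue_differentiation lv1.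
  apply: filterS2; first exact: (ae_filter_ringOfSetsType mu).
  move=> x p1 p0.
  have c1 := approx_lebesgue_pt Hth lv1 p1; have c0 := approx_lebesgue_pt Hth lv p0.
  have cF : F n x @[n --> \oo] --> G x.
    apply: cvgD; apply: cvgM; try exact: cvg_cst.
      by apply: cvgM; exact: c1.
    have cn : (W n)^\- x @[n --> \oo] --> v^\- x.
      have cm : continuous (fun z : R => Num.max (- z) 0).
        by apply: cont_max0; exact: opp_continuous.
      exact: (@cvg_comp _ _ _ (fun n => W n x) (fun z : R => Num.max (- z) 0) _ _ _ c0 (cm (v x))).
    by apply: cvgM; exact: cn.
  have cFE : (F n x)%:E @[n --> \oo] --> (G x)%:E by apply: cvg_EFin => //; exact: nearW.
  by have [-> _] := cvg_limn_einf_sup cFE.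
have GB : (\int[mu]_x (G x)%:E <= B%:E)%E.
  apply: le_trans infB; apply: le_trans fat.
  apply: ae_ge0_le_integral => //.
  - by move=> x _; rewrite lee_fin.
  - by apply/measurable_EFinP; exact: L1_measurable lG.
  - move=> x _; rewrite limn_einf_lim; apply: lime_ge; first exact: is_cvg_einfs.
    by apply: nearW => n; apply: le_ereal_inf_tmp => _ [m _ <-]; rewrite lee_fin.
  - under eq_fun do rewrite limn_einf_lim.
    apply: (emeasurable_fun_cvg (fun n x => einfs (fun n => (F n x)%:E) n)).
      by move=> n; exact: (measurable_fun_einfs mF).
    by move=> x _; exact: is_cvg_einfs.
  - apply: filterS aeG; first exact: (ae_filter_ringOfSetsType mu).
    by move=> x -> _.
have fin : \int[mu]_x G x <= B.
  rewrite -lee_fin /Rintegral fineK//.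
  by apply: integrable_fin_num => //; exact: lG.
rewrite -/(G _) in Jneg; move: Jneg; apply/negP; rewrite -leNgt subr_ge0.
exact: fin.
Qed.
End omega_minus.


Theorem theorem1 (R : realType) (a b : R) (hb : 0 < b) (hab : b < a)
  (c : R) (hc : c != 0)
  (hOmega : Omega_minus (4 * a / c ^+ 4, 4 * b / c ^+ 4)) :
  exists u : R -> R -> R, travelling_wave a b c u.
Proof.
have [[/= al1 _] [v Hv Jv]] := hOmega.
have [p [d [k Hk]]] := resolvent_exists al1.
apply: (wave_exists hb hab hc al1 Hk).
apply: (dual_form_gt0 al1 _ Hk Hv Jv).
by rewrite ltr_pM2r ?ltr_pM2l// invr_gt0 exprn_even_gt0.
Qed.
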